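(* Let $N_0\ge 0$ be an integer and let $f$ be a meromorphic function in $\mathbb{C}$, holomorphic at $0$ with $f(0)\neq 0$. Let $\{t_n\}$ and $\{s_n\}$ be the families of poles and of zeros of $f$ in $\mathbb{C}$, respectively, each listed according to multiplicity. Suppose that $$\sum_{n}\frac{1}{|t_n|^{N_0+1}}<+\infty,\qquad \limsup_{r\to\infty}\frac{T(r,f)}{r^{N_0+1}}=0 .$$ Then the following two assertions hold. (1) If $f$ has no zeros in $\mathbb{C}$, then for every integer $N\ge N_0$ $$\sum_{n}\frac{1}{t_n^{N+1}}=\frac{1}{N!}\left(\frac{f'}{f}\right)^{(N)}(0).$$ (2) If $\sum_{n}\frac{1}{|s_n|^{N_0+1}}<+\infty$ and there exists an integer $M\ge N_0+1$ such that for every integer $k\ge 1$ $$\sum_{n}\frac{1}{t_n^{kM}}=\frac{1}{(kM-1)!}\left(\frac{f'}{f}\right)^{(kM-1)}(0),$$ then $f$ has no zeros in $\mathbb{C}$.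
   Context: The families of zeros and poles are countable (finite or empty families are allowed; an empty sum is $0$). Here $T(r,f)$ is the Nevanlinna characteristic: $T(r,f)=m(r,f)+N(r,f)$, where $m(r,f)=\frac{1}{2\pi}\int_0^{2\pi}\ln^+|f(re^{i\varphi})|\,d\varphi$ with $\ln^+x=\max(0,\ln x)$ (and $\ln^+ 0=0$), and, for $f$ without a pole at $0$, $N(r,f)=\sum_{|t_k|<r}\ln\frac{r}{|t_k|}$, the sum being over the poles $t_k$ of $f$ in $|z|<r$ counted with multiplicity. $g^{(N)}$ denotes the $N$-th derivative. *)

(* Defs.v *)
From HB Require Import structures.
From mathcomp Require Import all_boot all_order all_algebra.
From mathcomp Require Import all_classical all_reals all_analysis.
From mathcomp Require Import complex.

Set Implicit Arguments.
Unset Strict Implicit.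
Unset Printing Implicit Defensive.

Import Order.TTheory GRing.Theory Num.Theory.
Import numFieldNormedType.Exports.

Local Open Scope classical_set_scope.
Local Open Scope ring_scope.

(* [R[i]] as a normed space over itself: [derivable f z 1], [f^`()] and
   [f^`(n)] for [f : R[i] -> R[i]] are then complex differentiability and the
   complex derivatives. *)
#[warning="-redundant-canonical-projection"]
HB.instance Definition _ (R : rcfType) := NormedModule.copy R[i] R[i]^o.

Section meromorphic.
Context {R : realType}.
Implicit Types (f : R[i] -> R[i]) (z : R[i]) (m : nat).

Definition cmod z : R := Normc.normc z.

Definition holomorphic_at f z := \forall w \near z, derivable f w 1.

Definition zero_of_order f z m := exists g : R[i] -> R[i],
  [/\ holomorphic_at g z, g z != 0
    & \forall w \near z, f w = (w - z) ^+ m * g w].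

(* The value of [f] at a pole is irrelevant: only a punctured neighbourhood of
   [z] matters. *)
Definition pole_of_order f z m := exists g : R[i] -> R[i],
  [/\ holomorphic_at g z, g z != 0
    & \forall w \near z^', f w = g w / (w - z) ^+ m].

Definition is_pole f z := exists2 m, (0 < m)%N & pole_of_order f z m.

(* Holomorphy is required because the (junk) value of [f] at a pole may be 0. *)
Definition is_zero f z := holomorphic_at f z /\ f z = 0.

(* A meromorphic function on the plane is a total function that is holomorphic
   except at its poles, where its value is arbitrary. *)
Definition meromorphic f := forall z, holomorphic_at f z \/ is_pole f z.

(* Orders are unique when they exist; the multiplicity is 0 at a point that is
   not a zero (resp. not a pole). *)
Definition zero_mult f z : nat :=
  xget 0%N [set m | (0 < m)%N /\ zero_of_order f z m].
Definition pole_mult f z : nat :=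
  xget 0%N [set m | (0 < m)%N /\ pole_of_order f z m].

(* The family [(t n)_(n in D)] lists every point [z] exactly [mult z] times;
   [D] may be any set of indices: empty, finite or infinite. *)
Definition lists (D : set nat) (t : nat -> R[i]) (mult : R[i] -> nat) :=
  forall z, ([set n | D n /\ t n = z] #= `I_(mult z))%card.

(* Partial sums in the order of the indices; the sums of interest converge
   absolutely, so the order is immaterial. *)
Definition has_sum (D : set nat) (u : nat -> R[i]) (v : R[i]) :=
  \sum_(0 <= k < n | k \in D) u k @[n --> \oo] --> v.

(* [ln 0 = 0] in the library, so [lnp 0 = 0]. *)
Definition lnp (x : R) : R := Num.max 0 (ln x).

Definition circle_point (r phi : R) : R[i] :=
  Complex (r * cos phi) (r * sin phi).

Definition nev_m (r : R) f : \bar R :=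
  ((2 * pi)^-1%:E *
   \int[lebesgue_measure]_(phi in `[0%R, (2 * pi)%R])
     (lnp (cmod (f (circle_point r phi))))%:E)%E.

(* Only meant for [f] without a pole at 0. *)
Definition nev_N (r : R) f : \bar R :=
  (\esum_(z in [set z | is_pole f z /\ (cmod z < r)%R])
     (ln (r / cmod z) *+ pole_mult f z)%:E)%E.

Definition nev_T (r : R) f : \bar R := (nev_m r f + nev_N r f)%E.

Definition log_derivative f : R[i] -> R[i] := fun z => (f^`()%classic z) / f z.

End meromorphic.

(* Main.v *)
(* For a radius r that is not the modulus of a zero or a pole, multiply f by the
   Blaschke product of its poles in |z| < r and divide by that of its zeros.  The
   result g is holomorphic and zero-free on the closed disc and has |g| = |f| on
   the circle.  It has a holomorphic logarithm, so the Taylor coefficients of g'/g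
   at 0 are Fourier coefficients of ln |g|; by Jensen's formula the N-th one is
   O((T(r,f) + 1) / r^(N+1)), which is small.  The logarithmic derivatives of the
   Blaschke factors at 0 are explicit, and their parts coming from the reflected
   points r^2 / conj(a) tend to 0 by summability; hence the N-th Taylor coefficient
   of f'/f at 0 is the sum of t_n^-(N+1) minus that of s_n^-(N+1).  This is (1).
   Under the hypotheses of (2) all power sums of the s_n^-M vanish, which is
   impossible for a nonempty family: after normalization, averaging over k
   counts the terms equal to one of largest modulus. *)

Require Import Defs.
From HB Require Import structures.
From mathcomp Require Import all_boot all_order all_algebra.
From mathcomp Require Import all_classical all_reals all_analysis.
From mathcomp Require Import complex.
From mathcomp Require Import ring lra.

Set Implicit Arguments.
Unset Strict Implicit.
Unset Printing Implicit Defensive.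

Import Order.TTheory GRing.Theory Num.Theory.
Import numFieldNormedType.Exports.

Local Open Scope classical_set_scope.
Local Open Scope ring_scope.

(* [Re] and [Im] would otherwise be those of [Num]. *)
Local Notation Re := complex.Re.
Local Notation Im := complex.Im.

(** * Complex limits and derivatives *)

(** The Taylor coefficients of positive index of a holomorphic function are determined by its real
    part on a circle. For a logarithm of [g] this real part is ln |g|, which on the circle equals ln
    |f|; so nothing about arguments is ever estimated. Its absolute value is integrated through |x|
    = 2 max(0, x) - x: the first part gives the proximity term m(r, f), and Jensen's formula turns
    the second into ln |g(0)|. There the poles contribute a sum that completes m(r, f) to T(r, f),
    while the zeros contribute with a favourable sign and are dropped, so that T(r, f) alone
    controls the coefficient.

    Total functions shape the details. The value of [f] at a pole is arbitrary, hence [g] is defined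
    through punctured limits. A multiplicity is positive only where a finite order exists, hence the
    identity theorem is used before every zero is known to be listed.

    Contour integrals run over images of rectangles under a contraction towards an apex, so that one
    form of Goursat's theorem serves both circles (Cauchy's formula) and triangles (primitives). *)

Section complex_norm.
Context {R : realType}.
Implicit Types (z w : R[i]).

Lemma normr_cmod z : `|z| = (cmod z)%:C%C.
Proof. by []. Qed.

Lemma cmod0 : cmod (0 : R[i]) = 0.
Proof. exact: Normc.normc0. Qed.

Lemma cmod1 : cmod (1 : R[i]) = 1.
Proof. exact: Normc.normc1. Qed.

Lemma cmodM z w : cmod (z * w) = cmod z * cmod w.
Proof. exact: Normc.normcM. Qed.

Lemma cmodV z : cmod z^-1 = (cmod z)^-1.
Proof. exact: Normc.normcV. Qed.

Lemma cmod_ge0 z : 0 <= cmod z.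
Proof. by case: z => a b; exact: sqrtr_ge0. Qed.

Lemma cmod_eq0 z : (cmod z == 0) = (z == 0).
Proof.
by apply/eqP/eqP => [/Normc.eq0_normc//|->]; exact: cmod0.
Qed.

Lemma cmod_gt0 z : (0 < cmod z) = (z != 0).
Proof. by rewrite lt_def cmod_eq0 cmod_ge0 andbT. Qed.

Lemma cmodX z n : cmod (z ^+ n) = cmod z ^+ n.
Proof. by elim: n => [|n ih]; rewrite ?expr0 ?cmod1// !exprS cmodM ih. Qed.

Lemma cmodN z : cmod (- z) = cmod z.
Proof. by case: z => a b; rewrite /cmod /= !sqrrN. Qed.

Lemma cmodBC z w : cmod (z - w) = cmod (w - z).
Proof. by rewrite -cmodN opprB. Qed.

Lemma cmodD z w : cmod (z + w) <= cmod z + cmod w.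
Proof. by have := ler_normD z w; rewrite !normr_cmod -rmorphD lecR. Qed.

Lemma cmodB z w : cmod (z - w) <= cmod z + cmod w.
Proof. by rewrite -(cmodN w) cmodD. Qed.

Lemma cmod_sub z w : cmod z - cmod w <= cmod (z - w).
Proof. by rewrite lerBlDr (le_trans _ (cmodD _ _))// subrK. Qed.

Lemma cmod_sum I (r : seq I) (P : pred I) (F : I -> R[i]) :
  cmod (\sum_(i <- r | P i) F i) <= \sum_(i <- r | P i) cmod (F i).
Proof.
elim/big_ind2 : _ => [|x a y b xa yb|//]; first by rewrite cmod0.
by rewrite (le_trans (cmodD _ _))// lerD.
Qed.

Lemma cmodR (x : R) : cmod x%:C%C = `|x|.
Proof. by rewrite /cmod /= expr0n addr0 sqrtr_sqr. Qed.

Lemma cmod_nat n : cmod (n%:R : R[i]) = n%:R.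
Proof. by rewrite -(rmorph_nat (real_complex R)) cmodR ger0_norm. Qed.

Lemma cmod_conj z : cmod z^*%C = cmod z.
Proof. by case: z => a b; rewrite /cmod /= sqrrN. Qed.

Lemma normr_Re z : `|Re z| <= cmod z.
Proof.
case: z => a b; rewrite /cmod /= -sqrtr_sqr ler_sqrt ?addr_ge0 ?sqr_ge0//.
by rewrite lerDl sqr_ge0.
Qed.

Lemma normr_Im z : `|Im z| <= cmod z.
Proof.
case: z => a b; rewrite /cmod /= -sqrtr_sqr ler_sqrt ?addr_ge0 ?sqr_ge0//.
by rewrite lerDr sqr_ge0.
Qed.

Lemma cmod_ReIm z : cmod z <= `|Re z| + `|Im z|.
Proof.
rewrite {1}(complexE z) (le_trans (cmodD _ _))// cmodM !cmodR.
have -> : cmod ('i%C : R[i]) = 1 by rewrite /cmod /= expr0n expr1n add0r sqrtr1.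
by rewrite mul1r.
Qed.

Lemma Complex_Re_Im z : Complex (Re z) (Im z) = z.
Proof. by case: z. Qed.

Lemma cReD z w : Re (z + w) = Re z + Re w. Proof. by case: z w => ? ? [? ?]. Qed.
Lemma cImD z w : Im (z + w) = Im z + Im w. Proof. by case: z w => ? ? [? ?]. Qed.
Lemma cReN z : Re (- z) = - Re z. Proof. by case: z => ? ?. Qed.
Lemma cImN z : Im (- z) = - Im z. Proof. by case: z => ? ?. Qed.
Lemma cReM z w : Re (z * w) = Re z * Re w - Im z * Im w.
Proof. by case: z w => ? ? [? ?]. Qed.
Lemma cImM z w : Im (z * w) = Re z * Im w + Im z * Re w.
Proof. by case: z w => ? ? [? ?]. Qed.

(** In the partial order of [R[i]] a positive element is a positive real, so the epsilon of the
    normed space can be exchanged for one in [R]. *)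
Lemma cvg_cmodP T (F : set_system T) (FF : Filter F) (f : T -> R[i]) (l : R[i]) :
  f x @[x --> F] --> l <->
  forall e : R, 0 < e -> \forall x \near F, cmod (l - f x) < e.
Proof.
split=> [/cvgrPdist_lt h e e0|h].
  have := h (e%:C)%C; rewrite ltcR => /(_ e0); apply: filterS => x.
  by rewrite normr_cmod ltcR.
apply/cvgrPdist_lt => -[e b]; rewrite ltcE /= => /andP[/eqP -> /h].
by apply: filterS => x; rewrite normr_cmod ltcR.
Qed.

Lemma nbhs_cmodP z (P : set R[i]) :
  nbhs z P <-> exists2 e : R, 0 < e & forall w, cmod (w - z) < e -> P w.
Proof.
split=> [/nbhs_ballP -[[e b]]|[e e0 h]].
  rewrite /= ltcE /= => /andP[/eqP -> e0] h; exists e => // w hw; apply: h.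
  by rewrite /ball/= normr_cmod ltcR cmodBC.
apply/nbhs_ballP; exists (e%:C)%C; first by rewrite /= ltcR.
by move=> w; rewrite /ball/= normr_cmod ltcR cmodBC; exact: h.
Qed.

Lemma cvg_ReIm T (F : set_system T) (FF : Filter F) (f : T -> R[i]) (l : R[i]) :
  (Re (f x) @[x --> F] --> Re l) -> (Im (f x) @[x --> F] --> Im l) ->
  f x @[x --> F] --> l.
Proof.
move=> /cvgrPdist_lt hr /cvgrPdist_lt hi; apply/cvg_cmodP => e e0.
have e20 : 0 < e / 2 by rewrite divr_gt0.
near=> x; rewrite (le_lt_trans (cmod_ReIm _))// (splitr e) ltrD//.
  by rewrite cReD cReN; near: x; exact: hr.
by rewrite cImD cImN; near: x; exact: hi.
Unshelve. all: by end_near. Qed.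

Lemma cvg_Re T (F : set_system T) (FF : Filter F) (f : T -> R[i]) (l : R[i]) :
  f x @[x --> F] --> l -> Re (f x) @[x --> F] --> Re l.
Proof.
move=> /cvg_cmodP h; apply/cvgrPdist_lt => e /h; apply: filterS => x.
by apply: le_lt_trans; rewrite -cReN -cReD normr_Re.
Qed.

Lemma cvg_Im T (F : set_system T) (FF : Filter F) (f : T -> R[i]) (l : R[i]) :
  f x @[x --> F] --> l -> Im (f x) @[x --> F] --> Im l.
Proof.
move=> /cvg_cmodP h; apply/cvgrPdist_lt => e /h; apply: filterS => x.
by apply: le_lt_trans; rewrite -cImN -cImD normr_Im.
Qed.

Lemma cvg_cmod T (F : set_system T) (FF : Filter F) (f : T -> R[i]) (l : R[i]) :
  f x @[x --> F] --> l -> cmod (f x) @[x --> F] --> cmod l.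
Proof.
move=> /cvg_cmodP h; apply/cvgrPdist_lt => e /h; apply: filterS => x.
apply: le_lt_trans; rewrite ler_norml cmod_sub andbT lerNl opprB.
by rewrite cmodBC cmod_sub.
Qed.

Lemma cvg_conj T (F : set_system T) (FF : Filter F) (f : T -> R[i]) (l : R[i]) :
  f x @[x --> F] --> l -> (f x)^*%C @[x --> F] --> l^*%C.
Proof.
move=> /cvg_cmodP h; apply/cvg_cmodP => e /h; apply: filterS => x.
by rewrite -rmorphB cmod_conj.
Qed.

Lemma cvg_real_complex (x : R) : y%:C%C @[y --> x] --> (x%:C%C : R[i]).
Proof. by apply: cvg_ReIm => /=; [exact: cvg_id|exact: cvg_cst]. Qed.

End complex_norm.

Section ccvg.
Context {R : realType} {T : Type} {F : set_system T} {FF : Filter F}.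
Implicit Types (f g : T -> R[i]) (a b : R[i]).

(* The generic lemmas are restated at [R[i]] because inferring their instances
   there by unification diverges. *)
Lemma cvgCD f g a b : f y @[y --> F] --> a -> g y @[y --> F] --> b ->
  f y + g y @[y --> F] --> a + b.
Proof. by move=> fa gb; exact: (@cvgD _ _ _ F FF f g a b fa gb). Qed.

Lemma cvgCN f a : f y @[y --> F] --> a -> - f y @[y --> F] --> - a.
Proof. by move=> fa; exact: (@cvgN _ _ _ F FF f a fa). Qed.

Lemma cvgCB f g a b : f y @[y --> F] --> a -> g y @[y --> F] --> b ->
  f y - g y @[y --> F] --> a - b.
Proof. by move=> fa gb; exact: (cvgCD fa (cvgCN gb)). Qed.

Lemma cvgCM f g a b : f y @[y --> F] --> a -> g y @[y --> F] --> b ->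
  f y * g y @[y --> F] --> a * b.
Proof. by move=> fa gb; exact: (@cvgM _ _ F FF f g a b fa gb). Qed.

Lemma cvgCV f a : a != 0 -> f y @[y --> F] --> a -> (f y)^-1 @[y --> F] --> a^-1.
Proof. by move=> a0 fa; exact: (@cvgV _ _ F FF f a a0 fa). Qed.

Lemma cvgCC a : (fun=> a) @ F --> a.
Proof. exact: cvg_cst. Qed.

Lemma cvgC_eq f g a : (\forall y \near F, f y = g y) ->
  f y @[y --> F] --> a -> g y @[y --> F] --> a.
Proof. by move=> fg fa; exact: (cvg_trans (near_eq_cvg fg) fa). Qed.

End ccvg.
Arguments cvgCC {R T F FF} a [t] _.

(** * Differentiability along a map into the complex numbers *)

Section gder.
Context {R : realType} {K : topologicalType}.
Variable j : K -> R[i].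
Implicit Types (f g : K -> R[i]) (x : K) (d e : R[i]).

(* Caratheodory's form of differentiability, common to functions of a complex
   variable ([j] the identity) and of a real one ([j] the embedding of the reals). *)
Definition gder f x d := exists psi : K -> R[i],
  [/\ psi y @[y --> x] --> psi x, psi x = d
    & \forall y \near x, f y = f x + psi y * (j y - j x)].

Hypothesis j_cts : forall x, j y @[y --> x] --> j x.

Lemma gder_cvg f x d : gder f x d -> f y @[y --> x] --> f x.
Proof.
move=> [psi [cpsi _ fE]].
pose proof (cvgCD (cvgCC (f x)) (cvgCM cpsi (cvgCB (@j_cts x) (cvgCC (j x))))) as h.
rewrite subrr mulr0 addr0 in h.
by refine (cvgC_eq _ h); apply: filterS fE => y ->.
Qed.

Lemma gder_near_eq f g x d : {near x, f =1 g} -> gder f x d -> gder g x d.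
Proof.
move=> fg [psi [cpsi psix fE]]; exists psi; split; [exact: cpsi|exact: psix|].
have <- := nbhs_singleton fg.
by near=> y; rewrite -(near fg y)//; near: y.
Unshelve. all: by end_near. Qed.

Lemma gder_cst (c : R[i]) x : gder (fun=> c) x 0.
Proof.
exists (fun=> 0); split; [exact: (cvgCC _)|by []|].
by apply: nearW => y; rewrite mul0r addr0.
Qed.

Lemma gder_id x : gder j x 1.
Proof.
exists (fun=> 1); split; [exact: (cvgCC _)|by []|].
by apply: nearW => y; rewrite mul1r addrC subrK.
Qed.

Lemma gderD f g x d e : gder f x d -> gder g x e ->
  gder (fun y => f y + g y) x (d + e).
Proof.
move=> [p [cp <- fE]] [q [cq <- gE]]; exists (fun y => p y + q y).
split; [exact: (cvgCD cp cq)|by []|].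
near=> y; rewrite (near fE y)// (near gE y)//; ring.
Unshelve. all: by end_near. Qed.

Lemma gderM f g x d e : gder f x d -> gder g x e ->
  gder (fun y => f y * g y) x (d * g x + f x * e).
Proof.
move=> fd ge; have cg := gder_cvg ge.
case: fd ge => [p [cp <- fE]] [q [cq <- gE]].
exists (fun y => p y * g y + f x * q y).
split; [|by []|].
  exact: (cvgCD (cvgCM cp cg) (cvgCM (cvgCC _) cq)).
near=> y; rewrite (near fE y)// (near gE y)//; ring.
Unshelve. all: by end_near. Qed.

Lemma gderZ (c : R[i]) f x d : gder f x d -> gder (fun y => c * f y) x (c * d).
Proof.
by move=> fd; have := gderM (gder_cst c x) fd; rewrite mul0r add0r.
Qed.

Lemma gderN f x d : gder f x d -> gder (fun y => - f y) x (- d).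
Proof.
move=> /(gderZ (-1)); rewrite mulN1r; apply: gder_near_eq.
by apply: nearW => y; rewrite mulN1r.
Qed.

Lemma gderB f g x d e : gder f x d -> gder g x e ->
  gder (fun y => f y - g y) x (d - e).
Proof. by move=> fd ge; apply: gderD => //; exact: gderN. Qed.

Lemma gderX f x d n : gder f x d ->
  gder (fun y => f y ^+ n) x (n%:R * f x ^+ n.-1 * d).
Proof.
move=> fd; elim: n => [|n ih]; first by rewrite !mul0r; exact: gder_cst.
have := gderM fd ih; rewrite [X in gder _ _ X](_ : _ = n.+1%:R * f x ^+ n * d).
  by apply: gder_near_eq; apply: nearW => y; rewrite exprS.
by case: n {ih} => [|n]; rewrite -?[n.+2]addn1 ?natrD/= ?exprS; ring.
Qed.

Lemma gderV f x d : f x != 0 -> gder f x d ->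
  gder (fun y => (f y)^-1) x (- d / f x ^+ 2).
Proof.
move=> fx0 fd; have cf := gder_cvg fd.
case: fd => [p [cp <- fE]].
have fn0 : \forall y \near x, f y != 0.
  have /cvg_cmodP /(_ (cmod (f x))) := cf.
  rewrite cmod_gt0 => /(_ fx0); apply: filterS => y.
  by apply: contraTN => /eqP ->; rewrite subr0 ltxx.
exists (fun y => - p y / (f y * f x)); split; [|by rewrite expr2|].
  have fx20 : f x * f x != 0 by rewrite mulf_neq0.
  exact: (cvgCM (cvgCN cp) (cvgCV fx20 (cvgCM cf (cvgCC _)))).
near=> y; have pE : p y * (j y - j x) = f y - f x.
  by rewrite (near fE y)// addrAC subrr add0r.
rewrite mulrAC mulNr pE; field; apply/andP; split => //.
by near: y.
Unshelve. all: by end_near. Qed.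

(** The hypothesis on [H] is [gder id] written out: inside this section [gder] is tied to the
    variable [j], whereas [H] is a function of a complex variable. *)
Lemma gder_comp (H : R[i] -> R[i]) f x d e :
  (exists psi : R[i] -> R[i], [/\ psi y @[y --> f x] --> psi (f x), psi (f x) = d
    & \forall y \near f x, H y = H (f x) + psi y * (y - f x)]) ->
  gder f x e -> gder (fun y => H (f y)) x (d * e).
Proof.
move=> [p [cp <- HE]] fe; have cf := gder_cvg fe.
case: fe => [q [cq <- fE]].
exists (fun y => p (f y) * q y); split; [|by []|].
  exact: (cvgCM (cvg_comp f p cf cp) cq).
have HE' : \forall y \near x, H (f y) = H (f x) + p (f y) * (f y - f x).
  exact: (cf _ HE).
near=> y; rewrite (near HE' y)//; congr (_ + _).
by rewrite -mulrA; congr (_ * _); rewrite (near fE y)// addrAC subrr add0r.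
Unshelve. all: by end_near. Qed.

End gder.

Section cder.
Context {R : realType}.
Implicit Types (f g : R[i] -> R[i]) (z d e : R[i]).

Definition cder f z d := gder id f z d.

Lemma cvg_nbhs_cmodP f z d : f y @[y --> z] --> d <->
  forall e : R, 0 < e -> exists2 e' : R, 0 < e' &
    forall w, cmod (w - z) < e' -> cmod (d - f w) < e.
Proof.
split=> [h e e0|h].
  by apply/nbhs_cmodP; move/cvg_cmodP : h => /(_ _ e0).
apply: (proj2 (cvg_cmodP (nbhs_filter z) f d)) => e /h h1.
exact/nbhs_cmodP.
Qed.

Lemma cder_derive1 f z d : cder f z d -> derivable f z 1 /\ f^`()%classic z = d.
Proof.
move=> [psi [cpsi psiz fE]].
have h1 : (h^-1 *: ((f \o shift z) h - f z) : R[i]) @[h --> (0:R[i])^'] --> d.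
  rewrite -psiz; apply/cvg_cmodP => e e0.
  have /cvg_cmodP /(_ _ e0) /nbhs_cmodP[d1 d10 h1] := cpsi.
  have /nbhs_cmodP[d2 d20 h2] := fE.
  suff : \forall h \near (0 : R[i]), h != 0 -> 
      cmod (psi z - h^-1 *: ((f \o shift z) h - f z)) < e by [].
  apply/nbhs_cmodP; exists (Num.min d1 d2); first by rewrite lt_min d10.
  move=> h; rewrite subr0 lt_min => /andP[hd1 hd2] h0 /=.
  have /h2 -> : cmod (h + z - z) < d2 by rewrite addrK.
  rewrite addrAC subrr add0r addrK [_ *: _]mulrC mulfK//.
  by apply: h1; rewrite addrK.
have h2 : h^-1 *: ((f \o shift z) (h *: (1:R[i])) - f z) @[h --> (0:R[i])^'] --> d.
  rewrite [X in X @ _ --> _](_ : _ = (fun h => h^-1 *: ((f \o shift z) h - f z) : R[i]))//.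
  by apply/funext => h; rewrite [h *: 1]mulr1.
split; first by apply/cvg_ex; exists d.
by apply: cvg_lim h1; exact: norm_hausdorff.
Qed.

Lemma derivable_cder f z : derivable f z 1 -> cder f z (f^`()%classic z).
Proof.
move=> /cvg_ex[d hd].
suff fd : cder f z d by have [_ ->] := cder_derive1 fd.
exists (fun y => if y == z then d else (f y - f z) / (y - z)); split.
- rewrite eqxx; apply/cvg_nbhs_cmodP => e e0.
  have /cvg_cmodP /(_ _ e0) hd' := hd.
  have /nbhs_cmodP[e' e'0 h] : \forall h \near (0 : R[i]), h != 0 ->
    cmod (d - h^-1 *: ((f \o shift z) (h *: (1 : R[i])) - f z)) < e by exact: hd'.
  exists e' => // y yz; case: eqP => [_|/eqP yz0].
    by rewrite subrr cmod0.
  have := h (y - z); rewrite subr0 subr_eq0 yz => /(_ isT yz0).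
  by rewrite [_ *: 1]mulr1 /= subrK [_ *: _]mulrC.
- by rewrite eqxx.
- apply/nbhs_cmodP; exists 1 => // y _; case: eqP => [->|/eqP yz].
    by rewrite subrr mulr0 addr0.
  by rewrite divfK ?subr_eq0// addrC subrK.
Qed.

Lemma cvg_idC z : y @[y --> z] --> z.
Proof. exact: (@cvg_id _ (nbhs z)). Qed.

Lemma cder_cvg f z d : cder f z d -> f y @[y --> z] --> f z.
Proof. exact: (gder_cvg cvg_idC). Qed.

Lemma cder_near_eq f g z d : {near z, f =1 g} -> cder f z d -> cder g z d.
Proof. exact: gder_near_eq. Qed.

Lemma cder_cst (c z : R[i]) : cder (fun=> c) z 0.
Proof. exact: gder_cst. Qed.

Lemma cder_id z : cder id z 1.
Proof. exact: gder_id. Qed.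

Lemma cderD f g z d e : cder f z d -> cder g z e ->
  cder (fun y => f y + g y) z (d + e).
Proof. exact: gderD. Qed.

Lemma cderN f z d : cder f z d -> cder (fun y => - f y) z (- d).
Proof. exact: (gderN cvg_idC). Qed.

Lemma cderB f g z d e : cder f z d -> cder g z e ->
  cder (fun y => f y - g y) z (d - e).
Proof. exact: (gderB cvg_idC). Qed.

Lemma cderM f g z d e : cder f z d -> cder g z e ->
  cder (fun y => f y * g y) z (d * g z + f z * e).
Proof. exact: (gderM cvg_idC). Qed.

Lemma cderZ (c : R[i]) f z d : cder f z d -> cder (fun y => c * f y) z (c * d).
Proof. exact: (gderZ cvg_idC). Qed.

Lemma cderX f z d n : cder f z d ->
  cder (fun y => f y ^+ n) z (n%:R * f z ^+ n.-1 * d).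
Proof. exact: (gderX cvg_idC). Qed.

Lemma cderV f z d : f z != 0 -> cder f z d ->
  cder (fun y => (f y)^-1) z (- d / f z ^+ 2).
Proof. exact: (gderV cvg_idC). Qed.

End cder.

Section rder.
Context {R : realType}.
Implicit Types (f g : R -> R[i]) (x : R) (d e : R[i]).

Definition rder f x d := gder (fun x : R => x%:C%C) f x d.

Lemma rder_cvg f x d : rder f x d -> f y @[y --> x] --> f x.
Proof. exact: (gder_cvg (@cvg_real_complex R)). Qed.

Lemma is_derive_cvgP (f : R -> R) x (d : R) :
  is_derive x 1 f d <-> h^-1 * (f (h + x) - f x) @[h --> 0^'] --> d.
Proof.
have E : (fun h => h^-1 *: ((f \o shift x) (h *: (1:R)) - f x)) =
   (fun h => h^-1 * (f (h + x) - f x)).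
  by apply/funext => h /=; rewrite /GRing.scale/= mulr1.
split => [[/cvg_ex[l lh] <-]|h].
  by rewrite /derive E; rewrite E in lh; rewrite (cvg_lim _ lh).
split; first by apply/cvg_ex; exists d; rewrite E.
by rewrite /derive E; exact/cvg_lim.
Qed.

Lemma rder_is_derive f x d : rder f x d ->
  is_derive x 1 (fun y => Re (f y)) (Re d) /\
  is_derive x 1 (fun y => Im (f y)) (Im d).
Proof.
move=> [psi [cpsi <- fE]].
have sx : h + x @[h --> (0:R)^'] --> x.
  apply/cvgrPdist_lt => e e0; near=> h.
  by rewrite opprD addrCA subrr addr0 normrN; near: h; exact: dnbhs0_lt.
have c2 : psi (h + x) @[h --> (0:R)^'] --> psi x.
  exact: (cvg_comp (fun h => h + x) psi sx cpsi).
have E : \forall h \near (0 : R)^', f (h + x) = f x + psi (h + x) * (h%:C)%C.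
  have E : \forall h \near (0 : R)^',
      f (h + x) = f x + psi (h + x) * ((h + x)%:C - x%:C)%C by exact: (sx _ fE).
  by near=> h; rewrite (near E h)// -rmorphB addrK.
split; apply/is_derive_cvgP.
  refine (cvg_trans (near_eq_cvg _) (cvg_Re _ c2)).
  near=> h; rewrite (near E h)// cReD cReM /= mulr0 subr0 addrAC subrr add0r mulrC.
  by rewrite mulfK//; near: h; exact: nbhs_dnbhs_neq.
refine (cvg_trans (near_eq_cvg _) (cvg_Im _ c2)).
near=> h; rewrite (near E h)// cImD cImM /= mulr0 add0r addrAC subrr add0r mulrC.
by rewrite mulfK//; near: h; exact: nbhs_dnbhs_neq.
Unshelve. all: by end_near. Qed.

Lemma is_derive_rder (f : R -> R) x (d : R) : is_derive x 1 f d ->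
  rder (fun y => (f y)%:C%C) x (d%:C%C).
Proof.
move=> /is_derive_cvgP fd.
exists (fun y => (if y == x then d else (f y - f x) / (y - x))%:C%C); split.
- rewrite eqxx; apply: cvg_ReIm => /=; last exact: cvg_cst.
  apply/cvgrPdist_lt => e e0.
  have /cvgrPdist_lt /(_ _ e0) := fd.
  move=> /nbhs_ballP[e' /= e'0 h].
  apply/nbhs_ballP; exists e' => // y yz /=; case: eqP => [_|/eqP yz0].
    by rewrite subrr normr0.
  have := h (y - x); rewrite /ball/= sub0r normrN distrC => /(_ yz).
  by rewrite subr_eq0 => /(_ yz0); rewrite subrK mulrC.
- by rewrite eqxx.
- apply/nbhs_ballP; exists 1 => [|y _] /=; first exact: ltr01.
  rewrite -rmorphB -rmorphM -rmorphD; congr (_%:C)%C.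
  case: eqP => [->|/eqP yz]; first by rewrite subrr mulr0 addr0.
  by rewrite divfK ?subr_eq0// addrC subrK.
Qed.

Lemma rder_cst (c : R[i]) x : rder (fun=> c) x 0.
Proof. exact: gder_cst. Qed.

Lemma rder_real x : rder (fun x => x%:C%C) x 1.
Proof. exact: gder_id. Qed.

Lemma rderD f g x d e : rder f x d -> rder g x e ->
  rder (fun y => f y + g y) x (d + e).
Proof. exact: gderD. Qed.

Lemma rderB f g x d e : rder f x d -> rder g x e ->
  rder (fun y => f y - g y) x (d - e).
Proof. exact: (gderB (@cvg_real_complex R)). Qed.

Lemma rderM f g x d e : rder f x d -> rder g x e ->
  rder (fun y => f y * g y) x (d * g x + f x * e).
Proof. exact: (gderM (@cvg_real_complex R)). Qed.

Lemma rderZ (c : R[i]) f x d : rder f x d -> rder (fun y => c * f y) x (c * d).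
Proof. exact: (gderZ (@cvg_real_complex R)). Qed.

Lemma rderX f x d n : rder f x d ->
  rder (fun y => f y ^+ n) x (n%:R * f x ^+ n.-1 * d).
Proof. exact: (gderX (@cvg_real_complex R)). Qed.

Lemma rder_comp (H : R[i] -> R[i]) f x d e :
  cder H (f x) d -> rder f x e -> rder (fun y => H (f y)) x (d * e).
Proof. exact: (gder_comp (@cvg_real_complex R)). Qed.

End rder.

(** * Integrals of complex functions of a real variable *)

Section rint.
Context {R : realType}.
Local Notation mu := (@lebesgue_measure R).
Implicit Types (f g F : R -> R) (a b c x : R).

Definition rcont a b f := forall x, a <= x <= b -> f y @[y --> x] --> f x.

Lemma rcont_within a b f : rcont a b f -> {within `[a, b], continuous f}.
Proof.
move=> cf; apply: continuous_in_subspaceT => x.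
by rewrite inE /= in_itv /=; exact: cf.
Qed.

Lemma rcont_integrable a b f : rcont a b f -> mu.-integrable `[a, b] (EFin \o f).
Proof.
move=> /rcont_within cf.
by apply: continuous_compact_integrable => //; exact: segment_compact.
Qed.

Lemma rint_FTC a b f F : a <= b -> rcont a b f ->
  (forall x, a <= x <= b -> is_derive x 1 F (f x)) ->
  \int[mu]_(x in `[a, b]) f x = F b - F a.
Proof.
rewrite le_eqVlt => /predU1P[<-|ab] cf dF.
  by rewrite set_itv1 Rintegral_set1 subrr.
have cF x : a <= x <= b -> F y @[y --> x] --> F x.
  by move=> /dF dFx; apply: differentiable_continuous; apply/derivable1_diffP.
rewrite /Rintegral (@continuous_FTC2 _ f F)//.
- exact: rcont_within.
- split.
  + by move=> x; rewrite in_itv /= => /andP[ax xb]; apply: ex_derive; apply: dF; rewrite !ltW.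
  + by apply: cvg_at_right_filter; apply: cF; rewrite lexx ltW.
  + by apply: cvg_at_left_filter; apply: cF; rewrite lexx ltW.
- move=> x; rewrite in_itv /= => /andP[ax xb].
  have /dF dFx : a <= x <= b by rewrite !ltW.
  by rewrite derive1E derive_val.
Qed.

Lemma rint_split a m b f : a <= m <= b -> rcont a b f ->
  \int[mu]_(x in `[a, b]) f x =
  \int[mu]_(x in `[a, m]) f x + \int[mu]_(x in `[m, b]) f x.
Proof.
move=> /andP[am mb] cf; have intf := rcont_integrable cf.
have := @Rintegral_itvB _ f (BLeft a) (BRight b) m intf.
rewrite !bnd_simp => /(_ am mb) E.
have <- : \int[mu]_(x in `]m, b]) f x = \int[mu]_(x in `[m, b]) f x.
  apply: Rintegral_itv_obnd_cbnd.
  by apply: integrableS intf => //; apply: subset_itvr; rewrite bnd_simp.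
by rewrite -E addrC subrK.
Qed.

Lemma rint_le a b f M : a <= b -> rcont a b f ->
  (forall x, a <= x <= b -> `|f x| <= M) ->
  `|\int[mu]_(x in `[a, b]) f x| <= M * (b - a).
Proof.
move=> ab cf fM.
have intf := rcont_integrable cf.
apply: le_trans (le_normr_Rintegral _ intf) _ => //.
have -> : M * (b - a) = \int[mu]_(x in `[a, b]) M.
  by rewrite Rintegral_cst//= lebesgue_measure_itv/= lte_fin;
    case: ltgtP ab => //= -> _; rewrite subrr.
apply: le_Rintegral => //.
- exact: (integrable_norm intf).
- by apply: (@rcont_integrable a b (fun=> M)) => x _; exact: cvg_cst.
Qed.

End rint.

Section cint.
Context {R : realType}.
Local Notation mu := (@lebesgue_measure R).
Implicit Types (f g F : R -> R[i]) (a b x : R).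

Definition ccont a b f := forall x, a <= x <= b -> f y @[y --> x] --> f x.

Definition cint a b f : R[i] :=
  Complex (\int[mu]_(x in `[a, b]) Re (f x)) (\int[mu]_(x in `[a, b]) Im (f x)).

Lemma ccont_Re a b f : ccont a b f -> rcont a b (fun x => Re (f x)).
Proof. by move=> cf x /cf h; exact: (cvg_Re _ h). Qed.

Lemma ccont_Im a b f : ccont a b f -> rcont a b (fun x => Im (f x)).
Proof. by move=> cf x /cf h; exact: (cvg_Im _ h). Qed.

Lemma ccont_cst a b (c : R[i]) : ccont a b (fun=> c).
Proof. by move=> x _; exact: cvg_cst. Qed.

Lemma ccontD a b f g : ccont a b f -> ccont a b g -> ccont a b (fun x => f x + g x).
Proof. by move=> cf cg x xab; exact: (cvgCD (cf _ xab) (cg _ xab)). Qed.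

Lemma ccontN a b f : ccont a b f -> ccont a b (fun x => - f x).
Proof. by move=> cf x xab; exact: (cvgCN (cf _ xab)). Qed.

Lemma ccontB a b f g : ccont a b f -> ccont a b g -> ccont a b (fun x => f x - g x).
Proof. by move=> cf cg x xab; exact: (cvgCB (cf _ xab) (cg _ xab)). Qed.

Lemma ccontM a b f g : ccont a b f -> ccont a b g -> ccont a b (fun x => f x * g x).
Proof. by move=> cf cg x xab; exact: (cvgCM (cf _ xab) (cg _ xab)). Qed.

Lemma ccontV a b f : (forall x, a <= x <= b -> f x != 0) -> ccont a b f ->
  ccont a b (fun x => (f x)^-1).
Proof. by move=> f0 cf x xab; exact: (cvgCV (f0 _ xab) (cf _ xab)). Qed.

Lemma ccontX a b f n : ccont a b f -> ccont a b (fun x => f x ^+ n).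
Proof.
move=> cf; elim: n => [|n ih]; first exact: ccont_cst.
have -> : (fun x => f x ^+ n.+1) = (fun x => f x * f x ^+ n).
  by apply/funext => x; rewrite exprS.
exact: ccontM.
Qed.

Lemma ccont_conj a b f : ccont a b f -> ccont a b (fun x => (f x)^*%C).
Proof. by move=> cf x /cf h; exact: (cvg_conj _ h). Qed.

Lemma ccont_sub a b a' b' f : a' <= a -> b <= b' -> ccont a' b' f -> ccont a b f.
Proof.
move=> aa bb cf x /andP[ax xb]; apply: cf.
by rewrite (le_trans aa ax) (le_trans xb bb).
Qed.

Lemma eq_cint a b f g : (forall x, a <= x <= b -> f x = g x) -> cint a b f = cint a b g.
Proof.
move=> fg; congr Complex; apply: eq_Rintegral => x;
  by rewrite inE/= in_itv/= => /fg ->.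
Qed.

Lemma cintD a b f g : ccont a b f -> ccont a b g ->
  cint a b (fun x => f x + g x) = cint a b f + cint a b g.
Proof.
move=> cf cg; apply/eqP; rewrite eq_complex cReD cImD; apply/andP; split; apply/eqP => /=.
  under eq_Rintegral do rewrite cReD.
  by rewrite RintegralD//; apply: rcont_integrable; exact: ccont_Re.
under eq_Rintegral do rewrite cImD.
by rewrite RintegralD//; apply: rcont_integrable; exact: ccont_Im.
Qed.

Lemma cintZ a b (c : R[i]) f : ccont a b f ->
  cint a b (fun x => c * f x) = c * cint a b f.
Proof.
move=> cf; have ir := rcont_integrable (ccont_Re cf).
have ii := rcont_integrable (ccont_Im cf).
have irZ (r : R) : mu.-integrable `[a, b] (EFin \o (fun x => r * Re (f x))).
  by apply: rcont_integrable => x /(ccont_Re cf) h; apply: cvgM h; exact: cvg_cst.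
have iiZ (r : R) : mu.-integrable `[a, b] (EFin \o (fun x => r * Im (f x))).
  by apply: rcont_integrable => x /(ccont_Im cf) h; apply: cvgM h; exact: cvg_cst.
apply/eqP; rewrite eq_complex cReM cImM; apply/andP; split; apply/eqP => /=.
  under eq_Rintegral do rewrite cReM.
  by rewrite (RintegralB _ (irZ _) (iiZ _))// !RintegralZl.
under eq_Rintegral do rewrite cImM.
by rewrite (RintegralD _ (iiZ _) (irZ _))// !RintegralZl.
Qed.

Lemma cintN a b f : ccont a b f -> cint a b (fun x => - f x) = - cint a b f.
Proof.
move=> cf; rewrite -mulN1r -cintZ//; apply: eq_cint => x _.
by rewrite mulN1r.
Qed.

Lemma cintB a b f g : ccont a b f -> ccont a b g ->
  cint a b (fun x => f x - g x) = cint a b f - cint a b g.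
Proof.
by move=> cf cg; rewrite -(cintN cg) -(cintD cf (ccontN cg)).
Qed.

Lemma cint_cst a b (c : R[i]) : a <= b -> cint a b (fun=> c) = c * (b - a)%:C%C.
Proof.
move=> ab.
have leb : fine (mu `[a, b]) = b - a.
  by rewrite lebesgue_measure_itv/= lte_fin; case: ltgtP ab => //= -> _; rewrite subrr.
rewrite /cint !Rintegral_cst//= leb; apply/eqP.
by rewrite eq_complex cReM cImM /= !mulr0 subr0 add0r !eqxx.
Qed.

Lemma cint_conj a b f : ccont a b f ->
  cint a b (fun x => (f x)^*%C) = (cint a b f)^*%C.
Proof.
move=> cf; apply/eqP; rewrite eq_complex; apply/andP; split; apply/eqP => /=.
  by apply: eq_Rintegral => x _; case: (f x).
rewrite -mulN1r -RintegralZl//; last exact: rcont_integrable (ccont_Im cf).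
by apply: eq_Rintegral => x _; rewrite mulN1r; case: (f x).
Qed.

Lemma cint_split a m b f : a <= m <= b -> ccont a b f ->
  cint a b f = cint a m f + cint m b f.
Proof.
move=> amb cf; apply/eqP; rewrite eq_complex cReD cImD; apply/andP.
by split; apply/eqP; apply: rint_split => //; [exact: ccont_Re|exact: ccont_Im].
Qed.

(** The factor 2 comes from bounding the real and imaginary parts separately; it is harmless because
    only orders of magnitude matter in the uses. *)
Lemma cint_le a b f M : a <= b -> ccont a b f ->
  (forall x, a <= x <= b -> cmod (f x) <= M) ->
  cmod (cint a b f) <= 2 * M * (b - a).
Proof.
move=> ab cf fM; apply: le_trans (cmod_ReIm _) _.
rewrite -mulrA mulr_natl mulr2n lerD//=.
  by apply: rint_le => //; [exact: ccont_Re|move=> x /fM; apply: le_trans; exact: normr_Re].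
by apply: rint_le => //; [exact: ccont_Im|move=> x /fM; apply: le_trans; exact: normr_Im].
Qed.

Lemma cint_FTC a b f F : a <= b -> ccont a b f ->
  (forall x, a <= x <= b -> rder F x (f x)) -> cint a b f = F b - F a.
Proof.
move=> ab cf dF; apply/eqP; rewrite eq_complex cReD cImD cReN cImN; apply/andP.
split; apply/eqP => /=.
  apply: (@rint_FTC _ a b _ (fun x => Re (F x))) => //; first exact: ccont_Re.
  by move=> x /dF /rder_is_derive[].
apply: (@rint_FTC _ a b _ (fun x => Im (F x))) => //; first exact: ccont_Im.
by move=> x /dF /rder_is_derive[].
Qed.

End cint.

(** * Goursat's theorem and Cauchy's formula *)

Section bisection.
Context {R : realType}.
Implicit Types (a b c d x y : R).

Lemma nested_intervals (u v : nat -> R) : (forall n, u n <= u n.+1) ->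
  (forall n, v n.+1 <= v n) -> (forall n, u n <= v n) ->
  exists x, forall n, u n <= x <= v n.
Proof.
move=> uS vS uv.
have umono : {homo u : m n / (m <= n)%N >-> m <= n}.
  by apply: homo_leq => // y x z; exact: le_trans.
have vmono : {homo v : m n / (m <= n)%N >-> n <= m}.
  by apply: homo_leq => // y x z yx zy; exact: le_trans zy yx.
have uvmn m n : u m <= v n.
  have [mn|nm] := leqP m n; first exact: le_trans (umono _ _ mn) (uv n).
  exact: le_trans (uv m) (vmono _ _ (ltnW nm)).
have u0 : range u !=set0 by exists (u 0%N), 0%N.
exists (sup (range u)) => n; apply/andP; split; last first.
  by apply: ge_sup => // _ [m _ <-].
by apply: ub_le_sup; [exists (v 0%N) => _ [m _ <-]|exists n].
Qed.

Lemma half_pow_lt (k e : R) : 0 <= k -> 0 < e -> exists n, k / 2 ^+ n < e.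
Proof.
move=> k0 e0; exists (Num.bound (k / e)).
rewrite ltr_pdivrMr ?exprn_gt0// mulrC -ltr_pdivrMr//.
apply: (lt_le_trans (archi_boundP _)); first by rewrite divr_ge0// ltW.
by rewrite -natrX ler_nat ltnW// ltn_expl.
Qed.

Lemma half_subl a b : (a + b) / 2 - a = (b - a) / 2.
Proof. by field. Qed.

Lemma half_subr a b : b - (a + b) / 2 = (b - a) / 2.
Proof. by field. Qed.

Definition child_itv (p q : R * R) :=
  q = (p.1, (p.1 + p.2) / 2) \/ q = ((p.1 + p.2) / 2, p.2).

Lemma child_itvP p q : child_itv p q -> p.1 <= p.2 ->
  [/\ p.1 <= q.1, q.2 <= p.2, q.1 <= q.2 & q.2 - q.1 = (p.2 - p.1) / 2].
Proof. by case: p q => [a b] [c d] [] [-> ->] /= ab; split; lra. Qed.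

(** Compactness of a rectangle as an induction principle. If [P] failed, some quarter of each bad
    rectangle would be bad again; the nested bad rectangles shrink to a point, around which the
    local hypothesis contradicts them. It serves both Goursat's theorem and [disc_enlarge]. *)
Lemma rect_bisection (P : R * R -> R * R -> Prop) (I J : R * R) :
  I.1 <= I.2 -> J.1 <= J.2 ->
  (forall p q, I.1 <= p.1 -> p.1 <= p.2 -> p.2 <= I.2 ->
     J.1 <= q.1 -> q.1 <= q.2 -> q.2 <= J.2 ->
     (forall p' q', child_itv p p' -> child_itv q q' -> P p' q') -> P p q) ->
  (forall x y, I.1 <= x <= I.2 -> J.1 <= y <= J.2 ->
     exists2 e, 0 < e & forall p q,
      I.1 <= p.1 <= x -> x <= p.2 <= I.2 -> J.1 <= q.1 <= y -> y <= q.2 <= J.2 ->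
      p.2 - p.1 < e -> q.2 - q.1 < e -> P p q) ->
  P I J.
Proof.
move=> I12 J12 hsub hloc; apply: contrapT => nP.
pose ok (r : (R * R) * (R * R)) := [/\ I.1 <= r.1.1, r.1.1 <= r.1.2 & r.1.2 <= I.2] /\
  [/\ J.1 <= r.2.1, r.2.1 <= r.2.2, r.2.2 <= J.2 & ~ P r.1 r.2].
(* The implication makes the choice total: at a rectangle that is not [ok] the successor is
   arbitrary. *)
have step r : exists r', ok r -> [/\ child_itv r.1 r'.1, child_itv r.2 r'.2 & ~ P r'.1 r'.2].
  have [okr|nok] := pselect (ok r); last by exists r.
  move: okr => [[r1 r2 r3] [r4 r5 r6 r7]].
  apply: contrapT => H; apply: r7; apply: hsub => // p' q' cp cq.
  by apply: contrapT => nP'; apply: H; exists (p', q').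
have [next nextP] := choice step.
pose s n := iter n next (I, J).
have ok_s n : ok (s n).
  elim: n => [|n ih]; first by do !split.
  have [cp cq nP'] := nextP _ ih.
  move: ih => [[r1 r2 r3] [r4 r5 r6 r7]].
  have [h1 h2 h3 _] := child_itvP cp r2.
  have [k1 k2 k3 _] := child_itvP cq r5.
  by do !split => //=; [exact: le_trans h1|exact: le_trans r3|exact: le_trans k1|exact: le_trans r6].
have child n := nextP _ (ok_s n).
have lens n : (s n).1.2 - (s n).1.1 = (I.2 - I.1) / 2 ^+ n /\
   (s n).2.2 - (s n).2.1 = (J.2 - J.1) / 2 ^+ n.
  elim: n => [|n [ih1 ih2]]; first by rewrite !expr0 !divr1.
  have [cp cq _] := child n; have [[_ r2 _] [_ r5 _ _]] := ok_s n.
  have [_ _ _ h] := child_itvP cp r2.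
  have [_ _ _ k] := child_itvP cq r5.
  by rewrite /= h k ih1 ih2 exprSr invfM !mulrA.
have [x xP] : exists x, forall n, (s n).1.1 <= x <= (s n).1.2.
  apply: nested_intervals => n; have [[_ r2 _] [_ r5 _ _]] := ok_s n => //;
  by have [cp cq _] := child n; have [] := child_itvP cp r2.
have [y yP] : exists y, forall n, (s n).2.1 <= y <= (s n).2.2.
  apply: nested_intervals => n; have [[_ r2 _] [_ r5 _ _]] := ok_s n => //;
  by have [cp cq _] := child n; have [] := child_itvP cq r5.
have [e e0 he] := hloc x y (xP 0%N) (yP 0%N).
have len_ge0 : 0 <= Num.max (I.2 - I.1) (J.2 - J.1) by rewrite le_max subr_ge0 I12.
have [n hn] := half_pow_lt len_ge0 e0.
have [[r1 r2 r3] [r4 r5 r6 r7]] := ok_s n; apply: r7.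
have /andP[x1 x2] := xP n; have /andP[y1 y2] := yP n; have [l1 l2] := lens n.
apply: he; rewrite ?r1 ?r3 ?r4 ?r6 ?x1 ?x2 ?y1 ?y2//.
- by rewrite l1; apply: le_lt_trans hn; rewrite ler_pM2r ?invr_gt0 ?exprn_gt0// le_max lexx.
- by rewrite l2; apply: le_lt_trans hn; rewrite ler_pM2r ?invr_gt0 ?exprn_gt0// le_max lexx orbT.
Qed.

End bisection.

(** * Goursat's theorem on the cone over a curve *)

Section goursat.
Context {R : realType}.
Variables (F : R[i] -> R[i]) (w : R[i]) (zeta dzeta : R -> R[i]) (I J : R * R).
Variable L : R.
Hypotheses (I0 : 0 <= I.1) (I12 : I.1 <= I.2) (I1 : I.2 <= 1) (J12 : J.1 <= J.2).
Hypothesis dzetaP : forall phi, J.1 <= phi <= J.2 -> rder zeta phi (dzeta phi).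
Hypothesis dzeta_cont : ccont J.1 J.2 dzeta.
Hypothesis L0 : 0 < L.
Hypothesis zetaL : forall phi, J.1 <= phi <= J.2 -> cmod (zeta phi - w) <= L.
Hypothesis dzetaL : forall phi, J.1 <= phi <= J.2 -> cmod (dzeta phi) <= L.

(** The segment from the apex [w] (at s = 0) to the curve [zeta] (at s = 1). A circle for [zeta]
    gives polar-like coordinates on a disc, a segment gives a triangle. *)
Definition cone (s phi : R) : R[i] := w + s%:C%C * (zeta phi - w).

Definition cone_side (f : R[i] -> R[i]) a b phi :=
  cint a b (fun s => f (cone s phi) * (zeta phi - w)).

Definition cone_arc (f : R[i] -> R[i]) c d s :=
  cint c d (fun phi => f (cone s phi) * (s%:C%C * dzeta phi)).

(** The contour integral of [f] along the image under [cone] of the boundary of the rectangle [p]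
    times [q]. *)
Definition cone_loop f (p q : R * R) :=
  cone_side f p.1 p.2 q.1 - cone_side f p.1 p.2 q.2 +
  (cone_arc f q.1 q.2 p.2 - cone_arc f q.1 q.2 p.1).

Definition cone_cont (f : R[i] -> R[i]) := forall s phi, I.1 <= s <= I.2 ->
  J.1 <= phi <= J.2 -> f y @[y --> cone s phi] --> f (cone s phi).

Lemma rder_cone_s s phi : rder (fun s => cone s phi) s (zeta phi - w).
Proof.
have h := rderD (rder_cst w s) (rderM (rder_real s) (rder_cst (zeta phi - w) s)).
by rewrite mul1r mulr0 addr0 add0r in h.
Qed.

Lemma rder_cone_phi s phi : J.1 <= phi <= J.2 ->
  rder (cone s) phi (s%:C%C * dzeta phi).
Proof.
move=> /dzetaP hz.
have h := rderD (rder_cst w phi) (rderZ (s%:C)%C (rderB hz (rder_cst w phi))).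
by rewrite subr0 add0r in h.
Qed.

Lemma ccont_side f phi : cone_cont f -> J.1 <= phi <= J.2 ->
  ccont I.1 I.2 (fun s => f (cone s phi) * (zeta phi - w)).
Proof.
move=> cf hphi; apply: ccontM; last exact: ccont_cst.
move=> s hs; exact: (cvg_comp _ f (rder_cvg (rder_cone_s s phi)) (cf _ _ hs hphi)).
Qed.

Lemma ccont_arc f s : cone_cont f -> I.1 <= s <= I.2 ->
  ccont J.1 J.2 (fun phi => f (cone s phi) * (s%:C%C * dzeta phi)).
Proof.
move=> cf hs; apply: ccontM; last by apply: ccontM dzeta_cont; exact: ccont_cst.
move=> phi hphi; exact: (cvg_comp _ f (rder_cvg (rder_cone_phi s hphi)) (cf _ _ hs hphi)).
Qed.

Definition sub_itv (p q : R * R) := [/\ q.1 <= p.1, p.1 <= p.2 & p.2 <= q.2].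

Lemma cone_loopD f g p q : cone_cont f -> cone_cont g -> sub_itv p I -> sub_itv q J ->
  cone_loop (fun z => f z + g z) p q = cone_loop f p q + cone_loop g p q.
Proof.
move=> cf cg [p1 p12 p2] [q1 q12 q2].
have sD phi : J.1 <= phi <= J.2 ->
    cone_side (fun z => f z + g z) p.1 p.2 phi = cone_side f p.1 p.2 phi + cone_side g p.1 p.2 phi.
  move=> hphi; rewrite /cone_side -cintD; first by apply: eq_cint => s _; rewrite mulrDl.
    exact: ccont_sub (ccont_side cf hphi).
  exact: ccont_sub (ccont_side cg hphi).
have aD s : I.1 <= s <= I.2 ->
    cone_arc (fun z => f z + g z) q.1 q.2 s = cone_arc f q.1 q.2 s + cone_arc g q.1 q.2 s.
  move=> hs; rewrite /cone_arc -cintD; first by apply: eq_cint => phi _; rewrite mulrDl.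
    exact: ccont_sub (ccont_arc cf hs).
  exact: ccont_sub (ccont_arc cg hs).
rewrite /cone_loop !sD ?aD;
  first by repeat (move: (cone_side _ _ _ _) => ?); repeat (move: (cone_arc _ _ _ _) => ?); ring.
- by rewrite p1 (le_trans p12).
- by rewrite (le_trans p1).
- by rewrite (le_trans q1).
- by rewrite q1 (le_trans q12).
Qed.

(** With a primitive, each of the four integrals is a difference of values at corners, and these
    cancel. *)
Lemma cone_loop_exact f V p q : cone_cont f -> sub_itv p I -> sub_itv q J ->
  (forall z, cder V z (f z)) -> cone_loop f p q = 0.
Proof.
move=> cf [p1 p12 p2] [q1 q12 q2] dV.
have sE phi : J.1 <= phi <= J.2 ->
    cone_side f p.1 p.2 phi = V (cone p.2 phi) - V (cone p.1 phi).
  move=> hphi; apply: (cint_FTC (F := fun s => V (cone s phi))) => //.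
    exact: ccont_sub (ccont_side cf hphi).
  by move=> s _; apply: rder_comp; [exact: dV|exact: rder_cone_s].
have aE s : I.1 <= s <= I.2 ->
    cone_arc f q.1 q.2 s = V (cone s q.2) - V (cone s q.1).
  move=> hs; apply: (cint_FTC (F := fun phi => V (cone s phi))) => //.
    exact: ccont_sub (ccont_arc cf hs).
  move=> phi /andP[h1 h2]; apply: rder_comp; [exact: dV|apply: rder_cone_phi].
  by rewrite (le_trans q1 h1) (le_trans h2 q2).
rewrite /cone_loop !sE ?aE;
  first by repeat (move: (cone_side _ _ _ _) => ?); repeat (move: (cone_arc _ _ _ _) => ?); ring.
- by rewrite p1 (le_trans p12).
- by rewrite (le_trans p1).
- by rewrite (le_trans q1).
- by rewrite q1 (le_trans q12).
Qed.

Lemma cone_loop_split f p q : cone_cont f -> sub_itv p I -> sub_itv q J ->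
  let m := (p.1 + p.2) / 2 in let n := (q.1 + q.2) / 2 in
  cone_loop f p q = cone_loop f (p.1, m) (q.1, n) + cone_loop f (m, p.2) (q.1, n)
    + cone_loop f (p.1, m) (n, q.2) + cone_loop f (m, p.2) (n, q.2).
Proof.
move=> cf [p1 p12 p2] [q1 q12 q2] m n.
have mP : p.1 <= m <= p.2 by rewrite /m; apply/andP; split; lra.
have nP : q.1 <= n <= q.2 by rewrite /n; apply/andP; split; lra.
have sE phi : J.1 <= phi <= J.2 ->
    cone_side f p.1 p.2 phi = cone_side f p.1 m phi + cone_side f m p.2 phi.
  move=> hphi; apply: cint_split => //.
  exact: ccont_sub (ccont_side cf hphi).
have aE s : I.1 <= s <= I.2 ->
    cone_arc f q.1 q.2 s = cone_arc f q.1 n s + cone_arc f n q.2 s.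
  move=> hs; apply: cint_split => //.
  exact: ccont_sub (ccont_arc cf hs).
rewrite /cone_loop /= !sE ?aE;
  first by repeat (move: (cone_side _ _ _ _) => ?); repeat (move: (cone_arc _ _ _ _) => ?); ring.
- by rewrite p1 (le_trans p12).
- by rewrite (le_trans p1).
- by rewrite (le_trans q1).
- by rewrite q1 (le_trans q12).
Qed.

Lemma cone_loop_le f M p q : cone_cont f -> sub_itv p I -> sub_itv q J -> 0 <= M ->
  (forall s phi, p.1 <= s <= p.2 -> q.1 <= phi <= q.2 -> cmod (f (cone s phi)) <= M) ->
  cmod (cone_loop f p q) <= 4 * M * L * ((p.2 - p.1) + (q.2 - q.1)).
Proof.
move=> cf [p1 p12 p2] [q1 q12 q2] M0 fM.
have q1J : J.1 <= q.1 <= J.2 by rewrite q1 (le_trans q12).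
have q2J : J.1 <= q.2 <= J.2 by rewrite (le_trans q1).
have p1I : I.1 <= p.1 <= I.2 by rewrite p1 (le_trans p12).
have p2I : I.1 <= p.2 <= I.2 by rewrite (le_trans p1).
have sM phi : q.1 <= phi <= q.2 -> cmod (cone_side f p.1 p.2 phi) <= 2 * (M * L) * (p.2 - p.1).
  move=> hphi; have hphiJ : J.1 <= phi <= J.2.
    by move: hphi => /andP[h1 h2]; rewrite (le_trans q1)// (le_trans h2).
  apply: cint_le => //.
    exact: ccont_sub (ccont_side cf hphiJ).
  by move=> s hs; rewrite cmodM; apply: ler_pM; rewrite ?cmod_ge0// ?fM// zetaL.
have aM s : p.1 <= s <= p.2 -> cmod (cone_arc f q.1 q.2 s) <= 2 * (M * L) * (q.2 - q.1).
  move=> hs; have hsI : I.1 <= s <= I.2.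
    by move: hs => /andP[h1 h2]; rewrite (le_trans p1)// (le_trans h2).
  apply: cint_le => //.
    exact: ccont_sub (ccont_arc cf hsI).
  move=> phi hphi; have hphiJ : J.1 <= phi <= J.2.
    by move: hphi => /andP[h1 h2]; rewrite (le_trans q1)// (le_trans h2).
  rewrite cmodM; apply: ler_pM; rewrite ?cmod_ge0// ?fM// cmodM cmodR.
  move: hsI => /andP[h1 h2]; rewrite ger0_norm ?(le_trans I0)//.
  rewrite -[leRHS]mul1r; apply: ler_pM; rewrite ?cmod_ge0 ?(le_trans I0)//.
    exact: le_trans I1.
  exact: dzetaL.
have qq1 : q.1 <= q.1 <= q.2 by rewrite lexx.
have qq2 : q.1 <= q.2 <= q.2 by rewrite lexx andbT.
have pp1 : p.1 <= p.1 <= p.2 by rewrite lexx.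
have pp2 : p.1 <= p.2 <= p.2 by rewrite lexx andbT.
rewrite /cone_loop; apply: le_trans (cmodD _ _) _.
have := lerD (le_trans (cmodB _ _) (lerD (sM _ qq1) (sM _ qq2)))
  (le_trans (cmodB _ _) (lerD (aM _ pp2) (aM _ pp1))).
move=> /le_trans; apply; lra.
Qed.

Lemma zeta_lipschitz x y : J.1 <= x <= J.2 -> J.1 <= y <= J.2 ->
  cmod (zeta x - zeta y) <= 2 * L * `|x - y|.
Proof.
wlog xy : x y / y <= x => [H hx hy|/andP[x1 x2] /andP[y1 y2]].
  have [/H|/ltW /H] := leP y x; first exact.
  by rewrite cmodBC distrC; exact.
rewrite -(@cint_FTC _ y x dzeta)//.
- rewrite ger0_norm ?subr_ge0//; apply: cint_le => //.
    exact: ccont_sub dzeta_cont.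
  by move=> u /andP[u1 u2]; apply: dzetaL; rewrite (le_trans y1 u1) (le_trans u2).
- exact: ccont_sub dzeta_cont.
- by move=> u /andP[u1 u2]; apply: dzetaP; rewrite (le_trans y1 u1) (le_trans u2).
Qed.

Lemma cone_lipschitz s s' x y : I.1 <= s <= I.2 -> I.1 <= s' <= I.2 ->
  J.1 <= x <= J.2 -> J.1 <= y <= J.2 ->
  cmod (cone s x - cone s' y) <= 2 * L * (`|s - s'| + `|x - y|).
Proof.
move=> hs hs' hx hy.
have -> : cone s x - cone s' y = (s - s')%:C%C * (zeta x - w) + s'%:C%C * (zeta x - zeta y).
  by rewrite /cone rmorphB /=; ring.
apply: le_trans (cmodD _ _) _; rewrite !cmodM !cmodR mulrDr; apply: lerD.
  rewrite mulrC; apply: ler_wpM2r => //; apply: le_trans (zetaL hx) _.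
  by rewrite ler_peMl ?ler1n// ltW.
rewrite -[leRHS]mul1r; apply: ler_pM; rewrite ?cmod_ge0//; last exact: zeta_lipschitz.
move: hs' => /andP[h1 h2]; rewrite ger0_norm; first exact: le_trans I1.
exact: le_trans h1.
Qed.

Lemma cder_eps (f : R[i] -> R[i]) z d e : cder f z d -> 0 < e ->
  exists2 e' : R, 0 < e' & forall y, cmod (y - z) < e' ->
    cmod (f y - f z - d * (y - z)) <= e * cmod (y - z).
Proof.
move=> [psi [cpsi <- fE]] e0.
have /cvg_nbhs_cmodP /(_ _ e0) [e1 e10 h1] := cpsi.
have /nbhs_cmodP[e2 e20 h2] := fE.
exists (Num.min e1 e2); first by rewrite lt_min e10.
move=> y; rewrite lt_min => /andP[y1 y2].
have -> : f y - f z - psi z * (y - z) = (psi y - psi z) * (y - z).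
  by rewrite h2//; ring.
rewrite cmodM ler_wpM2r ?cmod_ge0//.
by rewrite cmodBC ltW// h1.
Qed.

Lemma cder_affine (a b z0 z : R[i]) :
  cder (fun z => a * (z - z0) + b * (z - z0) ^+ 2) z (a + 2 * b * (z - z0)).
Proof.
have h1 : cder (fun z => z - z0) z 1.
  by have := cderB (cder_id z) (cder_cst z0 z); rewrite subr0.
have h := cderD (cderZ a h1) (cderZ b (cderX 2 h1)).
have E : a * 1 + b * (2 * (z - z0) ^+ 2.-1 * 1) = a + 2 * b * (z - z0) by ring.
by rewrite E in h.
Qed.

(** On a small cell the affine part of [F] has a primitive and contributes nothing; the remainder is
    o(size) on a contour of length O(size). The claim e * (sum of the side lengths)^2 is stable
    under bisection, since four quarters of half the size add up to exactly the same bound. *)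
Theorem goursat : (forall s phi, I.1 <= s <= I.2 -> J.1 <= phi <= J.2 ->
    exists d, cder F (cone s phi) d) ->
  cone_loop F I J = 0.
Proof.
move=> dF.
have cF : cone_cont F.
  by move=> s phi hs hphi; have [d /cder_cvg] := dF _ _ hs hphi.
suff small e : 0 < e -> cmod (cone_loop F I J) <=
    e * ((I.2 - I.1) + (J.2 - J.1)) ^+ 2.
  apply/eqP; rewrite -cmod_eq0 eq_le cmod_ge0 andbT.
  set l := _ ^+ 2 in small; have l0 : 0 <= l by exact: sqr_ge0.
  apply/ler_addgt0Pl => e e0; rewrite addr0.
  apply: le_trans (small (e / (l + 1)) _) _; first by rewrite divr_gt0// ltr_wpDl.
  by rewrite mulrAC ler_pdivrMr ?ltr_wpDl// ler_wpM2l ?(ltW e0)// lerDl.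
move=> e0.
have SI : sub_itv I I by split; rewrite ?lexx.
have SJ : sub_itv J J by split; rewrite ?lexx.
apply: (@rect_bisection R (fun p q => cmod (cone_loop F p q) <=
    e * ((p.2 - p.1) + (q.2 - q.1)) ^+ 2)) => //.
  move=> p q p1 p12 p2 q1 q12 q2 H.
  rewrite (cone_loop_split cF)//.
  set m := (p.1 + p.2) / 2; set n := (q.1 + q.2) / 2.
  have h1 := H (p.1, m) (q.1, n) (or_introl erefl) (or_introl erefl).
  have h2 := H (m, p.2) (q.1, n) (or_intror erefl) (or_introl erefl).
  have h3 := H (p.1, m) (n, q.2) (or_introl erefl) (or_intror erefl).
  have h4 := H (m, p.2) (n, q.2) (or_intror erefl) (or_intror erefl).
  have k1 := le_trans (cmodD _ _) (lerD h1 h2).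
  have k2 := le_trans (cmodD _ _) (lerD k1 h3).
  have k3 := le_trans (cmodD _ _) (lerD k2 h4).
  apply: le_trans k3 _ => /=.
  rewrite /m /n !half_subl !half_subr.
  by rewrite le_eqVlt; apply/predU1P; left; field.
move=> x y hx hy; have [d dFx] := dF _ _ hx hy.
(* On a cell of size [l] the remainder is at most e1 * 2 L l, and [cone_loop_le] multiplies it by 4
   L l; the product is e * l^2. *)
pose e1 := e / (8 * L ^+ 2).
have e10 : 0 < e1 by rewrite divr_gt0// mulr_gt0// exprn_gt0.
have [r r0 hr] := cder_eps dFx e10.
(* By [cone_lipschitz] a cell stays within 2 L times the sum of its two sides of [z0], hence within
   [r]. *)
exists (r / (4 * L)); first by rewrite divr_gt0// mulr_gt0.
move=> p q /andP[p1 p1x] /andP[xp2 p2] /andP[q1 q1y] /andP[yq2 q2] lp lq.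
have Sp : sub_itv p I by split=> //; exact: le_trans p1x xp2.
have Sq : sub_itv q J by split=> //; exact: le_trans q1y yq2.
set z0 := cone x y in dFx hr.
pose A z := F z0 + d * (z - z0).
pose E z := F z - A z.
have cA : cone_cont A.
  move=> s phi _ _; exact: (cvgCD (cvgCC (F z0)) (cvgCM (cvgCC d) (cvgCB (@cvg_idC R _) (cvgCC z0)))).
have cE : cone_cont E.
  by move=> s phi hs hphi; exact: (cvgCB (cF _ _ hs hphi) (cA _ _ hs hphi)).
have -> : cone_loop F p q = cone_loop E p q.
  rewrite -[RHS]addr0 -(@cone_loop_exact A (fun z => F z0 * (z - z0) + d / 2 * (z - z0) ^+ 2) p q)//.
    rewrite -cone_loopD//; congr (cone_loop _ p q); apply/funext => z.
    by rewrite /E subrK.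
  move=> z; have := cder_affine (F z0) (d / 2) z0 z.
  by have -> : F z0 + 2 * (d / 2) * (z - z0) = A z by rewrite /A; field.
set l := (p.2 - p.1) + (q.2 - q.1).
have l0 : 0 <= l by rewrite /l; lra.
have bE s phi : p.1 <= s <= p.2 -> q.1 <= phi <= q.2 -> cmod (E (cone s phi)) <= e1 * (2 * L * l).
  move=> /andP[s1 s2] /andP[f1 f2].
  have near_z0 : cmod (cone s phi - z0) <= 2 * L * l.
    apply: le_trans (cone_lipschitz _ _ _ _) _ => //.
    - by rewrite (le_trans p1)// (le_trans s2).
    - by rewrite (le_trans q1)// (le_trans f2).
    - apply: ler_wpM2l; first by rewrite mulr_ge0// ltW.
      by apply: lerD; rewrite ler_norml; apply/andP; split; lra.
  rewrite /E /A opprD addrA; apply: le_trans (hr _ _) _.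
    apply: le_lt_trans near_z0 _.
    have -> : r = 2 * L * (r / (4 * L) + r / (4 * L)) by field; rewrite gt_eqF.
    by rewrite ltr_pM2l ?mulr_gt0// /l ltrD.
  by apply: ler_wpM2l => //; exact: ltW.
apply: le_trans (cone_loop_le cE Sp Sq _ bE) _.
  by apply: mulr_ge0; [exact: ltW|rewrite !mulr_ge0// ltW].
rewrite -/l le_eqVlt; apply/predU1P; left; rewrite /e1; field.
by rewrite gt_eqF.
Qed.

End goursat.

(** * Parametrization of circles *)

Section circle.
Context {R : realType}.
Implicit Types (r phi : R).

Definition expi phi : R[i] := Complex (cos phi) (sin phi).

Lemma circle_pointE r phi : circle_point r phi = r%:C%C * expi phi.
Proof.
by apply/eqP; rewrite eq_complex cReM cImM /= !mul0r subr0 addr0 !eqxx.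
Qed.

Lemma cmod_expi phi : cmod (expi phi) = 1.
Proof. by rewrite /cmod /= cos2Dsin2 sqrtr1. Qed.

Lemma expi_neq0 phi : expi phi != 0.
Proof. by rewrite -cmod_gt0 cmod_expi. Qed.

Lemma expi0 : expi 0 = 1.
Proof. by rewrite /expi cos0 sin0. Qed.

Lemma expi2pi : expi (2 * pi) = 1.
Proof. by rewrite /expi mulrC mulr_natr cos2pi sin2pi. Qed.

Lemma conj_expi phi : (expi phi)^*%C = (expi phi)^-1.
Proof.
apply: (mulfI (expi_neq0 phi)); rewrite divff ?expi_neq0//.
apply/eqP; rewrite eq_complex cReM cImM /=.
rewrite mulrN opprK -!expr2 cos2Dsin2 eqxx /=.
by rewrite mulrN mulrC addNr.
Qed.

Lemma rder_expi phi : rder expi phi ('i%C * expi phi).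
Proof.
have hc := is_derive_rder (is_derive_cos phi).
have hs := is_derive_rder (is_derive_sin phi).
have h := rderD hc (rderZ 'i%C hs).
have E : (fun y => (cos y)%:C%C + 'i%C * (sin y)%:C%C) = expi.
  by apply/funext => y; rewrite [RHS]complexE.
rewrite E in h.
suff -> : 'i%C * expi phi = (- sin phi)%:C%C + 'i%C * (cos phi)%:C%C by [].
rewrite [expi phi]complexE /= mulrDr mulrA -expr2 sqr_i mulN1r addrC.
by rewrite rmorphN.
Qed.

Lemma rder_circle (c : R[i]) r phi :
  rder (fun phi => c + r%:C%C * expi phi) phi (r%:C%C * ('i%C * expi phi)).
Proof.
have := rderD (rder_cst c phi) (rderZ r%:C%C (rder_expi phi)).
by rewrite add0r.
Qed.

Lemma twopi_gt0 : 0 < 2 * pi :> R.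
Proof. by rewrite mulr_gt0// pi_gt0. Qed.

Lemma ccont_rder a b (f f' : R -> R[i]) :
  (forall x, a <= x <= b -> rder f x (f' x)) -> ccont a b f.
Proof. by move=> df x /df /rder_cvg. Qed.

Lemma ccont_expi a b : ccont a b expi.
Proof. by apply: (@ccont_rder _ _ _ (fun phi => 'i%C * expi phi)) => x _; exact: rder_expi. Qed.

Lemma ccont_comp a b (H : R[i] -> R[i]) f : ccont a b f ->
  (forall x, a <= x <= b -> exists d, cder H (f x) d) -> ccont a b (fun x => H (f x)).
Proof.
by move=> cf dH x hx; have [d /cder_cvg hd] := dH _ hx; exact: (cvg_comp f H (cf _ hx) hd).
Qed.

Lemma ccont_bounded a b (f : R -> R[i]) : a <= b -> ccont a b f ->
  exists2 M, 0 < M & forall x, a <= x <= b -> cmod (f x) <= M.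
Proof.
move=> ab cf.
have : rcont a b (fun x => cmod (f x)) by move=> x /cf h; exact: (cvg_cmod _ h).
move=> /rcont_within /(EVT_max ab)[c _ hc].
exists (cmod (f c) + 1); first by rewrite ltr_wpDl// cmod_ge0.
move=> x hx; apply: le_trans (hc x _) _; first by rewrite in_itv.
by rewrite lerDl.
Qed.

End circle.

(** * Mean values and Cauchy's formula *)

Section cauchy_formula.
Context {R : realType}.
Implicit Types (H : R[i] -> R[i]) (c w z : R[i]) (r : R).
Local Notation TP := (2 * pi : R).

Definition disc_cder H c r := forall z, cmod (z - c) <= r -> exists d, cder H z d.

Lemma cmod_circle c r phi : 0 <= r -> cmod (c + r%:C%C * expi phi - c) = r.
Proof.
move=> r0; rewrite addrAC subrr add0r cmodM cmod_expi mulr1 cmodR.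
by rewrite ger0_norm.
Qed.

Lemma circle_dist c r w phi : 0 <= r ->
  r - cmod (w - c) <= cmod (c + r%:C%C * expi phi - w).
Proof.
move=> r0; rewrite -{1}(cmod_circle c phi r0).
have -> : c + r%:C%C * expi phi - w = (c + r%:C%C * expi phi - c) - (w - c) by ring.
exact: cmod_sub.
Qed.

Lemma circle_neq c r w phi : cmod (w - c) < r -> c + r%:C%C * expi phi - w != 0.
Proof.
move=> wr; rewrite -cmod_gt0; apply: lt_le_trans (circle_dist _ _ _ _).
  by rewrite subr_gt0.
exact: le_trans (cmod_ge0 _) (ltW wr).
Qed.

Lemma ccont_circle_inv a b c r w : cmod (w - c) < r ->
  ccont a b (fun phi => (c + r%:C%C * expi phi - w)^-1).
Proof.
move=> wr; apply: ccontV; first by move=> x _; exact: circle_neq.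
apply: ccontB; last exact: ccont_cst.
by apply: ccont_rder => x _; exact: rder_circle.
Qed.

(** [om] is dz / (z - w) along the circle, and this form does not change when the circle is
    contracted towards [w], because the factor s cancels. By Goursat for H(z) / (z - w), whose
    integrals along the sides phi = 0 and phi = 2 pi agree, the contracted integral is the same for
    every s in ]0, 1]; as s tends to 0 the values of [H] tend uniformly to [H w]. *)
Lemma star_homotopy H c r w : 0 < r -> cmod (w - c) < r -> disc_cder H c r ->
  let om phi := r%:C%C * ('i%C * expi phi) / (c + r%:C%C * expi phi - w) in
  cint 0 TP (fun phi => H (c + r%:C%C * expi phi) * om phi) = H w * cint 0 TP om.
Proof.
move=> r0 wr dH om.
pose zeta phi := c + r%:C%C * expi phi.
pose dzeta phi := r%:C%C * ('i%C * expi phi).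
have cd a b : ccont a b dzeta.
  by apply: ccontM; [exact: ccont_cst|apply: ccontM; [exact: ccont_cst|exact: ccont_expi]].
have com : ccont 0 TP om by apply: ccontM (ccont_circle_inv _); [exact: cd|].
have cmi : cmod ('i%C : R[i]) = 1 by rewrite /cmod /= expr0n expr1n add0r sqrtr1.
have cmd phi : cmod (dzeta phi) = r.
  by rewrite !cmodM cmod_expi cmi !mulr1 cmodR gtr0_norm.
have coneE s phi : cone w zeta s phi - c = (1 - s)%:C%C * (w - c) + s%:C%C * (zeta phi - c).
  by rewrite /cone rmorphB rmorph1; ring.
have in_disc s phi : 0 <= s <= 1 -> cmod (cone w zeta s phi - c) <= r.
  move=> /andP[s0 s1]; rewrite coneE; apply: le_trans (cmodD _ _) _.
  rewrite !cmodM !cmodR cmod_circle ?(ltW r0)// !ger0_norm ?subr_ge0//.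
  have : (1 - s) * cmod (w - c) <= (1 - s) * r by rewrite ler_wpM2l ?subr_ge0// ltW.
  by move=> h; apply: le_trans (lerD h (lexx _)) _; rewrite -mulrDl subrK mul1r.
have ccone s : 0 <= s <= 1 -> ccont 0 TP (fun phi => H (cone w zeta s phi) * om phi).
  move=> hs; apply: ccontM com; apply: (@ccont_comp _ _ _ H); last first.
    by move=> x _; apply: dH; exact: in_disc.
  apply: ccontD; first exact: ccont_cst.
  apply: ccontM; first exact: ccont_cst.
  by apply: ccontB; [apply: ccont_rder => x _; exact: rder_circle|exact: ccont_cst].
pose A s := cint 0 TP (fun phi => H (cone w zeta s phi) * om phi).
have zw phi : zeta phi - w != 0 by exact: circle_neq.
have A1 a : 0 < a <= 1 -> A 1 = A a.
  move=> /andP[a0 a1].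
  pose F z := H z / (z - w).
  have := @goursat R F w zeta dzeta (a, 1) (0, TP) (2 * r) (ltW a0) a1 (lexx _) (ltW twopi_gt0).
  have h1 (phi : R) : 0 <= phi <= TP -> rder zeta phi (dzeta phi).
    by move=> _; exact: rder_circle.
  have h2 : 0 < 2 * r by rewrite mulr_gt0.
  have h3 (phi : R) : 0 <= phi <= TP -> cmod (zeta phi - w) <= 2 * r.
    move=> _; have -> : zeta phi - w = (zeta phi - c) - (w - c) by ring.
    apply: le_trans (cmodB _ _) _; rewrite cmod_circle ?(ltW r0)//.
    by rewrite mulr_natl mulr2n lerD2l ltW.
  have h4 (phi : R) : 0 <= phi <= TP -> cmod (dzeta phi) <= 2 * r.
    by move=> _; rewrite cmd mulr_natl mulr2n lerDl ltW.
  move=> /(_ h1 (cd _ _) h2 h3 h4); rewrite /cone_loop /cone_side /=.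
  have z02 : zeta TP = zeta 0 by rewrite /zeta expi2pi expi0.
  rewrite /cone z02 subrr add0r => G.
  have arcE s : 0 < s -> cone_arc w zeta dzeta F 0 TP s = A s.
    move=> s0; rewrite /cone_arc /A; apply: eq_cint => phi _.
    rewrite /F /om -/(zeta phi) -/(dzeta phi) /cone [w + _]addrC addrK.
    have sC : s%:C%C != 0 :> R[i] by rewrite -cmod_gt0 cmodR normr_gt0 gt_eqF.
    by field; rewrite zw sC.
  rewrite -!arcE//; apply/eqP; rewrite -subr_eq0; apply/eqP; apply: G.
  move=> s phi /andP[as1 s1] _.
  have s0 : 0 < s by exact: lt_le_trans as1.
  have [d hd] : exists d, cder H (cone w zeta s phi) d.
    by apply: dH; apply: in_disc; rewrite (ltW s0).
  have nz : cone w zeta s phi - w != 0.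
    rewrite /cone [w + _]addrC addrK mulf_neq0//.
    by rewrite -cmod_gt0 cmodR normr_gt0 gt_eqF.
  eexists; apply: (cderM hd).
  apply: (@cderV _ (fun z => z - w)) => //.
  by apply: cderB; [exact: cder_id|exact: cder_cst].
have -> : cint 0 TP (fun phi => H (c + r%:C%C * expi phi) * om phi) = A 1.
  by apply: eq_cint => phi _; rewrite /cone rmorph1 mul1r [w + _]addrC subrK.
have -> : H w * cint 0 TP om = cint 0 TP (fun phi => H w * om phi) by rewrite cintZ.
have [d hd] : exists d, cder H w d by apply: dH; exact: ltW.
have [M M0 hM] := ccont_bounded (ltW twopi_gt0) com.
apply/eqP; rewrite -subr_eq0 -cmod_eq0 eq_le cmod_ge0 andbT.
apply/ler_addgt0Pl => e e0; rewrite addr0.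
pose e1 := e / (2 * M * TP).
have MT : 0 < 2 * M * TP by rewrite mulr_gt0 ?twopi_gt0// mulr_gt0.
have e10 : 0 < e1 by rewrite divr_gt0.
have /cvg_nbhs_cmodP /(_ _ e10)[e' e'0 he'] := cder_cvg hd.
pose a := Num.min 1 (e' / (4 * r)).
have a0 : 0 < a by rewrite lt_min ltr01 divr_gt0// mulr_gt0.
have a1 : 0 < a <= 1 by rewrite a0 ge_min lexx.
rewrite (A1 _ a1) /A -cintB; [|by apply: ccone; rewrite (ltW a0); case/andP: a1|].
- have -> : e = 2 * (e1 * M) * (TP - 0).
    by rewrite subr0 -{1}(divfK (lt0r_neq0 MT) e) -/e1; ring.
  apply: cint_le; first exact/ltW/twopi_gt0.
    apply: ccontB; first by apply: ccone; rewrite (ltW a0); case/andP: a1.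
    by apply: ccontM com; exact: ccont_cst.
  move=> phi hphi; rewrite -mulrBl cmodM; apply: ler_pM; rewrite ?cmod_ge0 ?hM//.
  rewrite cmodBC ltW//; apply: he'.
  rewrite /cone [w + _]addrC addrK cmodM cmodR gtr0_norm//.
  have -> : zeta phi - w = (zeta phi - c) - (w - c) by ring.
  have h : cmod (zeta phi - c - (w - c)) < 4 * r.
    apply: le_lt_trans (cmodB _ _) _; rewrite cmod_circle ?(ltW r0)//.
    by lra.
  apply: lt_le_trans (_ : a * (4 * r) <= e'); first by rewrite ltr_pM2l.
  by rewrite -ler_pdivlMr ?mulr_gt0// ge_min lexx orbT.
- by apply: ccontM com; exact: ccont_cst.
Qed.

(** With the apex at the center, [om] is the constant ['i], and [star_homotopy] becomes the mean
    value property. *)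
Lemma circle_mean H c r : 0 < r -> disc_cder H c r ->
  cint 0 TP (fun phi => H (c + r%:C%C * expi phi)) = H c * TP%:C%C.
Proof.
move=> r0 dH; have cc : cmod (c - c) < r by rewrite subrr cmod0.
have rC : r%:C%C != 0 :> R[i] by rewrite -cmod_gt0 cmodR normr_gt0 gt_eqF.
have E phi : r%:C%C * ('i%C * expi phi) / (c + r%:C%C * expi phi - c) = 'i%C :> R[i].
  by rewrite addrAC subrr add0r; field; rewrite expi_neq0.
have i0 : 'i%C != 0 :> R[i] by rewrite eq_complex /= oner_eq0 andbF.
have cH : ccont 0 TP (fun phi => H (c + r%:C%C * expi phi)).
  apply: (@ccont_comp _ _ _ H); first by apply: ccont_rder => x _; exact: rder_circle.
  by move=> x _; apply: dH; rewrite cmod_circle// ltW.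
have := star_homotopy r0 cc dH => /=.
under eq_cint do rewrite E mulrC.
under [in RHS]eq_cint do rewrite E.
rewrite cintZ// cint_cst ?(ltW twopi_gt0)// subr0 mulrCA => h.
exact: (mulfI i0 h).
Qed.

(** After [star_homotopy] only the case of a constant [H] is left, that is, the winding number of
    the circle around [w]. *)
Theorem cauchy_formula H c r w : 0 < r -> cmod (w - c) < r -> disc_cder H c r ->
  cint 0 TP (fun phi => H (c + r%:C%C * expi phi) * (r%:C%C * expi phi)
                        / (c + r%:C%C * expi phi - w)) = H w * TP%:C%C.
Proof.
move=> r0 wr dH; have := star_homotopy r0 wr dH => /=.
have rC : r%:C%C != 0 :> R[i] by rewrite -cmod_gt0 cmodR normr_gt0 gt_eqF.
have i0 : 'i%C != 0 :> R[i] by rewrite eq_complex /= oner_eq0 andbF.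
pose om phi := r%:C%C * expi phi / (c + r%:C%C * expi phi - w) : R[i].
have com : ccont 0 TP om.
  apply: ccontM (ccont_circle_inv wr).
  by apply: ccontM; [exact: ccont_cst|exact: ccont_expi].
have cH : ccont 0 TP (fun phi => H (c + r%:C%C * expi phi)).
  apply: (@ccont_comp _ _ _ H); first by apply: ccont_rder => x _; exact: rder_circle.
  by move=> x _; apply: dH; rewrite cmod_circle// ltW.
(* The kernel is the conjugate of a function that is holomorphic in
   [expi phi], so that its mean is given by [circle_mean]. *)
have omT : cint 0 TP om = TP%:C%C.
  pose K z := r%:C%C / (r%:C%C - (w - c)^*%C * z) : R[i].
  have Knz (z : R[i]) : cmod (z - 0) <= 1 -> r%:C%C - (w - c)^*%C * z != 0.
    rewrite subr0 => z1; rewrite subr_eq0; apply/eqP => /(congr1 cmod).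
    rewrite cmodM cmodR cmod_conj gtr0_norm// => rE.
    have : r <= cmod (w - c) by rewrite {1}rE ler_piMr ?cmod_ge0.
    by rewrite leNgt wr.
  have dK : disc_cder K 0 1.
    move=> z /Knz nz; eexists; apply: cderZ.
    apply: (@cderV _ (fun z => r%:C%C - (w - c)^*%C * z)) => //.
    by apply: cderB; [exact: cder_cst|apply: cderZ; exact: cder_id].
  have := circle_mean ltr01 dK.
  have -> : K 0 = 1 by rewrite /K mulr0 subr0 divff.
  rewrite mul1r => h; rewrite -[LHS]conjcK -cint_conj//.
  rewrite -[RHS]conjc_real -h; congr (_^*)%C; apply: eq_cint => phi _.
  have cM (x y : R[i]) : (x * y)^*%C = x^*%C * y^*%C by exact: (rmorphM (@conjc R)).
  have cB (x y : R[i]) : (x - y)^*%C = x^*%C - y^*%C by exact: (rmorphB (@conjc R)).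
  have cV (x : R[i]) : x^-1^*%C = x^*%C^-1 by exact: (fmorphV (@conjc R)).
  have nz := Knz (expi phi); rewrite subr0 cmod_expi in nz.
  have {}nz := nz (lexx _).
  have e0 := expi_neq0 phi.
  have omE : om phi = r%:C%C * expi phi / (r%:C%C * expi phi - (w - c)).
    by rewrite /om; congr (_ / _); ring.
  rewrite omE cM cV cB cM conjc_real conj_expi /K add0r rmorph1 mul1r.
  set u := ((w - c)^*)%C in nz *.
  have -> : r%:C%C / expi phi - u = (r%:C%C - u * expi phi) / expi phi by field.
  by rewrite invfM invrK mulrACA mulVf// mulr1.
rewrite [X in _ = H w * X -> _](_ : _ = 'i%C * TP%:C%C); last first.
  rewrite -omT -cintZ//; apply: eq_cint => phi _; rewrite /om; ring.
move=> h; apply: (mulfI i0); rewrite mulrCA -h -cintZ.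
  by apply: eq_cint => phi _; ring.
apply: ccontM (ccont_circle_inv wr); apply: ccontM cH _.
by apply: ccontM; [exact: ccont_cst|exact: ccont_expi].
Qed.

End cauchy_formula.

(** * Holomorphic functions and Taylor coefficients *)

Section holomorphic.
Context {R : realType}.
Implicit Types (H f g : R[i] -> R[i]) (c w z d : R[i]) (r : R).
Local Notation TP := (2 * pi : R).

Lemma cder_of_eps f z d :
  (forall e : R, 0 < e -> exists2 e' : R, 0 < e' & forall y, cmod (y - z) < e' ->
     cmod (f y - f z - d * (y - z)) <= e * cmod (y - z)) ->
  cder f z d.
Proof.
move=> hd; exists (fun y => if y == z then d else (f y - f z) / (y - z)); split.
- rewrite eqxx; apply/cvg_nbhs_cmodP => e e0.
  have e20 : 0 < e / 2 by rewrite divr_gt0.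
  have [e' e'0 he'] := hd _ e20.
  exists e' => // y yz; case: eqP => [_|/eqP yz0]; first by rewrite subrr cmod0.
  have yz0' : 0 < cmod (y - z) by rewrite cmod_gt0 subr_eq0.
  have -> : d - (f y - f z) / (y - z) = - ((f y - f z - d * (y - z)) / (y - z)).
    by field; rewrite subr_eq0.
  rewrite cmodN cmodM cmodV ltr_pdivrMr//; apply: le_lt_trans (he' _ yz) _.
  by rewrite ltr_pM2r// ltr_pdivrMr// ltr_pMr// ltr1n.
- by rewrite eqxx.
- apply/nbhs_cmodP; exists 1 => // y _; case: eqP => [->|/eqP yz].
    by rewrite subrr mulr0 addr0.
  by rewrite divfK ?subr_eq0// addrC subrK.
Qed.

(** Differentiation under the integral sign: the remainder is quadratic in [y - w] uniformly in
    [phi], and stays so after integration. *)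
Lemma cder_cint (G : R[i] -> R -> R[i]) (G1 : R -> R[i]) w r M : 0 < r -> 0 <= M ->
  (forall y, cmod (y - w) < r -> ccont 0 TP (G y)) -> ccont 0 TP G1 ->
  (forall y phi, cmod (y - w) < r -> 0 <= phi <= TP ->
     cmod (G y phi - G w phi - (y - w) * G1 phi) <= M * cmod (y - w) ^+ 2) ->
  cder (fun y => cint 0 TP (G y)) w (cint 0 TP G1).
Proof.
move=> r0 M0 cG cG1 hG; apply: cder_of_eps => e e0.
pose k := 2 * M * TP + 1.
have k0 : 0 < k by rewrite ltr_wpDl// !mulr_ge0// pi_ge0.
exists (Num.min r (e / k)); first by rewrite lt_min r0 divr_gt0.
move=> y; rewrite lt_min => /andP[yr ye].
have ww : cmod (w - w) < r by rewrite subrr cmod0.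
have c1 := ccontB (cG _ yr) (cG _ ww).
have c2 : ccont 0 TP (fun phi => (y - w) * G1 phi) by apply: ccontM cG1; exact: ccont_cst.
have -> : cint 0 TP (G y) - cint 0 TP (G w) - cint 0 TP G1 * (y - w) =
    cint 0 TP (fun phi => G y phi - G w phi - (y - w) * G1 phi).
  by rewrite (cintB c1 c2) (cintB (cG _ yr) (cG _ ww)) (cintZ _ cG1); congr (_ - _); exact: mulrC.
have h := cint_le (ltW twopi_gt0) (ccontB c1 c2) (fun phi hphi => hG y phi yr hphi).
apply: le_trans h _; rewrite subr0.
have -> : 2 * (M * cmod (y - w) ^+ 2) * TP = (2 * M * TP * cmod (y - w)) * cmod (y - w).
  by ring.
rewrite ler_wpM2r ?cmod_ge0//.
move: ye; rewrite ltr_pdivlMr// => /ltW; apply: le_trans.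
by rewrite [leRHS]mulrC; apply: ler_wpM2r; rewrite ?cmod_ge0// /k lerDl ler01.
Qed.

Definition cauchyK n (a : R -> R[i]) c r w :=
  cint 0 TP (fun phi => a phi / (c + r%:C%C * expi phi - w) ^+ n).

Lemma ccont_cauchyK n a c r w : ccont 0 TP a -> cmod (w - c) < r ->
  ccont 0 TP (fun phi => a phi / (c + r%:C%C * expi phi - w) ^+ n).
Proof.
move=> ca wr; apply: ccontM ca _; apply: ccontV.
  by move=> x _; rewrite expf_neq0// circle_neq.
apply: ccontX; apply: ccontB; last exact: ccont_cst.
by apply: ccont_rder => x _; exact: rder_circle.
Qed.

(** Two orders suffice for all: the first identifies the derivative of a Cauchy integral, the second
    shows that this derivative is again differentiable, and [holomorphic_at_deriven] iterates. *)
Lemma cder_cauchyK (a : R -> R[i]) c r w : ccont 0 TP a -> cmod (w - c) < r ->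
  cder (cauchyK 1 a c r) w (cauchyK 2 a c r w) /\
  cder (cauchyK 2 a c r) w (cint 0 TP (fun phi =>
    2 * (a phi / (c + r%:C%C * expi phi - w) ^+ 3))).
Proof.
move=> ca wr.
have [A A0 hA] := ccont_bounded (ltW twopi_gt0) ca.
(* Half the distance from [w] to the circle: for [y] within [del] of [w] every point of the circle
   is at distance at least [del] from [y], which bounds all denominators. *)
have [del del0 delE] : exists2 del, 0 < del & del = (r - cmod (w - c)) / 2.
  by eexists; last reflexivity; rewrite divr_gt0// subr_gt0.
have r0 : 0 < r by exact: le_lt_trans (cmod_ge0 _) wr.
have near_w y : cmod (y - w) < del -> cmod (y - c) < r - del.
  move=> yw; have -> : y - c = (y - w) + (w - c) by ring.
  by apply: le_lt_trans (cmodD _ _) _; lra.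
have far y phi : cmod (y - w) < del -> del <= cmod (c + r%:C%C * expi phi - y).
  move=> /near_w h; apply: le_trans (circle_dist _ _ _ (ltW r0)); lra.
have near_r y : cmod (y - w) < del -> cmod (y - c) < r.
  by move=> /near_w h; apply: lt_le_trans h _; rewrite lerBlDr lerDl ltW.
have ww : cmod (w - w) < del by rewrite subrr cmod0.
split.
- apply: (@cder_cint (fun y phi => a phi / (c + r%:C%C * expi phi - y) ^+ 1)
    (fun phi => a phi / (c + r%:C%C * expi phi - w) ^+ 2) w del (A / del ^+ 3) del0).
  + by rewrite divr_ge0// ltW// exprn_gt0.
  + by move=> y /near_r; exact: ccont_cauchyK.
  + exact: ccont_cauchyK.
  + move=> y phi yw hphi.
    set x := c + r%:C%C * expi phi.
    have xw : x - w != 0 by exact: circle_neq.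
    have xy : x - y != 0 by apply: circle_neq; exact: near_r.
    have -> : a phi / (x - y) ^+ 1 - a phi / (x - w) ^+ 1 - (y - w) * (a phi / (x - w) ^+ 2) =
      a phi / ((x - y) * (x - w) ^+ 2) * (y - w) ^+ 2.
      by field; rewrite xw xy.
    rewrite cmodM cmodX ler_wpM2r ?exprn_ge0 ?cmod_ge0//.
    rewrite cmodM cmodV cmodM cmodX; apply: ler_pM; rewrite ?cmod_ge0 ?hA//.
      by rewrite invr_ge0 mulr_ge0 ?exprn_ge0 ?cmod_ge0.
    rewrite lef_pV2 ?posrE ?mulr_gt0 ?exprn_gt0 ?cmod_gt0//.
    rewrite exprS; apply: ler_pM; rewrite ?exprn_ge0 ?(ltW del0)// ?far//.
    by rewrite lerXn2r ?nnegrE ?cmod_ge0 ?(ltW del0)// far.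
- apply: (@cder_cint (fun y phi => a phi / (c + r%:C%C * expi phi - y) ^+ 2)
    (fun phi => 2 * (a phi / (c + r%:C%C * expi phi - w) ^+ 3)) w del
    (A * (8 * r) / del ^+ 5) del0).
  + by rewrite divr_ge0 ?mulr_ge0// ltW// exprn_gt0.
  + by move=> y /near_r; exact: ccont_cauchyK.
  + by apply: ccontM; [exact: ccont_cst|exact: ccont_cauchyK].
  + move=> y phi yw hphi.
    set x := c + r%:C%C * expi phi.
    have xw : x - w != 0 by exact: circle_neq.
    have xy : x - y != 0 by apply: circle_neq; exact: near_r.
    have -> : a phi / (x - y) ^+ 2 - a phi / (x - w) ^+ 2 -
        (y - w) * (2 * (a phi / (x - w) ^+ 3)) =
      a phi * (3 * (x - w) - 2 * (y - w)) / ((x - y) ^+ 2 * (x - w) ^+ 3) * (y - w) ^+ 2.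
      by field; rewrite xw xy.
    rewrite cmodM cmodX ler_wpM2r ?exprn_ge0 ?cmod_ge0//.
    rewrite cmodM cmodV 2!cmodM !cmodX; apply: ler_pM; rewrite ?mulr_ge0 ?cmod_ge0//.
    - by rewrite invr_ge0 mulr_ge0 ?exprn_ge0 ?cmod_ge0.
    - apply: ler_pM; rewrite ?cmod_ge0 ?hA//.
      apply: le_trans (cmodB _ _) _; rewrite !cmodM !cmod_nat.
      have : cmod (x - w) <= r + cmod (w - c).
        have -> : x - w = (x - c) - (w - c) by ring.
        by apply: le_trans (cmodB _ _) _; rewrite /x cmod_circle ?(ltW r0).
      by lra.
    - rewrite lef_pV2 ?posrE ?mulr_gt0 ?exprn_gt0 ?cmod_gt0//.
      rewrite (_ : 5 = 2 + 3)%N// exprD; apply: ler_pM; rewrite ?exprn_ge0 ?(ltW del0)//;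
      by rewrite lerXn2r ?nnegrE ?cmod_ge0 ?(ltW del0)// far.
Qed.

Definition cauchy_density H c r phi :=
  TP^-1%:C%C * (H (c + r%:C%C * expi phi) * (r%:C%C * expi phi)).

Lemma ccont_cauchy_density H c r : 0 <= r -> disc_cder H c r ->
  ccont 0 TP (cauchy_density H c r).
Proof.
move=> r0 dH; apply: ccontM; first exact: ccont_cst.
apply: ccontM.
  apply: (@ccont_comp _ _ _ H); first by apply: ccont_rder => x _; exact: rder_circle.
  by move=> x _; apply: dH; rewrite cmod_circle.
by apply: ccontM; [exact: ccont_cst|exact: ccont_expi].
Qed.

Lemma cauchyKE H c r w : 0 < r -> disc_cder H c r -> cmod (w - c) < r ->
  H w = cauchyK 1 (cauchy_density H c r) c r w.
Proof.
move=> r0 dH wr; have TP0 : TP%:C%C != 0 :> R[i].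
  by rewrite -cmod_gt0 cmodR normr_gt0 gt_eqF// twopi_gt0.
apply: (mulIf TP0); rewrite -(cauchy_formula r0 wr dH) [RHS]mulrC /cauchyK -cintZ.
  apply: eq_cint => phi _; rewrite /cauchy_density fmorphV expr1.
  by rewrite !mulrA divff// mul1r.
by apply: ccont_cauchyK => //; apply: ccont_cauchy_density; rewrite ?(ltW r0).
Qed.

Lemma holomorphic_discP f z : holomorphic_at f z <->
  exists2 r : R, 0 < r & forall w, cmod (w - z) < r -> exists d, cder f w d.
Proof.
split=> [/nbhs_cmodP[r r0 h]|[r r0 h]].
  by exists r => // w /h /derivable_cder hd; exists (f^`()%classic w).
by apply/nbhs_cmodP; exists r => // w /h[d /cder_derive1[]].
Qed.

Lemma holomorphic_disc f z : holomorphic_at f z ->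
  exists2 r : R, 0 < r & disc_cder f z r.
Proof.
move=> /holomorphic_discP[r r0 h]; exists (r / 2); first by rewrite divr_gt0.
move=> w wz; apply: h; apply: le_lt_trans wz _.
by rewrite ltr_pdivrMr// ltr_pMr// ltr1n.
Qed.

Lemma near_disc z w r : cmod (w - z) < r -> \forall y \near w, cmod (y - z) < r.
Proof.
move=> wz; apply/nbhs_cmodP; exists (r - cmod (w - z)); first by rewrite subr_gt0.
move=> y yw; have -> : y - z = (y - w) + (w - z) by ring.
by apply: le_lt_trans (cmodD _ _) _; rewrite -ltrBrDr.
Qed.

Lemma near_nbhsC z (P : R[i] -> Prop) : (\forall w \near z, P w) ->
  \forall w \near z, \forall y \near w, P y.
Proof.
move=> /nbhs_cmodP[r r0 h]; apply/nbhs_cmodP; exists r => // w wz.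
by have /nbhs_cmodP[r' r'0 h'] := near_disc wz; apply/nbhs_cmodP; exists r' => // y /h' /h.
Qed.

Lemma holomorphic_near f z : holomorphic_at f z ->
  \forall w \near z, holomorphic_at f w.
Proof. exact: near_nbhsC. Qed.

Lemma holomorphic_cder f z : holomorphic_at f z -> cder f z (f^`()%classic z).
Proof.
move=> /holomorphic_discP[r r0 h]; have [|d fd] := h z; first by rewrite subrr cmod0.
by have [_ ->] := cder_derive1 fd.
Qed.

Lemma holomorphic_at_derive f z : holomorphic_at f z -> holomorphic_at f^`()%classic z.
Proof.
move=> /holomorphic_disc[r r0 df]; apply/holomorphic_discP; exists r => // w wr.
pose a := cauchy_density f z r.
have ca : ccont 0 TP a by apply: ccont_cauchy_density df; exact: ltW.
have E1 y : cmod (y - z) < r -> f y = cauchyK 1 a z r y by exact: cauchyKE.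
have dE y : cmod (y - z) < r -> f^`()%classic y = cauchyK 2 a z r y.
  move=> yr; have [d1 _] := cder_cauchyK ca yr.
  suff fd : cder f y (cauchyK 2 a z r y) by have [_ ->] := cder_derive1 fd.
  apply: cder_near_eq d1; have /nbhs_cmodP[e e0 he] := near_disc yr.
  by apply/nbhs_cmodP; exists e => // u /he /E1.
have [_ d2] := cder_cauchyK ca wr; eexists; apply: cder_near_eq d2.
have /nbhs_cmodP[e e0 he] := near_disc wr.
by apply/nbhs_cmodP; exists e => // u /he /dE.
Qed.

Lemma holomorphic_at_deriven f z n : holomorphic_at f z -> holomorphic_at (f^`(n)%classic) z.
Proof.
move=> hf; elim: n => [|n ih]; first exact: hf.
exact: (holomorphic_at_derive ih).
Qed.

Lemma near_eq_derive1C f g z : holomorphic_at f z -> {near z, f =1 g} ->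
  {near z, f^`()%classic =1 g^`()%classic}.
Proof.
move=> /holomorphic_near /nbhs_cmodP[r r0 hf] /near_nbhsC /nbhs_cmodP[r' r'0 fg].
apply/nbhs_cmodP; exists (Num.min r r'); first by rewrite lt_min r0.
move=> w; rewrite lt_min => /andP[/hf fw /fg fgw].
have [_ gd] := cder_derive1 (cder_near_eq fgw (holomorphic_cder fw)).
exact: (esym gd).
Qed.

Lemma near_eq_deriven f g z n : holomorphic_at f z -> {near z, f =1 g} ->
  {near z, f^`(n)%classic =1 g^`(n)%classic}.
Proof.
move=> hf fg; elim: n => [|n ih]; first exact: fg.
exact: (near_eq_derive1C (holomorphic_at_deriven n hf) ih).
Qed.

Lemma near_eq_holomorphic f g z : {near z, f =1 g} -> holomorphic_at f z -> holomorphic_at g z.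
Proof.
move=> /near_nbhsC /nbhs_cmodP[r' r'0 fg] /holomorphic_discP[r r0 hf].
apply/holomorphic_discP; exists (Num.min r r'); first by rewrite lt_min r0.
move=> w; rewrite lt_min => /andP[/hf [d fw] /fg fgw]; exists d.
exact: cder_near_eq fw.
Qed.

Lemma holomorphic_at_op (op : R[i] -> R[i] -> R[i]) f g z :
  (forall f g w d e, cder f w d -> cder g w e -> exists e', cder (fun y => op (f y) (g y)) w e') ->
  holomorphic_at f z -> holomorphic_at g z -> holomorphic_at (fun y => op (f y) (g y)) z.
Proof.
move=> hop /holomorphic_discP[r r0 hf] /holomorphic_discP[r' r'0 hg].
apply/holomorphic_discP; exists (Num.min r r'); first by rewrite lt_min r0.
by move=> w; rewrite lt_min => /andP[/hf [d fw] /hg[e gw]]; exact: hop fw gw.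
Qed.

Lemma holomorphicD f g z : holomorphic_at f z -> holomorphic_at g z ->
  holomorphic_at (fun y => f y + g y) z.
Proof.
by apply: (@holomorphic_at_op +%R) => f' g' w d e fd ge; eexists; exact: cderD fd ge.
Qed.

Lemma holomorphicM f g z : holomorphic_at f z -> holomorphic_at g z ->
  holomorphic_at (fun y => f y * g y) z.
Proof.
by apply: (@holomorphic_at_op *%R) => f' g' w d e fd ge; eexists; exact: cderM fd ge.
Qed.

Lemma holomorphic_cst (c z : R[i]) : holomorphic_at (fun=> c) z.
Proof.
by apply/holomorphic_discP; exists 1 => // w _; exists 0; exact: cder_cst.
Qed.

Lemma holomorphic_id z : holomorphic_at id z.
Proof. by apply/holomorphic_discP; exists 1 => // w _; exists 1; exact: cder_id. Qed.

Lemma holomorphicB f g z : holomorphic_at f z -> holomorphic_at g z ->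
  holomorphic_at (fun y => f y - g y) z.
Proof.
by apply: (@holomorphic_at_op (fun x y => x - y)) => f' g' w d e fd ge; eexists; exact: cderB fd ge.
Qed.

Lemma holomorphicX f z n : holomorphic_at f z -> holomorphic_at (fun y => f y ^+ n) z.
Proof.
move=> hf; apply: (@holomorphic_at_op (fun x _ => x ^+ n) f f) => // f' g' w d e fd _.
by eexists; exact: cderX fd.
Qed.

Lemma holomorphic_continuous f z : holomorphic_at f z -> f y @[y --> z] --> f z.
Proof. by move=> /holomorphic_cder /cder_cvg. Qed.

Lemma near_neq0 f z : f y @[y --> z] --> f z -> f z != 0 -> \forall w \near z, f w != 0.
Proof.
move=> /cvg_nbhs_cmodP h fz0; have := h (cmod (f z)); rewrite cmod_gt0 => /(_ fz0)[r r0 hr].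
apply/nbhs_cmodP; exists r => // w /hr; apply: contraTN => /eqP ->.
by rewrite subr0 ltxx.
Qed.

Lemma holomorphicV f z : f z != 0 -> holomorphic_at f z -> holomorphic_at (fun y => (f y)^-1) z.
Proof.
move=> fz0 hf; have /nbhs_cmodP[r' r'0 f0] := near_neq0 (holomorphic_continuous hf) fz0.
move: hf => /holomorphic_discP[r r0 hf].
apply/holomorphic_discP; exists (Num.min r r'); first by rewrite lt_min r0.
by move=> w; rewrite lt_min => /andP[/hf [d fw] /f0 fw0]; eexists; exact: cderV fw.
Qed.

End holomorphic.

(** * Taylor coefficients as Fourier coefficients, and primitives *)

Section taylor.
Context {R : realType}.
Implicit Types (H f g h : R[i] -> R[i]) (c w z d : R[i]) (r : R).
Local Notation TP := (2 * pi : R).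

Definition holomorphic_disc0 H r := forall z, cmod z <= r -> holomorphic_at H z.

Lemma holomorphic_disc0_cder H r : holomorphic_disc0 H r -> disc_cder H 0 r.
Proof.
move=> hH z; rewrite subr0 => /hH /holomorphic_cder; by exists (H^`()%classic z).
Qed.

Lemma circle_mean0 H r : 0 < r -> holomorphic_disc0 H r ->
  cint 0 TP (fun phi => H (r%:C%C * expi phi)) = H 0 * TP%:C%C.
Proof.
move=> r0 /holomorphic_disc0_cder dH; rewrite -(circle_mean r0 dH).
by apply: eq_cint => phi _; rewrite add0r.
Qed.

Lemma cmod_circle0 r phi : 0 <= r -> cmod (r%:C%C * expi phi) = r.
Proof. by move=> r0; rewrite cmodM cmod_expi mulr1 cmodR ger0_norm. Qed.

Lemma rder_circle0 r phi :
  rder (fun phi => r%:C%C * expi phi : R[i]) phi (r%:C%C * ('i%C * expi phi)).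
Proof. exact: rderZ (rder_expi phi). Qed.

Lemma ccont_circle0 H r a b : 0 < r -> holomorphic_disc0 H r ->
  ccont a b (fun phi => H (r%:C%C * expi phi)).
Proof.
move=> r0 hH; apply: (@ccont_comp _ _ _ H).
  by apply: ccont_rder => x _; exact: rder_circle0.
move=> x _; eexists; apply: holomorphic_cder; apply: hH.
by rewrite cmod_circle0 ?(ltW r0).
Qed.

Lemma ccont_expiXV a b n : ccont a b (fun phi => (expi phi ^+ n)^-1 : R[i]).
Proof.
apply: ccontV; first by move=> x _; rewrite expf_neq0// expi_neq0.
exact: ccontX _ (@ccont_expi _ _ _).
Qed.

Lemma rder_expiXV n phi :
  rder (fun phi => (expi phi ^+ n)^-1 : R[i]) phi (- (n%:R * 'i%C) / expi phi ^+ n).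
Proof.
have e0 := expi_neq0 phi; have en0 : expi phi ^+ n != 0 by rewrite expf_neq0.
have h := gderV (@cvg_real_complex R) en0 (rderX n (rder_expi phi)).
suff <- : - (n%:R * expi phi ^+ n.-1 * ('i%C * expi phi)) / (expi phi ^+ n) ^+ 2 =
  - (n%:R * 'i%C) / expi phi ^+ n by exact: h.
case: n en0 {h} => [|n] en0; first by rewrite !mul0r oppr0 !mul0r.
by rewrite /= !exprS; field; rewrite e0 expf_neq0.
Qed.

(** Integration by parts on the circle: the derivative of [u] has integral 0 over a period, which
    trades one power of [expi phi] for one derivative of [H]. *)
Lemma circle_coef n H r : 0 < r -> holomorphic_disc0 H r ->
  cint 0 TP (fun phi => H (r%:C%C * expi phi) / expi phi ^+ n) =
  TP%:C%C * r%:C%C ^+ n / n`!%:R * H^`(n)%classic 0.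
Proof.
move=> r0; elim: n H => [|n ih] H hH.
  rewrite fact0 expr0 mulr1 divr1.
  transitivity (H 0 * TP%:C%C); last exact: mulrC.
  rewrite -(circle_mean0 r0 hH).
  by apply: eq_cint => phi _; rewrite expr0 divr1.
have hH' : holomorphic_disc0 H^`()%classic r.
  by move=> z /hH; exact: holomorphic_at_derive.
have := ih _ hH'; rewrite -derive1Sn => ih'.
pose u phi := H (r%:C%C * expi phi) / expi phi ^+ n.+1.
pose v phi := H^`()%classic (r%:C%C * expi phi) / expi phi ^+ n.
have cu : ccont 0 TP u by apply: ccontM; [exact: ccont_circle0|exact: ccont_expiXV].
have cv : ccont 0 TP v by apply: ccontM; [exact: ccont_circle0|exact: ccont_expiXV].
have du phi : rder u phi (r%:C%C * 'i%C * v phi - n.+1%:R * 'i%C * u phi).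
  have h1 : cder H (r%:C%C * expi phi) (H^`()%classic (r%:C%C * expi phi)).
    by apply: holomorphic_cder; apply: hH; rewrite cmod_circle0 ?(ltW r0).
  have h2 := rderM (rder_comp h1 (rder_circle0 r phi)) (rder_expiXV n.+1 phi).
  suff <- : H^`()%classic (r%:C%C * expi phi) * (r%:C%C * ('i%C * expi phi)) *
     (expi phi ^+ n.+1)^-1 +
     H (r%:C%C * expi phi) * (- (n.+1%:R * 'i%C) / expi phi ^+ n.+1) =
     r%:C%C * 'i%C * v phi - n.+1%:R * 'i%C * u phi by exact: h2.
  have e0 := expi_neq0 phi.
  rewrite /u /v exprS; field; by rewrite e0 expf_neq0.
have c1 : ccont 0 TP (fun phi => r%:C%C * 'i%C * v phi) by apply: ccontM cv; exact: ccont_cst.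
have c2 : ccont 0 TP (fun phi => n.+1%:R * 'i%C * u phi) by apply: ccontM cu; exact: ccont_cst.
have := cint_FTC (ltW twopi_gt0) (ccontB c1 c2) (fun x _ => du x).
rewrite (cintB c1 c2) (cintZ _ cv) (cintZ _ cu).
rewrite {2 3}/u expi2pi expi0 subrr => /eqP; rewrite subr_eq0 => /eqP E.
have i0 : 'i%C != 0 :> R[i] by rewrite eq_complex /= oner_eq0 andbF.
have n0 : n.+1%:R != 0 :> R[i] by rewrite pnatr_eq0.
have ni : n.+1%:R * 'i%C != 0 :> R[i] by rewrite mulf_neq0.
have f0 : n`!%:R != 0 :> R[i] by rewrite pnatr_eq0 -lt0n fact_gt0.
apply: (mulfI ni); rewrite -/u -E -/v ih' factS natrM exprS.
move: (n.+1%:R) (n`!%:R) n0 f0 => N K N0 K0.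
by field; rewrite N0 K0.
Qed.

(** The mean value property for H(z) z^(k+1), which vanishes at 0. *)
Lemma circle_coef_neg k H r : 0 < r -> holomorphic_disc0 H r ->
  cint 0 TP (fun phi => H (r%:C%C * expi phi) * expi phi ^+ k.+1) = 0.
Proof.
move=> r0 hH; pose G z := H z * z ^+ k.+1.
have hG : holomorphic_disc0 G r.
  by move=> z hz; apply: holomorphicM; [exact: hH|apply: holomorphicX; exact: holomorphic_id].
have rC : r%:C%C ^+ k.+1 != 0 :> R[i].
  by rewrite expf_neq0// -cmod_gt0 cmodR normr_gt0 gt_eqF.
have := circle_mean0 r0 hG; rewrite {2}/G expr0n mulr0 mul0r => h.
apply: (mulfI rC); rewrite mulr0 -h -cintZ.
  by apply: eq_cint => phi _; rewrite /G exprMn; ring.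
by apply: ccontM; [exact: ccont_circle0|exact: ccontX _ (@ccont_expi _ _ _)].
Qed.

(** In Re H = (H + conj H) / 2 the conjugate contributes the conjugate of a coefficient of negative
    index, which is 0. Thus the real part alone determines the derivatives of positive order at 0,
    with half the factor of [circle_coef]. *)
Lemma circle_coef_Re k H r : 0 < r -> holomorphic_disc0 H r ->
  cint 0 TP (fun phi => (Re (H (r%:C%C * expi phi)))%:C%C / expi phi ^+ k.+1) =
  pi%:C%C * r%:C%C ^+ k.+1 / k.+1`!%:R * H^`(k.+1)%classic 0.
Proof.
move=> r0 hH.
have cH := @ccont_circle0 H r 0 TP r0 hH.
have c1 : ccont 0 TP (fun phi => H (r%:C%C * expi phi) / expi phi ^+ k.+1).
  by apply: ccontM cH _; exact: ccont_expiXV.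
have c2 : ccont 0 TP (fun phi => H (r%:C%C * expi phi) * expi phi ^+ k.+1).
  by apply: ccontM cH _; exact: ccontX _ (@ccont_expi _ _ _).
have cM (x y : R[i]) : (x * y)^*%C = x^*%C * y^*%C by exact: (rmorphM (@conjc R)).
have E phi : (Re (H (r%:C%C * expi phi)))%:C%C / expi phi ^+ k.+1 =
   2^-1 * (H (r%:C%C * expi phi) / expi phi ^+ k.+1 +
     (H (r%:C%C * expi phi) * expi phi ^+ k.+1)^*%C).
  rewrite cM (_ : (expi phi ^+ k.+1)^*%C = (expi phi ^+ k.+1)^-1).
    by rewrite ReJ_add; field; rewrite expf_neq0// expi_neq0.
  by rewrite -exprVn -conj_expi; exact: (rmorphXn (@conjc R)).
under eq_cint do rewrite E.
have c2' := ccont_conj c2.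
rewrite (cintZ _ (ccontD c1 c2')) (cintD c1 c2') (cint_conj c2).
rewrite (circle_coef_neg _ r0 hH) (circle_coef _ r0 hH) conjc0 addr0.
have -> : TP%:C%C = 2 * pi%:C%C :> R[i] by rewrite rmorphM rmorph_nat.
by field; rewrite pnatr_eq0 -lt0n fact_gt0.
Qed.

(* The primitive is the integral along rays; Goursat's theorem on triangles
   with apex 0 gives its increments. *)
Lemma holomorphic_primitive h r :
  (forall z, cmod z < r -> exists d, cder h z d) ->
  exists2 P : R[i] -> R[i], P 0 = 0 & forall z, cmod z < r -> cder P z (h z).
Proof.
move=> dh; exists (fun z => cint 0 1 (fun s => h (s%:C%C * z) * z)).
  under eq_cint do rewrite mulr0.
  by rewrite cint_cst// mul0r.
set P := fun z => _.
have PB z w : cmod z < r -> cmod w < r ->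
    P w - P z = cint 0 1 (fun l => h (z + l%:C%C * (w - z)) * (w - z)) /\
    ccont 0 1 (fun l => h (z + l%:C%C * (w - z)) * (w - z)).
  move=> zr wr; pose zeta (l : R) := z + l%:C%C * (w - z); pose dzeta (l : R) := w - z.
  have zetaE l : zeta l = (1 - l)%:C%C * z + l%:C%C * w.
    by rewrite /zeta rmorphB rmorph1; ring.
  have in_disc l : 0 <= l <= 1 -> cmod (zeta l) < r.
    move=> /andP[l0 l1]; rewrite zetaE; apply: le_lt_trans (cmodD _ _) _.
    rewrite !cmodM !cmodR !ger0_norm ?subr_ge0//.
    have [->|lN1] := eqVneq l 1; first by rewrite subrr mul0r add0r mul1r.
    have l1' : 0 < 1 - l by rewrite subr_gt0 lt_neqAle lN1.
    have h1 : (1 - l) * cmod z < (1 - l) * r by rewrite ltr_pM2l.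
    have h2 : l * cmod w <= l * r by rewrite ler_wpM2l// ltW.
    by apply: lt_le_trans (ltr_leD h1 h2) _; rewrite -mulrDl subrK mul1r.
  have cone_disc s l : 0 <= s <= 1 -> 0 <= l <= 1 -> cmod (cone 0 zeta s l) < r.
    move=> /andP[s0 s1] /in_disc h1; rewrite /cone add0r subr0 cmodM cmodR ger0_norm//.
    by apply: le_lt_trans h1; rewrite ler_piMl ?cmod_ge0.
  have dz l : rder zeta l (dzeta l).
    have := rderD (rder_cst z l) (rderM (rder_real l) (rder_cst (w - z) l)).
    by rewrite mul1r mulr0 addr0 add0r.
  have r0 : 0 < r by exact: le_lt_trans (cmod_ge0 _) zr.
  have L0 : 0 < 2 * r by rewrite mulr_gt0.
  have h01 : 0 <= 1 :> R by [].
  have cdz : ccont 0 1 dzeta by exact: ccont_cst.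
  have := @goursat R h 0 zeta dzeta (0, 1) (0, 1) (2 * r) (lexx _) h01 (lexx _) h01
    (fun l _ => dz l) cdz L0.
  have b1 (l : R) : 0 <= l <= 1 -> cmod (zeta l - 0) <= 2 * r.
    move=> /in_disc; rewrite subr0 => /ltW /le_trans; apply.
    by rewrite ler_peMl ?ler1n// ltW.
  have b2 (l : R) : 0 <= l <= 1 -> cmod (dzeta l) <= 2 * r.
    by move=> _; apply: le_trans (cmodB _ _) _; rewrite mulr_natl mulr2n lerD// ltW.
  have b3 (s l : R) : 0 <= s <= 1 -> 0 <= l <= 1 -> exists d, cder h (cone 0 zeta s l) d.
    by move=> hs hl; apply: dh; exact: cone_disc.
  move=> /(_ b1 b2 b3); rewrite /cone_loop /=.
  have -> : cone_side 0 zeta h 0 1 0 = P z.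
    by apply: eq_cint => s _; rewrite /cone /zeta mul0r add0r !subr0 addr0.
  have -> : cone_side 0 zeta h 0 1 1 = P w.
    by apply: eq_cint => s _; rewrite /cone /zeta add0r !subr0 rmorph1 mul1r addrC subrK.
  have -> : cone_arc 0 zeta dzeta h 0 1 1 =
      cint 0 1 (fun l => h (z + l%:C%C * (w - z)) * (w - z)).
    by apply: eq_cint => s _; rewrite /cone add0r subr0 rmorph1 !mul1r.
  have -> : cone_arc 0 zeta dzeta h 0 1 0 = 0.
    rewrite /cone_arc; under eq_cint do rewrite mul0r mulr0.
    by rewrite cint_cst// mul0r.
  rewrite subr0 => E; split.
    by move/eqP: E; rewrite addrC addr_eq0 opprB => /eqP <-.
  apply: ccontM; last exact: ccont_cst.
  apply: (@ccont_comp _ _ _ h zeta); first by apply: ccont_rder => x _; exact: dz.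
  by move=> x hx; apply: dh; exact: in_disc.
move=> z zr; apply: cder_of_eps => e e0.
have [d hd] := dh _ zr.
have e20 : 0 < e / 2 by rewrite divr_gt0.
have /cvg_nbhs_cmodP /(_ _ e20)[e' e'0 he'] := cder_cvg hd.
exists (Num.min e' (r - cmod z)); first by rewrite lt_min e'0 subr_gt0.
move=> w; rewrite lt_min => /andP[we wr].
have wr' : cmod w < r.
  have -> : w = (w - z) + z by rewrite subrK.
  by apply: le_lt_trans (cmodD _ _) _; rewrite -ltrBrDr.
have [-> cc] := PB _ _ zr wr'.
have c2 : ccont 0 1 (fun l : R => h z * (w - z)) by exact: ccont_cst.
have -> : h z * (w - z) = cint 0 1 (fun l => h z * (w - z)).
  by rewrite cint_cst// subr0 rmorph1 mulr1.
rewrite -(cintB cc c2).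
have -> : e * cmod (w - z) = 2 * (e / 2 * cmod (w - z)) * (1 - 0) by rewrite subr0; field.
apply: (cint_le ler01 (ccontB cc c2)) => l /andP[l0 l1]; rewrite -mulrBl cmodM ler_wpM2r ?cmod_ge0// cmodBC ltW//.
apply: he'; rewrite addrAC subrr add0r cmodM cmodR ger0_norm//.
by apply: le_lt_trans we; rewrite ler_piMl ?cmod_ge0.
Qed.

End taylor.

(** * Zeros, poles and multiplicities *)

Section zeros.
Context {R : realType}.
Implicit Types (H f g h : R[i] -> R[i]) (c w z d : R[i]) (r : R).
Local Notation TP := (2 * pi : R).

Lemma geometric_small (q k e : R) : 0 <= q < 1 -> 0 <= k -> 0 < e ->
  exists n, k * q ^+ n < e.
Proof.
move=> /andP[q0 q1] k0 e0.
have k1 : 0 < k + 1 by rewrite ltr_wpDl.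
have ek : 0 < e / (k + 1) by rewrite divr_gt0.
have q1' : `|q| < 1 by rewrite ger0_norm.
have /cvgrPdist_lt /(_ _ ek) [N _ hN] := cvg_expr q1'.
exists N; have := hN N (leqnn N); rewrite sub0r normrN ger0_norm ?exprn_ge0//.
rewrite ltr_pdivlMr// => h; apply: le_lt_trans h; rewrite mulrC.
by rewrite ler_wpM2l ?exprn_ge0// lerDl.
Qed.

Lemma near_puncturedP z (P : R[i] -> Prop) : (\forall w \near z^', P w) <->
  exists2 r : R, 0 < r & forall w, cmod (w - z) < r -> w != z -> P w.
Proof.
split=> [h|[r r0 h]].
  have /nbhs_cmodP[r r0 h'] : \forall w \near z, w != z -> P w by exact: h.
  by exists r.
suff : \forall w \near z, w != z -> P w by [].
by apply/nbhs_cmodP; exists r.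
Qed.

(** [Hk k] is the Taylor remainder of order k divided by (w - c)^k, so that [Hk k c] is the k-th
    Taylor coefficient. The first nonzero coefficient gives the order. If all vanish, then H(w) = (w
    - c)^k Hk k w for every k, and the Cauchy bound on [Hk k] makes this O((|w - c| / r)^k). *)
Lemma zero_dichotomy H c r : 0 < r -> disc_cder H c r ->
  (forall w, cmod (w - c) < r -> H w = 0) \/ exists m, zero_of_order H c m.
Proof.
move=> r0 dH; pose a := cauchy_density H c r.
have ca : ccont 0 TP a by apply: ccont_cauchy_density dH; exact: ltW.
pose ak k phi := a phi / (c + r%:C%C * expi phi - c) ^+ k.
have cc : cmod (c - c) < r by rewrite subrr cmod0.
have cak k : ccont 0 TP (ak k) by exact: ccont_cauchyK.
pose Hk k := cauchyK 1 (ak k) c r.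
have H0 w : cmod (w - c) < r -> H w = Hk 0%N w.
  move=> wr; rewrite (cauchyKE r0 dH wr); apply: eq_cint => phi _.
  by rewrite /ak expr0 divr1.
have HkS k w : cmod (w - c) < r -> Hk k w = Hk k c + (w - c) * Hk k.+1 w.
  move=> wr; rewrite /Hk /cauchyK.
  have c1 := @ccont_cauchyK _ 1 _ _ _ _ (cak k.+1) wr.
  have c2 : ccont 0 TP (fun phi => (w - c) * (ak k.+1 phi / (c + r%:C%C * expi phi - w) ^+ 1)).
    by apply: ccontM c1; exact: ccont_cst.
  rewrite -(cintZ _ c1) -(cintD (@ccont_cauchyK _ 1 _ _ _ _ (cak k) cc) c2).
  apply: eq_cint => phi _; rewrite /ak !expr1 exprS.
  have n1 := circle_neq phi wr; have n2 := circle_neq phi cc.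
  set x := c + r%:C%C * expi phi in n1 n2 *.
  have -> : x - w = (x - c) - (w - c) by ring.
  rewrite (_ : x - w = (x - c) - (w - c)) in n1; last by ring.
  move: (x - c) (w - c) n1 n2 => u v n1 n2.
  have uk : u ^+ k != 0 by rewrite expf_neq0.
  by move: (u ^+ k) uk => U U0; field; rewrite n1 n2 U0.
have Hpow k w : cmod (w - c) < r -> (forall j, (j < k)%N -> Hk j c = 0) ->
    H w = (w - c) ^+ k * Hk k w.
  move=> wr; elim: k => [|k ih] hk; first by rewrite expr0 mul1r H0.
  rewrite ih => [|j jk]; last by apply: hk; rewrite ltnW.
  by rewrite HkS// hk// add0r exprSr mulrA.
have [ex|nex] := pselect (exists k, Hk k c != 0).
  right; exists (ex_minn ex); case: ex_minnP => m hm mmin.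
  exists (Hk m); split => //.
    apply/holomorphic_discP; exists r => // w wr; eexists.
    by have [h _] := cder_cauchyK (cak m) wr; exact: h.
  apply/nbhs_cmodP; exists r => // w wr; apply: Hpow => // j jm.
  by apply/eqP; apply: contraTT jm => /mmin; rewrite -leqNgt.
left => w wr.
have Hz j : Hk j c = 0 by apply/eqP; apply: contrapT => /negP hj; apply: nex; exists j.
have [A A0 hA] := ccont_bounded (ltW twopi_gt0) ca.
apply/eqP; rewrite -cmod_eq0 eq_le cmod_ge0 andbT.
apply/ler_addgt0Pl => e e0; rewrite addr0.
have rw : 0 < r - cmod (w - c) by rewrite subr_gt0.
have q01 : 0 <= cmod (w - c) / r < 1.
  by rewrite divr_ge0 ?cmod_ge0 ?(ltW r0)//= ltr_pdivrMr ?mul1r.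
have K0 : 0 <= 2 * (A / (r - cmod (w - c))) * TP.
  by rewrite !mulr_ge0 ?invr_ge0 ?(ltW A0) ?(ltW rw) ?pi_ge0.
have [n hn] := geometric_small q01 K0 e0.
rewrite (Hpow n w)// cmodM cmodX; apply: le_trans (ltW hn).
have hb phi : 0 <= phi <= TP ->
    cmod (ak n phi / (c + r%:C%C * expi phi - w) ^+ 1) <= A / r ^+ n / (r - cmod (w - c)).
  move=> hphi; rewrite expr1 cmodM cmodV; apply: ler_pM; rewrite ?cmod_ge0 ?invr_ge0 ?cmod_ge0//.
    by rewrite cmodM cmodV cmodX cmod_circle ?(ltW r0)// ler_wpM2r ?invr_ge0 ?exprn_ge0 ?(ltW r0)// hA.
  by rewrite lef_pV2 ?posrE ?cmod_gt0 ?circle_neq// circle_dist ?(ltW r0).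
have := cint_le (ltW twopi_gt0) (@ccont_cauchyK _ 1 _ _ _ _ (cak n) wr) hb.
move=> /(ler_wpM2l (exprn_ge0 n (cmod_ge0 (w - c)))) /le_trans; apply.
rewrite le_eqVlt; apply/predU1P; left; rewrite subr0 exprMn exprVn; ring.
Qed.

Lemma pole_near_neq0 f z : is_pole f z -> \forall w \near z^', f w != 0.
Proof.
move=> [m m0 [g [hg gz0 /near_puncturedP[r r0 fg]]]].
have /nbhs_cmodP[r' r'0 g0] := near_neq0 (holomorphic_continuous hg) gz0.
apply/near_puncturedP; exists (Num.min r r'); first by rewrite lt_min r0.
move=> w; rewrite lt_min => /andP[wr wr'] wz; rewrite fg//.
by rewrite mulf_neq0 ?g0// invr_neq0// expf_neq0// subr_eq0.
Qed.

Lemma zero_of_order_near_neq0 f z m : zero_of_order f z m -> \forall w \near z^', f w != 0.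
Proof.
move=> [g [hg gz0 /nbhs_cmodP[r r0 fg]]].
have /nbhs_cmodP[r' r'0 g0] := near_neq0 (holomorphic_continuous hg) gz0.
apply/near_puncturedP; exists (Num.min r r'); first by rewrite lt_min r0.
move=> w; rewrite lt_min => /andP[wr wr'] wz; rewrite fg//.
by rewrite mulf_neq0 ?g0// expf_neq0// subr_eq0.
Qed.

Lemma exists_punctured z w r : 0 < r -> exists y, [/\ cmod (y - z) < r, y != z & y != w].
Proof.
move=> r0; pose t := r / 2; have t0 : 0 < t by rewrite divr_gt0.
have tr : t < r by rewrite ltr_pdivrMr// ltr_pMr// ltr1n.
have tC (s : R) : s != 0 -> z + s%:C%C != z.
  by move=> s0; rewrite -subr_eq0 addrAC subrr add0r -cmod_eq0 cmodR normr_eq0.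
have [e|ne] := eqVneq (z + t%:C%C) w; last first.
  exists (z + t%:C%C); split => //; last by rewrite tC ?gt_eqF.
  by rewrite addrAC subrr add0r cmodR gtr0_norm.
exists (z + (- t)%:C%C); split.
- by rewrite addrAC subrr add0r cmodR normrN gtr0_norm.
- by rewrite tC// oppr_eq0 gt_eqF.
- rewrite -e -subr_eq0 opprD addrACA subrr add0r -rmorphB -cmod_eq0 cmodR.
  by rewrite normr_eq0 -opprD oppr_eq0 gt_eqF// addr_gt0.
Qed.

(* The set of points around which [f] vanishes identically is open and closed;
   it is met by the ray from 0 to [z0] in a clopen subset of the line. *)
Lemma zero_finite_order f z0 : meromorphic f -> holomorphic_at f 0 -> f 0 != 0 ->
  holomorphic_at f z0 -> exists m, zero_of_order f z0 m.
Proof.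
move=> fm f_hol0 f00 hz0.
pose E z := \forall w \near z^', f w = 0.
have [r0 r00 dz0] := holomorphic_disc hz0.
have [vanish|//] := zero_dichotomy r00 dz0; exfalso.
have Ez0 : E z0 by apply/near_puncturedP; exists r0 => // w wr _; exact: vanish.
have dich z : E z \/ \forall w \near z^', f w != 0.
  have [hz|/pole_near_neq0] := fm z; last by right.
  have [r rgt0 dz] := holomorphic_disc hz.
  have [v|[m /zero_of_order_near_neq0]] := zero_dichotomy rgt0 dz; last by right.
  by left; apply/near_puncturedP; exists r => // w wr _; exact: v.
have excl z : E z -> (\forall w \near z^', f w != 0) -> False.
  move=> /near_puncturedP[r rgt0 h1] /near_puncturedP[r' r'gt0 h2].
  have [|y [yr yz _]] := @exists_punctured z z (Num.min r r'); first by rewrite lt_min rgt0.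
  move: yr; rewrite lt_min => /andP[yr yr'].
  by have := h2 _ yr' yz; rewrite h1// eqxx.
have punct_open (P : R[i] -> Prop) z : (\forall w \near z^', P w) ->
    \forall w \near z, \forall y \near w^', P y.
  move=> Pz; have /near_puncturedP[r rgt0 h] := Pz.
  apply/nbhs_cmodP; exists r; [exact: rgt0|move=> w wr].
  have [->|wz] := eqVneq w z; first exact: Pz.
  have /nbhs_cmodP[e e0 he] := near_disc wr.
  apply/near_puncturedP; exists (Num.min e (cmod (w - z))).
    by rewrite lt_min e0 cmod_gt0 subr_eq0.
  move=> y; rewrite lt_min => /andP[/he yr yw] _; apply: h => //.
  by apply: contraTneq yw => ->; rewrite cmodBC ltxx.
have nE0 : ~ E 0.
  move=> E0; apply: (excl 0 E0); have [r rgt0 h] := (iffLR (nbhs_cmodP _ _))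
    (near_neq0 (holomorphic_continuous f_hol0) f00).
  by apply/near_puncturedP; exists r => // w wr _; exact: h.
pose gam (t : R) := t%:C%C * z0.
have near_gam (Q : R[i] -> Prop) (t : R) : (\forall w \near gam t, Q w) ->
    \forall s \near t, Q (gam s).
  move=> /nbhs_cmodP[r rgt0 hr].
  pose proof (cvgCM (@cvg_real_complex R t) (cvgCC z0)) as cgam.
  have /cvg_cmodP /(_ _ rgt0) := cgam.
  by apply: filterS => s hs; apply: hr; rewrite cmodBC.
pose B : set R := [set t | E (gam t)].
have openB : open B.
  rewrite openE => t Et; exact: (near_gam E t (punct_open _ _ Et)).
have openCB : open (~` B).
  rewrite openE => t nEt.
  have [Et|h] := dich (gam t); first by case: nEt.
  have := near_gam _ _ (punct_open _ _ h).
  by apply: filterS => s h1 h2; exact: (excl _ h2 h1).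
have /(_ B) := (iffRL (connected_intervalP [set: R])) (fun _ _ _ _ _ _ => I).
have g0 : gam 0 = 0 by exact: mul0r.
have g1 : gam 1 = z0 by exact: mul1r.
move=> H; have BT : B = setT.
  apply: H.
  - by exists 1; rewrite /B /= g1.
  - by exists B; [exact: openB|exact: (esym (setTI B))].
  - exists B; [|exact: (esym (setTI B))].
    by rewrite -[B]setCK; exact: open_closedC.
by apply: nE0; have : B 0 by [rewrite BT]; rewrite /B /= g0.
Qed.

(** Compactness of the closed disc through [rect_bisection]: [Q] asks for a common margin [e] on a
    rectangle, and small rectangles around a point off the disc satisfy it vacuously for a small
    margin. *)
Lemma disc_enlarge (P : R[i] -> Prop) r : 0 <= r ->
  (forall z, cmod z <= r -> \forall w \near z, P w) ->
  exists2 r', r < r' & forall z, cmod z <= r' -> P z.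
Proof.
move=> r0 hP.
pose Q (p q : R * R) := exists2 e, 0 < e & forall x y, p.1 <= x <= p.2 ->
  q.1 <= y <= q.2 -> cmod (Complex x y) <= r + e -> P (Complex x y).
have r1 : - (r + 1) <= r + 1 by rewrite ge0_cp// addr_ge0.
have : Q (- (r + 1), r + 1) (- (r + 1), r + 1).
  apply: rect_bisection => //=.
    move=> p q _ p12 _ _ q12 _ h.
    have [e1 e10 h1] := h _ _ (or_introl erefl) (or_introl erefl).
    have [e2 e20 h2] := h _ _ (or_introl erefl) (or_intror erefl).
    have [e3 e30 h3] := h _ _ (or_intror erefl) (or_introl erefl).
    have [e4 e40 h4] := h _ _ (or_intror erefl) (or_intror erefl).
    exists (Num.min (Num.min e1 e2) (Num.min e3 e4)).
      by rewrite !lt_min e10 e20 e30.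
    move=> x y /andP[x1 x2] /andP[y1 y2] hxy.
    have le_e e : Num.min (Num.min e1 e2) (Num.min e3 e4) <= e ->
      cmod (Complex x y) <= r + e by move=> he; apply: le_trans hxy _; rewrite lerD2l.
    have [xm|/ltW xm] := leP x ((p.1 + p.2) / 2); have [ym|/ltW ym] := leP y ((q.1 + q.2) / 2).
    - by apply: h1; rewrite /= ?x1 ?y1// le_e// !ge_min lexx.
    - by apply: h2; rewrite /= ?x1 ?y2 ?ym// le_e// !ge_min lexx ?orbT.
    - by apply: h3; rewrite /= ?x2 ?y1 ?xm// le_e// !ge_min lexx ?orbT.
    - by apply: h4; rewrite /= ?x2 ?y2 ?xm ?ym// le_e// !ge_min lexx ?orbT.
  move=> x y _ _; set z := Complex x y.
  have small e p q : p.1 <= x <= p.2 -> q.1 <= y <= q.2 -> p.2 - p.1 < e -> q.2 - q.1 < e ->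
      forall x' y', p.1 <= x' <= p.2 -> q.1 <= y' <= q.2 -> cmod (Complex x' y' - z) < e + e.
    move=> /andP[x1 x2] /andP[y1 y2] lp lq x' y' /andP[x3 x4] /andP[y3 y4].
    apply: le_lt_trans (cmod_ReIm _) _; rewrite /=.
    by apply: ltrD; rewrite ltr_norml; apply/andP; split; lra.
  have [zr|zr] := leP (cmod z) r.
    have /nbhs_cmodP[e e0 he] := hP _ zr.
    exists (e / 2) => [|p q /andP[_ px] /andP[xp _] /andP[_ qx] /andP[xq _] lp lq].
      by rewrite divr_gt0.
    exists 1 => // x' y' hx hy _; apply: he.
    rewrite [e in _ < e]splitr; apply: (small (e / 2) p q) => //.
      by rewrite px xp.
    by rewrite qx xq.
  have e0 : 0 < cmod z - r by rewrite subr_gt0.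
  exists ((cmod z - r) / 4) => [|p q /andP[_ px] /andP[xp _] /andP[_ qx] /andP[xq _] lp lq].
    by rewrite divr_gt0.
  exists ((cmod z - r) / 4) => [|x' y' hx hy hz]; first by rewrite divr_gt0.
  have px' : p.1 <= x <= p.2 by rewrite px xp.
  have qx' : q.1 <= y <= q.2 by rewrite qx xq.
  have := small _ _ _ px' qx' lp lq _ _ hx hy.
  have := cmod_sub z (Complex x' y'); rewrite cmodBC; lra.
(* The minimum with 1 keeps the enlarged disc inside the square of half-side r + 1 that was
   bisected. *)
move=> [e e0 he]; exists (r + Num.min e 1).
  by rewrite ltrDl lt_min e0 ltr01.
move=> z; rewrite -[z]Complex_Re_Im => hz; apply: he => /=.
- have := le_trans (normr_Re _) hz => /=; rewrite ler_norml => /andP[h1 h2].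
  have : Num.min e 1 <= 1 by rewrite ge_min lexx orbT.
  by move=> h3; apply/andP; split; lra.
- have := le_trans (normr_Im _) hz => /=; rewrite ler_norml => /andP[h1 h2].
  have : Num.min e 1 <= 1 by rewrite ge_min lexx orbT.
  by move=> h3; apply/andP; split; lra.
- by apply: le_trans hz _; rewrite lerD2l ge_min lexx.
Qed.

End zeros.

(** * Fourier coefficients of the logarithm of the modulus *)

Section log_modulus.
Context {R : realType}.
Implicit Types (g h : R[i] -> R[i]) (z d : R[i]) (r : R).
Local Notation TP := (2 * pi : R).
Local Notation mu := (@lebesgue_measure R).

(** Removes the square root before differentiation. At z = 0 both sides are 0 because ln 0 = 0. *)
Lemma ln_cmod z : ln (cmod z) = 2^-1 * ln (Re z ^+ 2 + Im z ^+ 2).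
Proof.
case: z => a b; rewrite /cmod /=; set N := a ^+ 2 + b ^+ 2.
have N0 : 0 <= N by rewrite addr_ge0 ?sqr_ge0.
have [->|Nn0] := eqVneq N 0; first by rewrite sqrtr0 !ln0 ?mulr0.
have Npos : 0 < N by rewrite lt_neqAle eq_sym Nn0.
rewrite -{2}(sqr_sqrtr N0) lnXn ?sqrtr_gt0// mulr2n.
by rewrite -mulr2n -[X in _ = _ * X]mulr_natr mulrC mulfK.
Qed.

Lemma is_derive_ln_cmod (f : R -> R[i]) t d : rder f t d -> f t != 0 ->
  is_derive t 1 (fun s => ln (cmod (f s))) (Re (d / f t)).
Proof.
move=> fd ft0; have [dr di] := rder_is_derive fd.
have -> : (fun s => ln (cmod (f s))) =
    2^-1 \*: (@ln R \o (fun s => Re (f s) ^+ 2 + Im (f s) ^+ 2)).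
  by apply/funext => s; rewrite ln_cmod.
have N0 : 0 < Re (f t) ^+ 2 + Im (f t) ^+ 2.
  rewrite lt_neqAle eq_sym addr_ge0 ?sqr_ge0// andbT.
  rewrite paddr_eq0 ?sqr_ge0// !expf_eq0 /=.
  by move: ft0; rewrite eq_complex.
have dl := is_derive1_ln N0.
have dN : is_derive t 1 (fun s => Re (f s) ^+ 2 + Im (f s) ^+ 2)
   (2 * (Re (f t) * Re d + Im (f t) * Im d)).
  have -> : (fun s => Re (f s) ^+ 2 + Im (f s) ^+ 2) =
      (fun s => Re (f s)) * (fun s => Re (f s)) + (fun s => Im (f s)) * (fun s => Im (f s)).
    by apply/funext => s; rewrite !expr2.
  apply: (is_derive_eq (is_deriveD (is_deriveM dr dr) (is_deriveM di di))).
  by rewrite /GRing.scale /=; ring.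
have dc := @is_derive1_comp R (@ln R) (fun s => Re (f s) ^+ 2 + Im (f s) ^+ 2) t _ _ dl dN.
apply: (@is_derive_eq _ _ _ _ _ _ _ _ (@is_deriveZ _ _ _ _ 2^-1 _ _ _ dc)).
case: (f t) d N0 {dr di dl dN dc fd ft0} => a b [u v] /= N0.
by rewrite /GRing.scale /=; field; rewrite gt_eqF.
Qed.

(** [P] is a primitive of g'/g on a slightly larger disc, normalized to ln |g(0)| at 0. Instead of
    comparing [g] with an exponential, ln |g| and Re P are compared along each ray from 0: they have
    the same derivative and the same value at 0. *)
Lemma holomorphic_log g r : 0 < r ->
  (forall z, cmod z <= r -> holomorphic_at g z /\ g z != 0) ->
  exists P : R[i] -> R[i], [/\ holomorphic_disc0 P r,
    forall z, cmod z <= r -> ln (cmod (g z)) = Re (P z)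
    & forall k, P^`(k.+1)%classic 0 = (log_derivative g)^`(k)%classic 0].
Proof.
move=> r0 hg.
have [r' rr' hg'] : exists2 r', r < r' &
    forall z, cmod z <= r' -> holomorphic_at g z /\ g z != 0.
  apply: disc_enlarge => [|z /hg[hz gz0]]; first exact: ltW.
  have /nbhs_cmodP[e1 e10 h1] := holomorphic_near hz.
  have /nbhs_cmodP[e2 e20 h2] := near_neq0 (holomorphic_continuous hz) gz0.
  apply/nbhs_cmodP; exists (Num.min e1 e2); first by rewrite lt_min e10.
  by move=> w; rewrite lt_min => /andP[/h1 ? /h2 ?].
pose h := log_derivative g.
have hh z : cmod z <= r' -> holomorphic_at h z.
  move=> /hg'[hz gz0]; apply: holomorphicM; first exact: holomorphic_at_derive.
  exact: holomorphicV.
have [P0 P00 dP0] : exists2 P, P 0 = 0 & forall z, cmod z < r' -> cder P z (h z).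
  by apply: holomorphic_primitive => z /ltW /hh /holomorphic_cder; exists (h^`()%classic z).
pose P z := (ln (cmod (g 0)))%:C%C + P0 z.
have dP z : cmod z < r' -> cder P z (h z).
  by move=> /dP0 hz; have := cderD (cder_cst (ln (cmod (g 0)))%:C%C z) hz; rewrite add0r.
have holP z : cmod z < r' -> holomorphic_at P z.
  move=> zr; apply/holomorphic_discP; exists (r' - cmod z); first by rewrite subr_gt0.
  move=> w wz; exists (h w); apply: dP.
  have -> : w = (w - z) + z by rewrite subrK.
  by apply: le_lt_trans (cmodD _ _) _; rewrite -ltrBrDr.
have r'0 : 0 < r' by exact: lt_trans rr'.
exists P; split.
- by move=> z zr; apply: holP; exact: le_lt_trans rr'.
- move=> z zr; have zr' : cmod z < r' by exact: le_lt_trans rr'.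
  have sz (s : R) : 0 <= s <= 1 -> cmod (s%:C%C * z) < r'.
    move=> /andP[s0 s1]; rewrite cmodM cmodR ger0_norm//.
    by apply: le_lt_trans zr'; rewrite ler_piMl ?cmod_ge0.
  have dsz (s : R) : rder (fun s : R => s%:C%C * z) s z.
    by have := rderM (rder_real s) (rder_cst z s); rewrite mul1r mulr0 addr0.
  pose u (s : R) := ln (cmod (g (s%:C%C * z))) - Re (P (s%:C%C * z)).
  have du (s : R) : 0 <= s <= 1 -> is_derive s 1 u 0.
    move=> /sz hs; have [hgz gz0] := hg' _ (ltW hs).
    have d1 := is_derive_ln_cmod (rder_comp (holomorphic_cder hgz) (dsz s)) gz0.
    have [d2 _] := rder_is_derive (rder_comp (dP _ hs) (dsz s)).
    suff <- : Re (g^`()%classic (s%:C%C * z) * z / g (s%:C%C * z)) -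
        Re (h (s%:C%C * z) * z) = 0 by exact: (is_deriveB d1 d2).
    by rewrite /h /log_derivative mulrAC subrr.
  have c0 : rcont 0 1 (fun=> 0 : R) by move=> x _; exact: cvg_cst.
  have := rint_FTC ler01 c0 du; rewrite Rintegral_cst// mul0r /u.
  have -> : 1%:C%C * z = z by exact: mul1r.
  have -> : 0%:C%C * z = 0 by exact: mul0r.
  rewrite /P P00 addr0 /= subrr subr0 => /esym/eqP.
  by rewrite subr_eq0 => /eqP.
- move=> k; rewrite derive1Sn.
  have z0 : cmod (0 : R[i]) <= r' by rewrite cmod0 ltW.
  have E : {near (0 : R[i]), h =1 P^`()%classic}.
    apply/nbhs_cmodP; exists r' => // w; rewrite subr0 => /dP hw.
    by have [_ ->] := cder_derive1 hw.
  exact: (esym (nbhs_singleton (near_eq_deriven k (hh _ z0) E))).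
Qed.

Lemma cint_le_norm a b (f : R -> R[i]) : ccont a b f ->
  cmod (cint a b f) <= 2 * \int[mu]_(x in `[a, b]) cmod (f x).
Proof.
move=> cf; have cn : rcont a b (fun x => cmod (f x)) by move=> x /cf h; exact: (cvg_cmod _ h).
have nle (u : R -> R) : rcont a b u -> (forall x, `|u x| <= cmod (f x)) ->
    `|\int[mu]_(x in `[a, b]) u x| <= \int[mu]_(x in `[a, b]) cmod (f x).
  move=> cu hu; have iu := rcont_integrable cu.
  apply: le_trans (le_normr_Rintegral _ iu) _ => //.
  apply: le_Rintegral => //; last exact: rcont_integrable.
  exact: (integrable_norm iu).
apply: le_trans (cmod_ReIm _) _; rewrite mulr_natl mulr2n lerD//=.
  by apply: nle; [exact: ccont_Re|move=> x; exact: normr_Re].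
by apply: nle; [exact: ccont_Im|move=> x; exact: normr_Im].
Qed.

(** Jensen's formula without zeros: the mean value property of Re P. The zeros and poles of [f]
    reenter later through the value of [g] at 0. *)
Lemma jensen_mean g r : 0 < r ->
  (forall z, cmod z <= r -> holomorphic_at g z /\ g z != 0) ->
  \int[mu]_(phi in `[0, TP]) ln (cmod (g (r%:C%C * expi phi))) = TP * ln (cmod (g 0)).
Proof.
move=> r0 hg; have [P [hP lnP _]] := holomorphic_log r0 hg.
have lnE phi : ln (cmod (g (r%:C%C * expi phi))) = Re (P (r%:C%C * expi phi)).
  by apply: lnP; rewrite cmod_circle0 ?(ltW r0).
under eq_Rintegral do rewrite lnE.
have := congr1 (@Re R) (circle_mean0 r0 hP); rewrite /= => ->.
by rewrite cReM /= mulr0 subr0 mulrC lnP ?cmod0 ?(ltW r0).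
Qed.

Lemma log_coef_bound g r k : 0 < r ->
  (forall z, cmod z <= r -> holomorphic_at g z /\ g z != 0) ->
  pi * r ^+ k.+1 / k.+1`!%:R * cmod ((log_derivative g)^`(k)%classic 0) <=
  2 * \int[mu]_(phi in `[0, TP]) `|ln (cmod (g (r%:C%C * expi phi)))|.
Proof.
move=> r0 hg; have [P [hP lnP dP]] := holomorphic_log r0 hg.
have lnE phi : ln (cmod (g (r%:C%C * expi phi))) = Re (P (r%:C%C * expi phi)).
  by apply: lnP; rewrite cmod_circle0 ?(ltW r0).
have := congr1 (@cmod R) (circle_coef_Re k r0 hP).
rewrite dP !cmodM cmodV cmodX !cmodR cmod_nat (ger0_norm (pi_ge0 R)) (gtr0_norm r0) => <-.
have cP : ccont 0 TP (fun phi => P (r%:C%C * expi phi)) by exact: ccont_circle0.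
have cR : ccont 0 TP (fun phi => (Re (P (r%:C%C * expi phi)))%:C%C).
  move=> x /(ccont_Re cP) h; apply: cvg_ReIm => //=; exact: cvg_cst.
have cc : ccont 0 TP (fun phi => (Re (P (r%:C%C * expi phi)))%:C%C / expi phi ^+ k.+1).
  by apply: ccontM cR _; exact: ccont_expiXV.
apply: le_trans (cint_le_norm cc) _.
rewrite ler_wpM2l// le_eqVlt; apply/predU1P; left.
apply: eq_Rintegral => phi _.
by rewrite lnE cmodM cmodV cmodX cmod_expi expr1n invr1 mulr1 cmodR.
Qed.

End log_modulus.

(** * Local normal forms of meromorphic functions *)

Section local_forms.
Context {R : realType}.
Implicit Types (f g q G : R[i] -> R[i]) (w z : R[i]) (r : R) (m : nat).

(** The default 0 of [xget] violates 0 < m, so a positive multiplicity is always a genuine order. *)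
Lemma xget_mult (P : nat -> Prop) :
  let m := xget 0%N [set m | (0 < m)%N /\ P m] in
  ((0 < m)%N -> P m) /\ ((exists2 m, (0 < m)%N & P m) -> (0 < m)%N).
Proof.
move=> m; rewrite /m; case: xgetP => [k _ [k0 Pk]|nP]; first by split.
by split => // -[k k0 Pk]; have := nP k; case.
Qed.

Lemma pole_mult_gt0 f z : (0 < pole_mult f z)%N <-> is_pole f z.
Proof.
have [h1 h2] := xget_mult (pole_of_order f z); split=> [h|]; last exact: h2.
by exists (pole_mult f z) => //; exact: h1.
Qed.

Lemma pole_mult_order f z : is_pole f z -> pole_of_order f z (pole_mult f z).
Proof.
by move=> /pole_mult_gt0; have [h1 _] := xget_mult (pole_of_order f z); exact: h1.
Qed.

Lemma near_andC z (P Q : R[i] -> Prop) : (\forall w \near z, P w) ->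
  (\forall w \near z, Q w) -> \forall w \near z, P w /\ Q w.
Proof.
move=> /nbhs_cmodP[r r0 h] /nbhs_cmodP[r' r'0 h'].
apply/nbhs_cmodP; exists (Num.min r r'); first by rewrite lt_min r0.
by move=> w; rewrite lt_min => /andP[wr wr']; split; [exact: h|exact: h'].
Qed.

Lemma punctured_eq_continuous f g z : (\forall w \near z^', f w = g w) ->
  f y @[y --> z] --> f z -> g y @[y --> z] --> g z -> f z = g z.
Proof.
move=> /near_puncturedP[r r0 h] /cvg_nbhs_cmodP cf /cvg_nbhs_cmodP cg.
apply/eqP; rewrite -subr_eq0 -cmod_eq0 eq_le cmod_ge0 andbT.
apply/ler_addgt0Pl => e e0; rewrite addr0.
have e20 : 0 < e / 2 by rewrite divr_gt0.
have [r1 r10 h1] := cf _ e20; have [r2 r20 h2] := cg _ e20.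
have [|y [yr yz _]] := @exists_punctured _ z z (Num.min r (Num.min r1 r2)).
  by rewrite !lt_min r0 r10.
move: yr; rewrite !lt_min => /and3P[yr yr1 yr2].
have -> : f z - g z = (f z - f y) - (g z - g y) by rewrite (h y yr yz); ring.
rewrite ltW// (le_lt_trans (cmodB _ _))// (splitr e) ltrD//; first exact: h1.
exact: h2.
Qed.

Lemma holomorphic_subX (a z : R[i]) m : holomorphic_at (fun w => (w - a) ^+ m) z.
Proof.
exact: (@holomorphicX _ (fun w => w - a) z m (holomorphicB (holomorphic_id z) (holomorphic_cst a z))).
Qed.

(** Otherwise f(w) (w - z)^m would be continuous with value 0 at z, since m > 0, and yet agree near
    z with a function that is nonzero there. *)
Lemma holomorphic_not_pole f z : holomorphic_at f z -> ~ is_pole f z.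
Proof.
move=> hf [m m0 [g [hg gz0 /near_puncturedP[r r0 fg]]]].
pose u w := f w * (w - z) ^+ m.
have hu : holomorphic_at u z by exact: (holomorphicM hf (holomorphic_subX z z m)).
have : u z = g z.
  apply: punctured_eq_continuous; [|exact: holomorphic_continuous..].
  apply/near_puncturedP; exists r => // w wr wz; rewrite /u fg// divfK//.
  by rewrite expf_neq0// subr_eq0.
rewrite /u subrr expr0n; case: m m0 {fg u hu} => // m _; rewrite mulr0 => g0.
by rewrite -g0 eqxx in gz0.
Qed.

Lemma zero_of_order_holomorphic f z m : zero_of_order f z m -> holomorphic_at f z.
Proof.
move=> [g [hg _ fg]]; have {}fg : {near z, (fun w => (w - z) ^+ m * g w) =1 f}.
  by move/nbhs_cmodP : fg => [r r0 h]; apply/nbhs_cmodP; exists r => // w /h ->.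
exact: (near_eq_holomorphic fg (holomorphicM (holomorphic_subX z z m) hg)).
Qed.

Lemma zero_mult_gt0 f z : (0 < zero_mult f z)%N -> is_zero f z.
Proof.
have [h1 _] := xget_mult (zero_of_order f z); move=> h.
have := h1 h => {}h1; split; first exact: zero_of_order_holomorphic h1.
move: h1 => [g [_ _ /nbhs_singleton ->]].
by rewrite subrr expr0n gtn_eqF// mul0r.
Qed.

Lemma zero_mult_order f z : (0 < zero_mult f z)%N -> zero_of_order f z (zero_mult f z).
Proof. by have [h1 _] := xget_mult (zero_of_order f z). Qed.

(** Units of the ring of germs of holomorphic functions at [z]. *)
Definition local_unit q z := holomorphic_at q z /\ q z != 0.

Lemma local_unit_near q z : local_unit q z -> \forall w \near z, local_unit q w.
Proof.
move=> [hq q0]; apply: near_andC; first exact: holomorphic_near.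
exact: near_neq0 (holomorphic_continuous hq) q0.
Qed.

Lemma local_unitM q q' z : local_unit q z -> local_unit q' z ->
  local_unit (fun w => q w * q' w) z.
Proof. by move=> [h1 q1] [h2 q2]; split; [exact: holomorphicM|rewrite mulf_neq0]. Qed.

Lemma local_unitV q z : local_unit q z -> local_unit (fun w => (q w)^-1) z.
Proof. by move=> [h1 q1]; split; [exact: holomorphicV|rewrite invr_neq0]. Qed.

Lemma punctured_lim G q z : (\forall w \near z^', G w = q w) -> q y @[y --> z] --> q z ->
  lim (G @ z^') = q z.
Proof.
move=> /near_puncturedP[r r0 Gq] /cvg_nbhs_cmodP cq.
suff : G @ z^' --> q z by move=> h; apply: cvg_lim h; exact: norm_hausdorff.
apply: (proj2 (cvg_cmodP _ G (q z))) => e e0; have [r' r'0 h'] := cq _ e0.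
apply/near_puncturedP; exists (Num.min r r'); first by rewrite lt_min r0.
by move=> w; rewrite lt_min => /andP[wr wr'] wz; rewrite Gq//; exact: h'.
Qed.

(** Repairs all removable singularities at once: the value no longer depends on what [G] takes at
    [z] itself, be it the arbitrary value of [f] at a pole or a division by 0. *)
Definition regularize G z : R[i] := lim (G @ z^').

Lemma regularizeE G q z : holomorphic_at q z -> (\forall w \near z^', G w = q w) ->
  {near z, q =1 regularize G}.
Proof.
move=> hq Gq; have /near_puncturedP[r r0 h] := Gq.
have /nbhs_cmodP[r' r'0 h'] := holomorphic_near hq.
apply/nbhs_cmodP; exists (Num.min r r'); first by rewrite lt_min r0.
move=> w; rewrite lt_min => /andP[wr wr']; apply: esym.
apply: punctured_lim; last exact: holomorphic_continuous (h' _ wr').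
have [->|wz] := eqVneq w z; first exact: Gq.
have /nbhs_cmodP[e e0 he] := near_disc wr.
apply/near_puncturedP; exists (Num.min e (cmod (w - z))).
  by rewrite lt_min e0 cmod_gt0 subr_eq0.
move=> y; rewrite lt_min => /andP[/he yr yw] _; apply: h; first exact: yr.
by apply: contraTneq yw => ->; rewrite cmodBC ltxx.
Qed.

Lemma regularize_unit G q z : local_unit q z -> (\forall w \near z^', G w = q w) ->
  local_unit (regularize G) z.
Proof.
move=> [hq q0] Gq; have E := regularizeE hq Gq.
split; first exact: near_eq_holomorphic E hq.
by rewrite -(nbhs_singleton E).
Qed.

(** One equation covers regular points, zeros and poles: at most one of the two multiplicities is
    nonzero. Its powers of [w - z] are those that [blaschke_prod_local] produces for the lists of
    poles and zeros. *)
Lemma meromorphic_normal_form f z : meromorphic f -> holomorphic_at f 0 -> f 0 != 0 ->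
  exists2 g, local_unit g z & \forall w \near z^',
    f w * (w - z) ^+ pole_mult f z = (w - z) ^+ zero_mult f z * g w.
Proof.
move=> fm f_hol0 f00; have [p0|ppos] := posnP (pole_mult f z); last first.
  have /pole_mult_gt0 pz := ppos.
  have [g [hg gz0 /near_puncturedP[r r0 h]]] := pole_mult_order pz.
  have -> : zero_mult f z = 0%N.
    apply/eqP; rewrite -leqn0 leqNgt; apply/negP => /zero_mult_gt0[hf _].
    exact: (holomorphic_not_pole hf pz).
  exists g => //; apply/near_puncturedP; exists r => // w wr wz.
  by rewrite h// expr0 mul1r divfK// expf_neq0// subr_eq0.
have hf : holomorphic_at f z.
  have [h|/pole_mult_gt0 pz] := fm z; first exact: h.
  by exfalso; rewrite p0 in pz.
rewrite p0; have [fz0|fz0] := eqVneq (f z) 0; last first.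
  have -> : zero_mult f z = 0%N.
    apply/eqP; rewrite -leqn0 leqNgt; apply/negP => /zero_mult_gt0[_ fz].
    by rewrite fz eqxx in fz0.
  exists f => //; apply/near_puncturedP; exists 1 => // w _ _.
  by rewrite !expr0 mul1r mulr1.
have [m hm] := zero_finite_order fm f_hol0 f00 hf.
have m0 : (0 < m)%N.
  case: m hm => // -[g [_ gz0 /nbhs_singleton]]; rewrite expr0 mul1r fz0 => g0.
  by rewrite -g0 eqxx in gz0.
have [_ h2] := xget_mult (zero_of_order f z).
have zpos : (0 < zero_mult f z)%N by apply: h2; exists m.
have [g [hg gz0 /nbhs_cmodP[r r0 h]]] := zero_mult_order zpos.
exists g => //; apply/near_puncturedP; exists r => // w /h -> _.
by rewrite expr0 mulr1.
Qed.

End local_forms.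

(** * Blaschke products and the bound by the characteristic *)

Section log_derivatives.
Context {R : realType}.
Implicit Types (f g : R[i] -> R[i]) (a b c w z : R[i]) (n : nat).

Lemma derivenD f g z n : holomorphic_at f z -> holomorphic_at g z ->
  (fun y => f y + g y)^`(n)%classic z = f^`(n)%classic z + g^`(n)%classic z.
Proof.
elim: n f g => [//|n ih] f g hf hg; rewrite !derive1Sn.
rewrite -(ih _ _ (holomorphic_at_derive hf) (holomorphic_at_derive hg)).
have E : {near z, (fun y => f^`()%classic y + g^`()%classic y) =1
    (fun y => f y + g y)^`()%classic}.
  have /nbhs_cmodP[r r0 h] := near_andC (holomorphic_near hf) (holomorphic_near hg).
  apply/nbhs_cmodP; exists r; [exact: r0|move=> w /h[fw gw]].
  by have [_ ->] := cder_derive1 (cderD (holomorphic_cder fw) (holomorphic_cder gw)).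
have hfg := holomorphicD (holomorphic_at_derive hf) (holomorphic_at_derive hg).
exact: (esym (nbhs_singleton (near_eq_deriven n hfg E))).
Qed.

Lemma derivenN f z n : holomorphic_at f z ->
  (fun y => - f y)^`(n)%classic z = - f^`(n)%classic z.
Proof.
elim: n f => [//|n ih] f hf; rewrite !derive1Sn.
rewrite -(ih _ (holomorphic_at_derive hf)).
have hN : holomorphic_at (fun y => - f^`()%classic y) z.
  have /holomorphic_discP[r r0 h] := holomorphic_at_derive hf.
  apply/holomorphic_discP; exists r; [exact: r0|move=> w /h[d fw]].
  by exists (- d); exact: cderN.
have E : {near z, (fun y => - f^`()%classic y) =1 (fun y => - f y)^`()%classic}.
  have /nbhs_cmodP[r r0 h] := holomorphic_near hf.
  apply/nbhs_cmodP; exists r; [exact: r0|move=> w /h fw].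
  by have [_ ->] := cder_derive1 (cderN (holomorphic_cder fw)).
exact: (esym (nbhs_singleton (near_eq_deriven n hN E))).
Qed.

Lemma holomorphicN f z : holomorphic_at f z -> holomorphic_at (fun y => - f y) z.
Proof.
move=> /holomorphic_discP[r r0 h].
apply/holomorphic_discP; exists r; [exact: r0|move=> w /h[d fw]].
by exists (- d); exact: cderN.
Qed.

Lemma holomorphic_sum (I : Type) (s : seq I) (F : I -> R[i] -> R[i]) z :
  (forall i, holomorphic_at (F i) z) -> holomorphic_at (fun y => \sum_(i <- s) F i y) z.
Proof.
move=> hF; elim: s => [|i s ih].
  have -> : (fun y => \sum_(i <- [::]) F i y) = fun=> 0.
    by apply/funext => y; rewrite big_nil.
  exact: holomorphic_cst.
have -> : (fun y => \sum_(i <- i :: s) F i y) = fun y => F i y + \sum_(i <- s) F i y.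
  by apply/funext => y; rewrite big_cons.
exact: (holomorphicD (hF i) ih).
Qed.

Lemma deriven_sum (I : Type) (s : seq I) (F : I -> R[i] -> R[i]) z n :
  (forall i, holomorphic_at (F i) z) ->
  (fun y => \sum_(i <- s) F i y)^`(n)%classic z = \sum_(i <- s) (F i)^`(n)%classic z.
Proof.
move=> hF; elim: s => [|i s ih].
  (* The derivative of the empty sum: written as 0 + 0, it equals its own double, hence is 0. *)
  have -> : (fun y => \sum_(i <- [::]) F i y) = fun y => 0 + 0.
    by apply/funext => y; rewrite big_nil addr0.
  have h0 := holomorphic_cst 0 z.
  rewrite big_nil; have := derivenD n h0 h0 => h.
  suff : (fun=> 0 : R[i])^`(n)%classic z = 0 by move=> E; rewrite h E addr0.
  have E : (fun y : R[i] => 0 + 0) = (fun=> 0 : R[i]) by apply/funext => y; rewrite addr0.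
  rewrite E in h; move: ((fun=> 0 : R[i])^`(n)%classic z) h => X h.
  by apply: (@addrI _ X); rewrite addr0 -h.
have -> : (fun y => \sum_(i <- i :: s) F i y) = fun y => F i y + \sum_(i <- s) F i y.
  by apply/funext => y; rewrite big_cons.
by rewrite big_cons -ih; exact: derivenD (hF i) (holomorphic_sum s hF).
Qed.

(** The logarithmic derivative of 1 / (1 - b w), whose n-th Taylor coefficient at 0 is b^(n+1): the
    origin of the power sums. *)
Definition geom b w : R[i] := b / (1 - b * w).

Lemma cder_affine1 b w : cder (fun w => 1 - b * w) w (- b).
Proof.
have := cderB (cder_cst 1 w) (cderZ b (cder_id w)).
by rewrite mulr1 sub0r.
Qed.

Lemma near0_affine_neq0 b : \forall w \near (0 : R[i]), 1 - b * w != 0.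
Proof.
apply: near_neq0; first exact: cder_cvg (cder_affine1 b 0).
by rewrite mulr0 subr0 oner_eq0.
Qed.

Lemma holomorphic_geom b : holomorphic_at (geom b) 0.
Proof.
have /nbhs_cmodP[r r0 h] := near0_affine_neq0 b.
apply/holomorphic_discP; exists r; [exact: r0|move=> w /h bw].
have hV := @cderV _ (fun w => 1 - b * w) w _ bw (cder_affine1 b w).
by eexists; exact: (cderZ b hV).
Qed.

Lemma deriven_geom b n : (geom b)^`(n)%classic 0 = n`!%:R * b ^+ n.+1.
Proof.
pose F n w := n`!%:R * b ^+ n.+1 * ((1 - b * w)^-1) ^+ n.+1.
have cF m w : 1 - b * w != 0 -> cder (F m) w (F m.+1 w).
  move=> bw; have := cderZ (m`!%:R * b ^+ m.+1) (cderX m.+1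
    (@cderV _ (fun w => 1 - b * w) w _ bw (cder_affine1 b w))).
  set d := (X in cder _ _ X); suff -> : d = F m.+1 w by [].
  rewrite /d /F /= factS natrM [in RHS]exprSr [((1 - b * w)^-1) ^+ m.+2]exprSr.
  rewrite [((1 - b * w)^-1) ^+ m.+1 in RHS]exprSr.
  move: (m.+1%:R) (m`!%:R) (b ^+ m.+1) ((1 - b * w)^-1 ^+ m) => A B C D.
  by field.
have hF m : holomorphic_at (F m) 0.
  have /nbhs_cmodP[r r0 h] := near0_affine_neq0 b.
  apply/holomorphic_discP; exists r; [exact: r0|move=> w /h bw].
  by exists (F m.+1 w); exact: cF.
suff /nbhs_singleton <- : {near (0 : R[i]), F n =1 (geom b)^`(n)%classic}.
  by rewrite /F mulr0 subr0 invr1 expr1n mulr1.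
elim: n => [|n ih].
  by apply/nbhs_cmodP; exists 1 => // w _; rewrite /F fact0 mul1r !expr1.
have ih' := near_eq_derive1C (hF n) ih.
have /nbhs_cmodP[r r0 h] := near_andC ih' (near0_affine_neq0 b).
apply/nbhs_cmodP; exists r; [exact: r0|move=> w /h[E bw]].
by have [_ <-] := cder_derive1 (cF n w bw); exact: E.
Qed.

Lemma log_derivativeM f g z : local_unit f z -> local_unit g z ->
  {near z, (fun w => log_derivative f w + log_derivative g w) =1
           log_derivative (fun w => f w * g w)}.
Proof.
move=> uf ug.
have /nbhs_cmodP[r r0 h] := near_andC (local_unit_near uf) (local_unit_near ug).
apply/nbhs_cmodP; exists r; [exact: r0|move=> w /h[[fw fw0] [gw gw0]]].
have [_] := cder_derive1 (cderM (holomorphic_cder fw) (holomorphic_cder gw)).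
rewrite /log_derivative => ->.
by move: (f^`()%classic w) (g^`()%classic w) => df dg; field; rewrite fw0 gw0.
Qed.

Lemma log_derivativeV f z : local_unit f z ->
  {near z, (fun w => - log_derivative f w) =1 log_derivative (fun w => (f w)^-1)}.
Proof.
move=> /local_unit_near /nbhs_cmodP[r r0 h].
apply/nbhs_cmodP; exists r; [exact: r0|move=> w /h[fw fw0]].
have [_] := cder_derive1 (cderV fw0 (holomorphic_cder fw)).
rewrite /log_derivative => ->.
by move: (f^`()%classic w) => df; field.
Qed.

End log_derivatives.

(** * Blaschke factors and products *)

Section blaschke.
Context {R : realType}.
Implicit Types (f : R[i] -> R[i]) (a w z : R[i]) (r : R) (l : seq R[i]).

Definition blaschke r a w : R[i] := r%:C%C * (w - a) / (r%:C%C ^+ 2 - a^*%C * w).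

Definition blaschke_prod r l w : R[i] := \prod_(a <- l) blaschke r a w.

Lemma blaschke_den_neq0 r a z : cmod a < r -> cmod z <= r ->
  r%:C%C ^+ 2 - a^*%C * z != 0.
Proof.
move=> ar zr; have r0 : 0 < r by exact: le_lt_trans (cmod_ge0 _) ar.
rewrite subr_eq0; apply/eqP => /(congr1 (@cmod R)).
rewrite cmodX cmodR cmodM cmod_conj gtr0_norm// => E.
have : cmod a * cmod z < r * r.
  by apply: le_lt_trans (_ : cmod a * r < _); rewrite ?ltr_pM2r// ler_wpM2l ?cmod_ge0.
by rewrite -E expr2 ltxx.
Qed.

Lemma blaschke_den_unit r a z : cmod a < r -> cmod z <= r ->
  local_unit (fun w => r%:C%C / (r%:C%C ^+ 2 - a^*%C * w)) z.
Proof.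
move=> ar zr; have dn := blaschke_den_neq0 ar zr.
have r0 : 0 < r by exact: le_lt_trans (cmod_ge0 _) ar.
have rC : r%:C%C != 0 :> R[i] by rewrite -cmod_gt0 cmodR normr_gt0 gt_eqF.
have hd : holomorphic_at (fun w => r%:C%C ^+ 2 - a^*%C * w) z.
  exact: (holomorphicB (holomorphic_cst _ z)
    (holomorphicM (holomorphic_cst _ z) (holomorphic_id z))).
split; last by rewrite mulf_neq0// invr_neq0.
pose proof (@holomorphicV _ (fun w => r%:C%C ^+ 2 - a^*%C * w) z dn hd) as hV.
exact: (@holomorphicM _ (fun=> r%:C%C) _ z (holomorphic_cst _ z) hV).
Qed.

Lemma blaschkeE r a w : blaschke r a w = (w - a) * (r%:C%C / (r%:C%C ^+ 2 - a^*%C * w)).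
Proof. by rewrite /blaschke; ring. Qed.

Lemma blaschke_unit r a z : cmod a < r -> cmod z <= r -> a != z ->
  local_unit (blaschke r a) z.
Proof.
move=> ar zr az; have -> : blaschke r a = fun w => (w - a) * (r%:C%C / (r%:C%C ^+ 2 - a^*%C * w)).
  by apply/funext => w; exact: blaschkeE.
apply: local_unitM; last exact: blaschke_den_unit.
split; last by rewrite subr_eq0 eq_sym.
exact: (holomorphicB (holomorphic_id z) (holomorphic_cst a z)).
Qed.

Lemma blaschke_prod_local r l z : (forall a, a \in l -> cmod a < r) -> cmod z <= r ->
  exists2 q, local_unit q z &
    forall w, blaschke_prod r l w = (w - z) ^+ count_mem z l * q w.
Proof.
move=> + zr; elim: l => [|a l ih] hl.
  exists (fun=> 1); first by split; [exact: holomorphic_cst|exact: oner_neq0].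
  by move=> w; rewrite /blaschke_prod big_nil expr0 mulr1.
have al : cmod a < r by apply: hl; rewrite mem_head.
have [|q uq hq] := ih; first by move=> b bl; apply: hl; rewrite in_cons bl orbT.
have [az|az] := eqVneq a z; last first.
  exists (fun w => blaschke r a w * q w); first exact: (local_unitM (blaschke_unit al zr az) uq).
  move=> w; rewrite /blaschke_prod big_cons -/(blaschke_prod r l w) hq /= (negbTE az) add0n.
  by rewrite mulrCA.
exists (fun w => r%:C%C / (r%:C%C ^+ 2 - a^*%C * w) * q w).
  exact: (local_unitM (blaschke_den_unit al zr) uq).
move=> w; rewrite /blaschke_prod big_cons -/(blaschke_prod r l w) hq /= az eqxx add1n exprS.
by rewrite blaschkeE; ring.
Qed.

Lemma blaschke_prod_unit r l z : (forall a, a \in l -> cmod a < r) -> cmod z <= r ->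
  z \notin l -> local_unit (blaschke_prod r l) z.
Proof.
move=> hl zr /count_memPn cz; have [q uq hq] := blaschke_prod_local hl zr.
suff -> : blaschke_prod r l = q by [].
by apply/funext => w; rewrite hq cz expr0 mul1r.
Qed.

Lemma cmod_blaschke r a w : cmod a < r -> cmod w = r -> cmod (blaschke r a w) = 1.
Proof.
move=> ar wr; have r0 : 0 < r by exact: le_lt_trans (cmod_ge0 _) ar.
have wa : cmod (w - a) != 0.
  rewrite cmod_eq0 subr_eq0; apply: contraTneq ar => <-.
  by rewrite wr ltxx.
(* On the circle r^2 = w conj(w), so the denominator is w conj(w - a), of modulus r |w - a|. *)
have -> : blaschke r a w = r%:C%C * (w - a) / (w * (w - a)^*%C).
  congr (_ / _); have -> : (w - a)^*%C = w^*%C - a^*%C by exact: (rmorphB (@conjc R)).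
  rewrite mulrBr [w * a^*%C]mulrC; congr (_ - _).
  rewrite -wr expr2; case: w {wa wr} => u v; apply/eqP; rewrite eq_complex !cReM !cImM.
  rewrite /= !mulr0 mul0r subr0 addr0.
  rewrite -expr2 sqr_sqrtr ?addr_ge0 ?sqr_ge0// mulrN opprK -!expr2 eqxx /=.
  by rewrite mulrN mulrC addNr.
rewrite !cmodM cmodV cmodM cmod_conj cmodR gtr0_norm// wr divff// mulf_neq0//.
by rewrite gt_eqF.
Qed.

Lemma cmod_blaschke_prod r l w : (forall a, a \in l -> cmod a < r) -> cmod w = r ->
  cmod (blaschke_prod r l w) = 1.
Proof.
move=> + wr; elim: l => [|a l ih] hl; first by rewrite /blaschke_prod big_nil cmod1.
rewrite /blaschke_prod big_cons cmodM ih => [|b bl]; last first.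
  by apply: hl; rewrite in_cons bl orbT.
by rewrite cmod_blaschke// ?mulr1//; apply: hl; rewrite mem_head.
Qed.

(** A factor has modulus |a| / r at 0. Applied to the poles, this sum is the one that defines N(r,
    f). *)
Lemma ln_blaschke_prod0 r l : 0 < r -> 0 \notin l ->
  ln (cmod (blaschke_prod r l 0)) = - \sum_(a <- l) ln (r / cmod a).
Proof.
move=> r0; elim: l => [|a l ih].
  by rewrite /blaschke_prod !big_nil cmod1 ln1 oppr0.
rewrite in_cons negb_or => /andP[a0 l0]; rewrite /blaschke_prod !big_cons.
have ca : 0 < cmod a by rewrite cmod_gt0 eq_sym.
have cb : cmod (blaschke r a 0) = cmod a / r.
  rewrite /blaschke mulr0 subr0 sub0r cmodM cmodV cmodX cmodM cmodN cmodR gtr0_norm//.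
  by field; rewrite gt_eqF.
have cl : 0 < cmod (blaschke_prod r l 0).
  rewrite /blaschke_prod; elim: (l) l0 => [|b l' ih']; first by rewrite big_nil cmod1.
  rewrite in_cons negb_or => /andP[b0 l0]; rewrite big_cons cmodM mulr_gt0 ?ih'//.
  rewrite /blaschke mulr0 subr0 sub0r cmodM cmodV cmodX cmodM cmodN cmodR gtr0_norm//.
  by rewrite divr_gt0 ?exprn_gt0// mulr_gt0// cmod_gt0 eq_sym.
rewrite cmodM lnM ?posrE ?cb ?divr_gt0// ih// opprD; congr (_ - _).
by rewrite -[cmod a / r]invf_div lnV// posrE divr_gt0.
Qed.

(** The logarithmic derivative of a Blaschke factor in partial fractions: the first term has its
    pole at the reflected point r^2 / conj(a), the second at [a]. *)
Definition blaschke_log r a w : R[i] :=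
  geom (a^*%C / r%:C%C ^+ 2) w - geom a^-1 w.

Lemma log_derivative_blaschke r a : cmod a < r -> a != 0 ->
  {near (0 : R[i]), blaschke_log r a =1 log_derivative (blaschke r a)}.
Proof.
move=> ar a0; have r0 : 0 < r by exact: le_lt_trans (cmod_ge0 _) ar.
have rC : r%:C%C != 0 :> R[i] by rewrite -cmod_gt0 cmodR normr_gt0 gt_eqF.
apply: (proj2 (nbhs_cmodP 0 _)).
exists (cmod a); first by rewrite cmod_gt0.
move=> w; rewrite subr0 => wa.
have dn : r%:C%C ^+ 2 - a^*%C * w != 0.
  by apply: blaschke_den_neq0 => //; rewrite (le_trans (ltW wa))// ltW.
have aw : w - a != 0 by rewrite subr_eq0; apply: contraTneq wa => ->; rewrite ltxx.
have d1 : cder (fun w => w - a) w 1.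
  by have := cderB (cder_id w) (cder_cst a w); rewrite subr0.
have d2 : cder (fun w => r%:C%C ^+ 2 - a^*%C * w) w (- a^*%C).
  have := cderB (cder_cst (r%:C%C ^+ 2) w) (cderZ a^*%C (cder_id w)).
  by rewrite mulr1 sub0r.
have d3 := cderM (cderZ r%:C%C d1)
  (@cderV _ (fun w => r%:C%C ^+ 2 - a^*%C * w) w _ dn d2).
have E : (blaschke r a)^`()%classic w =
    r%:C%C * 1 * (r%:C%C ^+ 2 - a^*%C * w)^-1 +
    r%:C%C * (w - a) * (- - a^*%C / (r%:C%C ^+ 2 - a^*%C * w) ^+ 2).
  by have [_ E] := cder_derive1 d3; exact: E.
rewrite /log_derivative E.
have aw' : 1 - a^-1 * w != 0.
  have -> : 1 - a^-1 * w = - ((w - a) / a) by field.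
  by rewrite oppr_eq0 mulf_neq0// invr_neq0.
have dn' : 1 - a^*%C / r%:C%C ^+ 2 * w != 0.
  have -> : 1 - a^*%C / r%:C%C ^+ 2 * w = (r%:C%C ^+ 2 - a^*%C * w) / r%:C%C ^+ 2 by field.
  by rewrite mulf_neq0// invr_neq0// expf_neq0.
have -> : blaschke_log r a w = a^*%C / (r%:C%C ^+ 2 - a^*%C * w) + (w - a)^-1.
  rewrite /blaschke_log /geom; congr (_ + _).
    have -> : 1 - a^*%C / r%:C%C ^+ 2 * w = (r%:C%C ^+ 2 - a^*%C * w) / r%:C%C ^+ 2 by field.
    by rewrite invf_div mulrA divfK// expf_neq0.
  have -> : 1 - a^-1 * w = - ((w - a) / a) by field.
  by rewrite invrN mulrN opprK invf_div mulrA mulVf// mul1r.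
rewrite /blaschke.
move: (r%:C%C ^+ 2 - a^*%C * w) (w - a) dn aw => u v u0 v0.
by field; rewrite u0 v0 rC.
Qed.

Lemma blaschke_log_deriven r a n :
  (blaschke_log r a)^`(n)%classic 0 =
  n`!%:R * ((a^*%C / r%:C%C ^+ 2) ^+ n.+1 - a^-1 ^+ n.+1).
Proof.
rewrite mulrBr -!deriven_geom.
have h := derivenD n (holomorphic_geom (a^*%C / r%:C%C ^+ 2)) (holomorphicN (holomorphic_geom a^-1)).
by rewrite -derivenN; [exact: h|exact: holomorphic_geom].
Qed.

Lemma holomorphic_blaschke_log r a : holomorphic_at (blaschke_log r a) 0.
Proof. exact: (holomorphicB (holomorphic_geom _) (holomorphic_geom _)). Qed.

Lemma log_derivative_blaschke_prod r l : 0 < r -> (forall a, a \in l -> cmod a < r) -> 0 \notin l ->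
  {near (0 : R[i]), (fun w => \sum_(a <- l) blaschke_log r a w) =1
     log_derivative (blaschke_prod r l)}.
Proof.
move=> r0; elim: l => [|a l ih] hl.
  move=> _; apply/nbhs_cmodP; exists 1; [exact: ltr01|move=> w _]; rewrite big_nil.
  have -> : blaschke_prod r [::] = fun=> 1 by apply/funext => y; rewrite /blaschke_prod big_nil.
  by have [_ E] := cder_derive1 (cder_cst 1 w); rewrite /log_derivative E mul0r.
rewrite in_cons negb_or => /andP[a0 l0].
have ar : cmod a < r by apply: hl; rewrite mem_head.
have hl' b : b \in l -> cmod b < r by move=> bl; apply: hl; rewrite in_cons bl orbT.
have c0 : cmod (0 : R[i]) <= r by rewrite cmod0 ltW.
rewrite eq_sym in a0.
have u1 := blaschke_unit ar c0 a0.
have u2 := blaschke_prod_unit hl' c0 l0.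
have h := near_andC (log_derivativeM u1 u2) (near_andC (log_derivative_blaschke ar a0) (ih hl' l0)).
have /nbhs_cmodP[e e0 he] := h.
apply/nbhs_cmodP; exists e; [exact: e0|move=> w /he[E1 [E2 E3]]].
have -> : blaschke_prod r (a :: l) = fun w => blaschke r a w * blaschke_prod r l w.
  by apply/funext => y; rewrite /blaschke_prod big_cons.
by rewrite big_cons E2 E3; exact: E1.
Qed.

End blaschke.

(** * The coefficient bound at a fixed radius *)

Section radius_bound.
Context {R : realType}.
Implicit Types (f G : R[i] -> R[i]) (a w z : R[i]) (r : R) (l lt ls : seq R[i]).
Local Notation TP := (2 * pi : R).
Local Notation mu := (@lebesgue_measure R).

Lemma lnpE (x : R) : lnp x = (`|ln x| + ln x) / 2.
Proof.
rewrite /lnp; have [h|h] := leP 0 (ln x).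
  by rewrite ger0_norm//; field.
by rewrite ltr0_norm// addNr mul0r.
Qed.

Lemma rcont_ln_cmod (a b : R) (u : R -> R[i]) : ccont a b u ->
  (forall x, a <= x <= b -> u x != 0) -> rcont a b (fun x => ln (cmod (u x))).
Proof.
move=> cu u0 x hx.
have h : cmod (u y) @[y --> x] --> cmod (u x) by exact: (cvg_cmod _ (cu _ hx)).
have c0 : 0 < cmod (u x) by rewrite cmod_gt0 u0.
have hl : ln y @[y --> cmod (u x)] --> ln (cmod (u x)) by exact: (continuous_ln c0).
exact: (cvg_comp (fun x => cmod (u x)) (@ln R) h hl).
Qed.

Lemma local_unit_at f z : meromorphic f -> holomorphic_at f 0 -> f 0 != 0 ->
  pole_mult f z = 0%N -> zero_mult f z = 0%N -> local_unit f z.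
Proof.
move=> fm f_hol0 f00 p0 q0.
have [g [hg gz0]] := meromorphic_normal_form z fm f_hol0 f00.
rewrite p0 q0 => /near_puncturedP[r r0 h].
have hf : holomorphic_at f z.
  have [hf|/pole_mult_gt0 pz] := fm z; first exact: hf.
  by exfalso; rewrite p0 in pz.
split; first exact: hf.
suff -> : f z = g z by exact: gz0.
apply: punctured_eq_continuous (holomorphic_continuous hf) (holomorphic_continuous hg).
apply/near_puncturedP; exists r; [exact: r0|move=> w wr wz].
by have := h w wr wz; rewrite !expr0 mul1r mulr1.
Qed.

Lemma sum_count_mem (V : zmodType) l (F : R[i] -> V) :
  \sum_(a <- l) F a = \sum_(z <- undup l) F z *+ count_mem z l.
Proof.
rewrite -big_undup_iterop_count; apply: eq_bigr => z _.
by rewrite /GRing.natmul.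
Qed.

(** An inequality is what [radius_bound] calls for: the distinct entries of the list form a finite
    subset of the poles, and [esum_ge] bounds the sum below by its part over such a subset. *)
Lemma nev_N_ge f r lt : (forall a, a \in lt -> cmod a < r) -> 0 \notin lt -> 0 < r ->
  (forall z, cmod z <= r -> count_mem z lt = pole_mult f z) ->
  ((\sum_(a <- lt) ln (r / cmod a))%:E <= nev_N r f)%E.
Proof.
move=> hl l0 r0 hc; apply: esum_ge; exists [set` undup lt].
  split; first exact: finite_seq.
  move=> z /=; rewrite mem_undup => zl; have zr := hl _ zl; split => //.
  by apply/pole_mult_gt0; rewrite -hc ?ltW// -has_count has_pred1.
rewrite sum_count_mem -fsbig_seq ?undup_uniq// sumEFin lee_fin.
rewrite le_eqVlt; apply/predU1P; left; rewrite big_seq [RHS]big_seq.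
apply: eq_bigr => z; rewrite mem_undup => /hl zr; by rewrite hc// ltW.
Qed.

Lemma log_derivative_deriven f g r lt ls n : 0 < r ->
  (forall a, a \in lt -> cmod a < r) -> (forall a, a \in ls -> cmod a < r) ->
  0 \notin lt -> 0 \notin ls -> local_unit f 0 ->
  {near (0 : R[i]), (fun w => f w * blaschke_prod r lt w * (blaschke_prod r ls w)^-1) =1 g} ->
  n`!%:R^-1 * (log_derivative f)^`(n)%classic 0
      + \sum_(a <- lt) ((a^*%C / r%:C%C ^+ 2) ^+ n.+1 - a^-1 ^+ n.+1)
      - \sum_(a <- ls) ((a^*%C / r%:C%C ^+ 2) ^+ n.+1 - a^-1 ^+ n.+1) =
  n`!%:R^-1 * (log_derivative g)^`(n)%classic 0.
Proof.
move=> r0 hlt hls lt0 ls0 uf Gg.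
have c0 : cmod (0 : R[i]) <= r by rewrite cmod0 ltW.
have ut := blaschke_prod_unit hlt c0 lt0.
have us := blaschke_prod_unit hls c0 ls0.
have uft := local_unitM uf ut.
have usV := local_unitV us.
have [hG _] := local_unitM uft usV.
pose St w := \sum_(a <- lt) blaschke_log r a w.
pose Ss w := \sum_(a <- ls) blaschke_log r a w.
have E : {near (0 : R[i]), (fun w => (log_derivative f w + St w) + - Ss w) =1 log_derivative g}.
  have h1 := near_andC (log_derivativeM uft usV) (near_andC (log_derivativeM uf ut) (log_derivativeV us)).
  have h2 := near_andC (log_derivative_blaschke_prod r0 hlt lt0)
    (log_derivative_blaschke_prod r0 hls ls0).
  have h3 := near_andC Gg (near_eq_derive1C hG Gg).
  have /nbhs_cmodP[e e0 he] := near_andC h1 (near_andC h2 h3).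
  apply/nbhs_cmodP; exists e; [exact: e0|move=> w /he].
  move=> [[E1 [E2 E3]] [[E4 E5] [E6 E7]]].
  transitivity (log_derivative (fun w => f w * blaschke_prod r lt w *
    (blaschke_prod r ls w)^-1) w); last by rewrite /log_derivative E6 E7.
  by rewrite -E1 -E2 -E3 -E4 -E5.
have hLf : holomorphic_at (log_derivative f) 0.
  move: uf => [hf f0]; exact: (holomorphicM (holomorphic_at_derive hf) (holomorphicV f0 hf)).
have hS l : holomorphic_at (fun w => \sum_(a <- l) blaschke_log r a w) 0.
  exact: (holomorphic_sum l (holomorphic_blaschke_log r)).
have h12 := holomorphicD hLf (hS lt).
have hN := holomorphicN (hS ls).
have <- := nbhs_singleton (near_eq_deriven n (holomorphicD h12 hN) E).
have n0 : n`!%:R != 0 :> R[i] by rewrite pnatr_eq0 -lt0n fact_gt0.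
have dS l : (fun w => \sum_(a <- l) blaschke_log r a w)^`(n)%classic 0 =
    n`!%:R * \sum_(a <- l) ((a^*%C / r%:C%C ^+ 2) ^+ n.+1 - a^-1 ^+ n.+1).
  rewrite (deriven_sum l n (holomorphic_blaschke_log r)) mulr_sumr.
  by apply: eq_bigr => a _; exact: blaschke_log_deriven.
rewrite (derivenD n h12 hN) (derivenD n hLf (hS lt)) (derivenN n (hS ls)) !dS.
by rewrite !mulrDr mulrN !mulrA mulVf// !mul1r.
Qed.

(** The counts for |z| <= r against entries of modulus < r exclude zeros and poles on the circle.
    With S and S' the sums of ln(r / |a|) over poles and zeros, the integral of |ln |g|| is 2 pi (2
    m - ln |f(0)| + S - S'), and S, S' >= 0 bound it by 2 pi (2 (m + S) - ln |f(0)|). The real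
    number [x] = m + S stands in for T(r, f), which is an extended real. *)
Lemma radius_bound f r lt ls n :
  meromorphic f -> holomorphic_at f 0 -> f 0 != 0 -> 0 < r ->
  (forall a, a \in lt -> cmod a < r) -> (forall a, a \in ls -> cmod a < r) ->
  (forall z, cmod z <= r -> count_mem z lt = pole_mult f z) ->
  (forall z, cmod z <= r -> count_mem z ls = zero_mult f z) ->
  exists2 x : R, (x%:E <= nev_T r f)%E &
    pi * r ^+ n.+1 / n.+1%:R * cmod (n`!%:R^-1 * (log_derivative f)^`(n)%classic 0
      + \sum_(a <- lt) ((a^*%C / r%:C%C ^+ 2) ^+ n.+1 - a^-1 ^+ n.+1)
      - \sum_(a <- ls) ((a^*%C / r%:C%C ^+ 2) ^+ n.+1 - a^-1 ^+ n.+1))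
    <= 2 * TP * (2 * x - ln (cmod (f 0))).
Proof.
move=> fm f_hol0 f00 r0 hlt hls clt cls.
have unit_f z : cmod z <= r -> z \notin lt -> z \notin ls -> local_unit f z.
  move=> zr /count_memPn zt /count_memPn zs; apply: local_unit_at => //.
    by rewrite -clt.
  by rewrite -cls.
have c0 : cmod (0 : R[i]) <= r by rewrite cmod0 ltW.
have lt0 : 0 \notin lt.
  apply/count_memPn; rewrite clt//; apply/eqP; rewrite -leqn0 leqNgt.
  by apply/negP => /pole_mult_gt0; exact: holomorphic_not_pole.
have ls0 : 0 \notin ls.
  apply/count_memPn; rewrite cls//; apply/eqP; rewrite -leqn0 leqNgt.
  by apply/negP => /zero_mult_gt0[_ f0]; rewrite f0 eqxx in f00.
have circ_notin l z : (forall a, a \in l -> cmod a < r) -> cmod z = r -> z \notin l.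
  by move=> hl zr; apply/negP => /hl; rewrite zr ltxx.
pose G w := f w * blaschke_prod r lt w * (blaschke_prod r ls w)^-1.
have unit_G z : cmod z <= r -> z \notin lt -> z \notin ls -> local_unit G z.
  move=> zr zt zs; apply: local_unitM.
    by apply: local_unitM; [exact: unit_f|exact: blaschke_prod_unit].
  by apply: local_unitV; exact: blaschke_prod_unit.
pose g := regularize G.
have gG z : cmod z <= r -> z \notin lt -> z \notin ls -> {near z, G =1 g}.
  move=> zr zt zs; have [hG _] := unit_G z zr zt zs.
  by apply: regularizeE => //; apply/near_puncturedP; exists 1.
(* At a zero or a pole the powers of [w - z] in [f] and in the two Blaschke products cancel, because
   the lists count multiplicities; a unit is left. *)
have unit_g z : cmod z <= r -> local_unit g z.
  move=> zr; have [q uq] := meromorphic_normal_form z fm f_hol0 f00.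
  move=> /near_puncturedP[e e0 he].
  have [q1 uq1 E1] := blaschke_prod_local hlt zr.
  have [q2 uq2 E2] := blaschke_prod_local hls zr.
  have /nbhs_cmodP[e' e'0 he'] := local_unit_near uq2.
  apply: (@regularize_unit _ G (fun w => q w * q1 w * (q2 w)^-1)).
    by apply: local_unitM; [exact: local_unitM|exact: local_unitV].
  apply/near_puncturedP; exists (Num.min e e'); first by rewrite lt_min e0.
  move=> w; rewrite lt_min => /andP[we we'] wz.
  have [_ q20] := he' _ we'.
  rewrite /G E1 E2 clt// cls// mulrA he// invfM.
  have pz : (w - z) ^+ zero_mult f z != 0 by rewrite expf_neq0// subr_eq0.
  by move: ((w - z) ^+ zero_mult f z) pz => X X0; field; rewrite X0 q20.
pose I (u : R -> R) := \int[mu]_(phi in `[0, TP]) u phi.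
have cr phi : cmod (r%:C%C * expi phi) = r by rewrite cmod_circle0 ?(ltW r0).
have g_circ phi : cmod (g (r%:C%C * expi phi)) = cmod (f (r%:C%C * expi phi)).
  have zr := cr phi; set z := r%:C%C * expi phi in zr *.
  have zt := circ_notin _ _ hlt zr; have zs := circ_notin _ _ hls zr.
  have zr' : cmod z <= r by rewrite zr.
  rewrite -(nbhs_singleton (gG z zr' zt zs)) /G !cmodM cmodV.
  by rewrite !cmod_blaschke_prod// invr1 !mulr1.
have clng : rcont 0 TP (fun phi => ln (cmod (g (r%:C%C * expi phi)))).
  apply: rcont_ln_cmod.
    by apply: (ccont_circle0 r0) => z zr; exact: (unit_g z zr).1.
  by move=> x _; apply: (unit_g _ _).2; rewrite cr.
have iln := rcont_integrable clng.
have inln : mu.-integrable `[0, TP] (EFin \o (fun phi => `|ln (cmod (g (r%:C%C * expi phi)))|)).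
  exact: (integrable_norm iln).
pose m := I (fun phi => lnp (cmod (f (circle_point r phi)))) / TP.
have TP0 : TP != 0 by rewrite gt_eqF// twopi_gt0.
have IE : I (fun phi => `|ln (cmod (g (r%:C%C * expi phi)))|) =
    2 * (TP * m) - I (fun phi => ln (cmod (g (r%:C%C * expi phi)))).
  have -> : TP * m = I (fun phi => (`|ln (cmod (g (r%:C%C * expi phi)))| +
      ln (cmod (g (r%:C%C * expi phi)))) * 2^-1).
    rewrite /m mulrC divfK//; apply: eq_Rintegral => phi _.
    by rewrite lnpE circle_pointE g_circ.
  rewrite /I RintegralZr//; last exact: (integrableD _ inln iln).
  by rewrite RintegralD//; field.
have lng0 : ln (cmod (g 0)) = ln (cmod (f 0)) - \sum_(a <- lt) ln (r / cmod a)
    + \sum_(a <- ls) ln (r / cmod a).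
  rewrite -(nbhs_singleton (gG 0 c0 lt0 ls0)) /G !cmodM cmodV.
  have [_ b1] := blaschke_prod_unit hlt c0 lt0.
  have [_ b2] := blaschke_prod_unit hls c0 ls0.
  rewrite -cmod_gt0 in b1; rewrite -cmod_gt0 in b2.
  have f0' : 0 < cmod (f 0) by rewrite cmod_gt0.
  rewrite lnM ?posrE ?mulr_gt0 ?invr_gt0// lnM ?posrE// lnV ?posrE//.
  by rewrite !ln_blaschke_prod0// opprK.
have hs0 l : (forall a, a \in l -> cmod a < r) -> 0 \notin l -> 0 <= \sum_(a <- l) ln (r / cmod a).
  move=> hl l0; rewrite big_seq sumr_ge0// => a al.
  have a0 : 0 < cmod a by rewrite cmod_gt0; apply: contraNneq l0 => <-.
  by rewrite ln_ge0// ler_pdivlMr// mul1r ltW// hl.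
exists (m + \sum_(a <- lt) ln (r / cmod a)).
  rewrite EFinD /nev_T; apply: leeD; last exact: nev_N_ge.
  rewrite /nev_m /m mulrC EFinM; apply: lee_wpmul2l.
    by rewrite lee_fin invr_ge0 ltW// twopi_gt0.
  rewrite /I /Rintegral fineK//; apply: integrable_fin_num => //.
  have : mu.-integrable `[0, TP] (EFin \o (fun phi => (`|ln (cmod (g (r%:C%C * expi phi)))| +
      ln (cmod (g (r%:C%C * expi phi)))) * 2^-1)).
    apply: rcont_integrable => x hx; have h := clng x hx.
    by apply: cvgM; [apply: cvgD => //; exact: cvg_norm|exact: cvg_cst].
  apply: eq_integrable => // phi _ /=.
  by rewrite lnpE circle_pointE g_circ.
have hb := log_coef_bound n r0 unit_g.
have hj := jensen_mean r0 unit_g.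
have -> : n`!%:R^-1 * (log_derivative f)^`(n)%classic 0
      + \sum_(a <- lt) ((a^*%C / r%:C%C ^+ 2) ^+ n.+1 - a^-1 ^+ n.+1)
      - \sum_(a <- ls) ((a^*%C / r%:C%C ^+ 2) ^+ n.+1 - a^-1 ^+ n.+1) =
      n`!%:R^-1 * (log_derivative g)^`(n)%classic 0.
  exact: (log_derivative_deriven n r0 hlt hls lt0 ls0 (unit_f 0 c0 lt0 ls0) (gG 0 c0 lt0 ls0)).
have fn0 : n`!%:R != 0 :> R by rewrite pnatr_eq0 -lt0n fact_gt0.
have n10 : n.+1%:R != 0 :> R by rewrite pnatr_eq0.
rewrite cmodM cmodV cmod_nat.
have -> : pi * r ^+ n.+1 / n.+1%:R * (n`!%:R^-1 * cmod ((log_derivative g)^`(n)%classic 0)) =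
  pi * r ^+ n.+1 / (n.+1)`!%:R * cmod ((log_derivative g)^`(n)%classic 0).
  by rewrite factS natrM invfM !mulrA.
apply: le_trans hb _; rewrite -/(I _) IE [X in 2 * (_ - X)]hj lng0.
rewrite -[2 * TP * _]mulrA ler_wpM2l//.
have -> : 2 * (TP * m) - TP * (ln (cmod (f 0)) - \sum_(a <- lt) ln (r / cmod a) + \sum_(a <- ls) ln (r / cmod a)) =
  TP * (2 * m - ln (cmod (f 0)) + \sum_(a <- lt) ln (r / cmod a) - \sum_(a <- ls) ln (r / cmod a)).
  by ring.
rewrite ler_wpM2l ?(ltW twopi_gt0)//.
by have := hs0 _ hlt lt0; have := hs0 _ hls ls0; lra.
Qed.

End radius_bound.

(** * Sums over the zeros and poles *)

Section families.
Context {R : realType}.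
Implicit Types (w : nat -> R) (D : set nat) (u : nat -> R[i]) (r : R).

Lemma bounded_tail w (S : R) : (forall i, 0 <= w i) ->
  (forall n, \sum_(0 <= i < n) w i <= S) ->
  forall e, 0 < e -> exists m, forall n, \sum_(m <= i < n) w i < e.
Proof.
move=> w0 wS e e0; pose E : set R := range (fun n => \sum_(0 <= i < n) w i).
have supE : has_sup E by split; [exists 0, 0%N; rewrite ?big_nil//; rewrite big_geq|exists S => _ [n _ <-]].
have [_ [m _ <-] hm] := sup_adherent e0 supE.
exists m => n; have [mn|nm] := leqP m n; last by rewrite big_geq// ltnW.
have : \sum_(0 <= i < n) w i <= sup E by apply: ub_le_sup; [case: supE|exists n].
rewrite (big_cat_nat (n := m))//= => h; lra.
Qed.

Definition weight D u k (i : nat) : R := if i \in D then (cmod (u i) ^+ k)^-1 else 0.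

Lemma weight_ge0 D u k i : 0 <= weight D u k i.
Proof. by rewrite /weight; case: ifP => // _; rewrite invr_ge0 exprn_ge0 ?cmod_ge0. Qed.

Lemma sum_weight D u k m n :
  \sum_(m <= i < n | i \in D) (cmod (u i) ^+ k)^-1 = \sum_(m <= i < n) weight D u k i.
Proof. by rewrite big_mkcond. Qed.

Lemma esum_weight D u k :
  (\esum_(n in D) ((cmod (u n) ^+ k)^-1)%:E < +oo)%E ->
  exists S, forall n, \sum_(0 <= i < n) weight D u k i <= S.
Proof.
set E := (\esum_(n in D) _)%E => Eoo.
have E0 : (0 <= E)%E.
  by apply: esum_ge0 => n _; rewrite lee_fin invr_ge0 exprn_ge0 ?cmod_ge0.
exists (fine E) => n; rewrite -lee_fin fineK; last by rewrite ge0_fin_numE.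
apply: esum_ge; exists [set` [seq i <- index_iota 0 n | i \in D]].
  split; first exact: finite_seq.
  by move=> i /=; rewrite mem_filter => /andP[/set_mem].
rewrite -fsbig_seq ?filter_uniq ?iota_uniq// sumEFin lee_fin.
by rewrite big_filter -sum_weight.
Qed.

(** A single term is at most the bound [S], so 1 / |u i| <= max(1, S), using k0 > 0; the additional
    k - k0 factors therefore cost only a constant. *)
Lemma weight_bound D u k0 k : (0 < k0 <= k)%N ->
  (exists S, forall n, \sum_(0 <= i < n) weight D u k0 i <= S) ->
  exists S, forall n, \sum_(0 <= i < n) weight D u k i <= S.
Proof.
move=> /andP[k00 kk] [S hS]; pose C := Num.max 1 S.
have C1 : 1 <= C by rewrite le_max lexx.
have C0 : 0 <= C by exact: le_trans C1.
have wS i : weight D u k0 i <= S.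
  apply: le_trans (hS i.+1); rewrite big_nat_recr//= lerDr.
  by rewrite sumr_ge0// => j _; exact: weight_ge0.
have hw i : weight D u k i <= C ^+ (k - k0) * weight D u k0 i.
  have := wS i; rewrite /weight; case: ifP => _ wSi; last by rewrite mulr0.
  set y := cmod (u i) in wSi *; have y0 : 0 <= y^-1 by rewrite invr_ge0 cmod_ge0.
  have yC : y^-1 <= C.
    have [y1|/ltW y1] := leP y^-1 1; first exact: le_trans C1.
    rewrite le_max; apply/orP; right; apply: le_trans wSi; rewrite -exprVn.
    by rewrite -[leLHS]expr1 ler_weXn2l.
  rewrite -!exprVn -{1}(subnK kk) exprD; apply: ler_wpM2r; first exact: exprn_ge0.
  by rewrite lerXn2r ?nnegrE.
exists (C ^+ (k - k0) * S) => n; apply: le_trans (ler_sum _ (fun i _ => hw i)) _.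
by rewrite -mulr_sumr ler_wpM2l ?exprn_ge0.
Qed.

(** A term with |u i| <= r is at least r^-k, which a sufficiently late tail of a convergent sum
    cannot contain. Hence the points in a disc have bounded indices. *)
Lemma index_bound D u k : (0 < k)%N -> (forall i, D i -> u i != 0) ->
  (exists S, forall n, \sum_(0 <= i < n) weight D u k i <= S) ->
  forall r, exists n, forall i, D i -> cmod (u i) <= r -> (i < n)%N.
Proof.
move=> k0 u0 [S hS] r; have [r0|r0] := leP r 0.
  exists 0%N => i /u0 ui ur; have : 0 < cmod (u i) by rewrite cmod_gt0.
  by rewrite ltNge (le_trans ur r0).
have rk : 0 < (r ^+ k)^-1 by rewrite invr_gt0 exprn_gt0.
have [m hm] := bounded_tail (weight_ge0 D u k) hS rk.
exists m => i Di ur; rewrite ltnNge; apply/negP => mi.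
have := hm i.+1; rewrite big_nat_recr//= ltNge => /negP; apply.
rewrite {2}/weight mem_set//; apply: ler_wpDl.
  by rewrite sumr_ge0// => j _; exact: weight_ge0.
have ui : 0 < cmod (u i) by rewrite cmod_gt0 u0.
by rewrite lef_pV2 ?posrE ?exprn_gt0// lerXn2r ?nnegrE ?cmod_ge0 ?(ltW r0).
Qed.

Lemma card_eq_seq (T : choiceType) (s : seq T) : uniq s -> ([set` s] #= `I_(size s))%card.
Proof.
elim: s => [_|x s ih /= /andP[xs us]].
  by rewrite II0 card_eq0; apply/eqP/seteqP; split.
apply/eq_cardSP; exists x; first by rewrite /= mem_head.
have -> : [set` x :: s] `\ x = [set` s].
  apply/seteqP; split => y /=; rewrite in_cons.
    by move=> [/predU1P[->|//] nx]; case: nx.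
  by move=> ys; split; [rewrite ys orbT|move=> yx; rewrite -yx ys in xs].
exact: ih.
Qed.

Lemma lists_gt0 D u (mult : R[i] -> nat) n : lists D u mult -> D n -> (0 < mult (u n))%N.
Proof.
move=> hl Dn; rewrite lt0n; apply/eqP => m0; have := hl (u n); rewrite m0 II0 card_eq0.
by move=> /eqP/seteqP[h _]; exact: (h n (conj Dn erefl)).
Qed.

Definition points_in D u r n : seq R[i] :=
  [seq u i | i <- index_iota 0 n & (i \in D) && (cmod (u i) < r)].

Lemma mem_points_in D u r n a : a \in points_in D u r n -> cmod a < r.
Proof.
rewrite /points_in => /mapP[x].
by rewrite mem_filter => /andP[/andP[_ h] _] ->.
Qed.

(** As no listed point has modulus [r], the strict inequality in [points_in] loses no point of the
    closed disc. *)
Lemma lists_count D u (mult : R[i] -> nat) r n z : lists D u mult ->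
  (forall i, D i -> cmod (u i) <= r -> (i < n)%N) ->
  (forall i, D i -> cmod (u i) != r) ->
  cmod z <= r -> count_mem z (points_in D u r n) = mult z.
Proof.
move=> hl hn hr zr.
pose s := [seq i <- index_iota 0 n | (u i == z) && ((i \in D) && (cmod (u i) < r))].
have -> : count_mem z (points_in D u r n) = size s.
  by rewrite /points_in count_map -size_filter -filter_predI.
have us : uniq s by rewrite filter_uniq ?iota_uniq.
have E : [set n | D n /\ u n = z] = [set` s].
  apply/seteqP; split => i /=; rewrite mem_filter.
    move=> [Di ui]; rewrite ui eqxx mem_set//= lt_neqAle zr andbT.
    rewrite mem_index_iota /= hn ?ui// andbT.
    by have := hr i Di; rewrite ui.
  by move=> /andP[/and3P[/eqP ui /set_mem Di _] _].
have := hl z; rewrite E => h1.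
have h2 := card_eq_seq us.
apply/card_eq_II; apply: card_eq_trans h1; by rewrite card_eq_sym.
Qed.

Lemma big_points_in (V : zmodType) D u r n (F : R[i] -> V) :
  \sum_(a <- points_in D u r n) F a =
  \sum_(0 <= i < n | (i \in D) && (cmod (u i) < r)) F (u i).
Proof. by rewrite /points_in big_map big_filter. Qed.

(** For the first [n] indices the powers of 1 / u i cancel and only the reflected parts remain,
    which vanish as r grows. For later indices |u i| < r gives |u i| / r^2 <= 1 / |u i|, so each
    term is at most twice its weight and the tail is small uniformly in [r]. *)
Lemma family_limit D u k : (0 < k)%N -> (forall i, D i -> u i != 0) ->
  (exists S, forall n, \sum_(0 <= i < n) weight D u k i <= S) ->
  forall e, 0 < e -> exists m, forall n, (m <= n)%N -> exists r0, forall r n',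
    r0 <= r -> (forall i, D i -> cmod (u i) <= r -> (i < n')%N) ->
    cmod (\sum_(a <- points_in D u r n') ((a^*%C / r%:C%C ^+ 2) ^+ k - a^-1 ^+ k) +
          \sum_(0 <= i < n | i \in D) (u i ^+ k)^-1) <= e.
Proof.
move=> k0 u0 [S hS] e e0; have e30 : 0 < e / 3 by rewrite divr_gt0.
have [m hm] := bounded_tail (weight_ge0 D u k) hS e30; exists m => n mn.
pose A := \sum_(0 <= i < n) cmod (u i).
pose B := \sum_(0 <= i < n) cmod (u i) ^+ k.
have A0 : 0 <= A by rewrite sumr_ge0// => i _; exact: cmod_ge0.
have B0 : 0 <= B by rewrite sumr_ge0// => i _; rewrite exprn_ge0 ?cmod_ge0.
(* [A] brings the first [n] points inside the disc, r >= 1 bounds r^(-2k) by 1/r, and [3 * B / e]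
   makes B / r <= e / 3. *)
exists (1 + A + 3 * B / e) => r n' hr hn'.
have Be : 0 <= 3 * B / e by rewrite divr_ge0 ?mulr_ge0// ltW.
have r1 : 1 <= r by lra.
have r0 : 0 < r by lra.
have ur i : (i < n)%N -> cmod (u i) < r.
  move=> ni; have : cmod (u i) <= A.
    rewrite /A big_mkord (bigD1 (Ordinal ni))//= lerDl.
    by rewrite sumr_ge0// => j _; exact: cmod_ge0.
  lra.
pose N := maxn n n'.
have nN : (n <= N)%N by rewrite leq_maxl.
have n'N : (n' <= N)%N by rewrite leq_maxr.
pose F a := (a^*%C / r%:C%C ^+ 2) ^+ k - a^-1 ^+ k : R[i].
have -> : \sum_(a <- points_in D u r n') F a =
    \sum_(0 <= i < N | (i \in D) && (cmod (u i) < r)) F (u i).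
  rewrite big_points_in [RHS](big_cat_nat (n := n'))//= [X in _ + X]big1_seq ?addr0//.
  move=> i /andP[/andP[/set_mem Di ui]]; rewrite mem_index_iota => /andP[n'i _].
  by have := hn' i Di (ltW ui); rewrite ltnNge n'i.
rewrite (big_cat_nat (n := n))//=.
have -> : \sum_(0 <= i < n | (i \in D) && (cmod (u i) < r)) F (u i) =
   \sum_(0 <= i < n | i \in D) F (u i).
  rewrite big_nat_cond [RHS]big_nat_cond; apply: eq_bigl => i.
  by case: ltnP => //= ni; rewrite ur// andbT.
rewrite addrAC -big_split /=.
have -> : \sum_(0 <= i < n | i \in D) (F (u i) + (u i ^+ k)^-1) =
    \sum_(0 <= i < n | i \in D) ((u i)^*%C / r%:C%C ^+ 2) ^+ k.
  by apply: eq_bigr => i _; rewrite /F exprVn subrK.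
have cr : cmod (r%:C%C : R[i]) = r by rewrite cmodR gtr0_norm.
have h1 : cmod (\sum_(0 <= i < n | i \in D) ((u i)^*%C / r%:C%C ^+ 2) ^+ k) <= e / 3.
  apply: le_trans (cmod_sum _ _ _) _.
  have : \sum_(0 <= i < n | i \in D) cmod (((u i)^*%C / r%:C%C ^+ 2) ^+ k) <= B / r.
    rewrite /B mulr_suml big_mkcond; apply: ler_sum => i _.
    have ck0 : 0 <= cmod (u i) ^+ k / r by rewrite divr_ge0 ?exprn_ge0 ?cmod_ge0 ?(ltW r0).
    case: ifP => // _; rewrite cmodX cmodM cmodV cmodX cmod_conj cr exprMn.
    rewrite ler_wpM2l ?exprn_ge0 ?cmod_ge0// exprVn lef_pV2 ?posrE ?exprn_gt0//.
    by rewrite -exprM -[leLHS]expr1 ler_weXn2l// muln_gt0.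
  move=> /le_trans; apply; rewrite ler_pdivrMr//.
  have : 3 * B / e <= r by lra.
  by rewrite ler_pdivrMr// => h; lra.
have h2 : cmod (\sum_(n <= i < N | (i \in D) && (cmod (u i) < r)) F (u i)) <= 2 * (e / 3).
  apply: le_trans (cmod_sum _ _ _) _.
  have : \sum_(n <= i < N | (i \in D) && (cmod (u i) < r)) cmod (F (u i)) <=
      2 * \sum_(n <= i < N) weight D u k i.
    rewrite mulr_sumr big_mkcond; apply: ler_sum => i _.
    case: ifP => [/andP[iD uir]|_]; last by rewrite mulr_ge0// weight_ge0.
    have ui0 : 0 < cmod (u i) by rewrite cmod_gt0 u0//; exact: set_mem.
    rewrite /weight iD /F; apply: le_trans (cmodB _ _) _.
    rewrite mulr_natl mulr2n; apply: lerD; last by rewrite cmodX cmodV exprVn.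
    rewrite cmodX cmodM cmodV cmodX cmod_conj cr -[leRHS]exprVn lerXn2r ?nnegrE//.
    - by rewrite divr_ge0 ?cmod_ge0// exprn_ge0// ltW.
    - by rewrite invr_ge0 ltW.
    - rewrite ler_pdivrMr ?exprn_gt0// mulrC ler_pdivlMr// expr2.
      by apply: ler_pM; rewrite ?cmod_ge0 ?(ltW uir).
  move=> /le_trans; apply; rewrite ler_wpM2l//.
  have := hm N; rewrite (big_cat_nat (n := n))//= => h.
  have : 0 <= \sum_(m <= i < n) weight D u k i by rewrite sumr_ge0// => i _; exact: weight_ge0.
  by move=> h'; lra.
apply: le_trans (cmodD _ _) _.
by have := lerD h1 h2; lra.
Qed.

End families.

(** * Letting the radius tend to infinity *)

Section coefficient_limit.
Context {R : realType}.
Implicit Types (f : R[i] -> R[i]) (D : set nat) (u : nat -> R[i]) (r : R).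
Local Notation TP := (2 * pi : R).

(** The values of both sequences, interleaved by parity in [w], form a countable set, of measure 0;
    an interval of length 1 has points outside it. *)
Lemma good_radius (u v : nat -> R) (A : R) :
  exists2 r, A < r & forall n, u n != r /\ v n != r.
Proof.
apply: contrapT => H.
pose w n := if odd n then v n./2 else u n./2.
have cB : countable (range w) by exact: card_image_le.
have AB : `]A, A + 1[ `<=` range w.
  move=> r /=; rewrite in_itv /= => /andP[Ar _]; apply: contrapT => nB.
  apply: H; exists r => // n; split; apply/eqP => E; apply: nB.
    by exists n.*2 => //; rewrite /w odd_double doubleK.
  by exists n.*2.+1 => //; rewrite /w /= odd_double /= uphalf_double.
have := countable_lebesgue_measure0 (sub_countable (subset_card_le AB) cB).
rewrite lebesgue_measure_itv /= lte_fin ltrDl ltr01 -EFinB => -[].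
by rewrite addrAC subrr add0r => /eqP; rewrite oner_eq0.
Qed.

(** Phrased for reals below T(r, f), the form in which [radius_bound] delivers its bound; finiteness
    of T(r, f) then never has to be discussed. *)
Lemma nev_T_small f k :
  limf_esup (fun r : R => nev_T r f * ((r ^+ k)^-1)%:E)%E (pinfty_nbhs R) = 0%E ->
  forall e, 0 < e -> exists2 r0, 0 < r0 & forall r x, r0 < r -> (x%:E <= nev_T r f)%E ->
    x <= e * r ^+ k.
Proof.
rewrite limf_esupE => E0 e e0.
have : (ereal_inf [set ereal_sup ((fun r : R => nev_T r f * ((r ^+ k)^-1)%:E)%E @` V) |
   V in pinfty_nbhs R] < e%:E)%E by rewrite E0 lte_fin.
move=> /ereal_inf_lt[_ [V [M [_ MV]] <-] hV].
exists (Num.max 1 M); first by rewrite lt_max ltr01.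
move=> r x; rewrite gt_max => /andP[r1 Mr] xT.
have r0 : 0 < r by exact: lt_trans r1.
have rk : 0 < (r ^+ k)^-1 by rewrite invr_gt0 exprn_gt0.
have h : (nev_T r f * ((r ^+ k)^-1)%:E < e%:E)%E.
  apply: le_lt_trans hV; apply: ereal_sup_ubound; exists r => //; exact: MV.
have : (x%:E * ((r ^+ k)^-1)%:E < e%:E)%E.
  apply: le_lt_trans h; apply: lee_wpmul2r => //.
  by rewrite lee_fin ltW.
by rewrite -EFinM lte_fin ltr_pdivrMr ?exprn_gt0// => /ltW.
Qed.

Lemma coefficient_limit f (N0 N : nat) (Dt Ds : set nat) (t s : nat -> R[i]) :
  meromorphic f -> holomorphic_at f 0 -> f 0 != 0 ->
  lists Dt t (pole_mult f) -> lists Ds s (zero_mult f) ->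
  (\esum_(n in Dt) ((cmod (t n) ^+ N0.+1)^-1)%:E < +oo)%E ->
  (\esum_(n in Ds) ((cmod (s n) ^+ N0.+1)^-1)%:E < +oo)%E ->
  limf_esup (fun r : R => nev_T r f * ((r ^+ N0.+1)^-1)%:E)%E (pinfty_nbhs R) = 0%E ->
  (N0 <= N)%N ->
  \sum_(0 <= k < n | k \in Dt) (t k ^+ N.+1)^-1 -
  \sum_(0 <= k < n | k \in Ds) (s k ^+ N.+1)^-1 @[n --> \oo] -->
  (N`!)%:R^-1 * (log_derivative f)^`(N)%classic 0.
Proof.
move=> fm f_hol0 f00 lt ls sumt sums Tsmall NN.
have t0 i : Dt i -> t i != 0.
  move=> /(lists_gt0 lt) /pole_mult_gt0 p; apply/eqP => ti; rewrite ti in p.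
  exact: (holomorphic_not_pole f_hol0 p).
have s0 i : Ds i -> s i != 0.
  move=> /(lists_gt0 ls) /zero_mult_gt0[_ fs]; apply/eqP => si.
  by rewrite si in fs; rewrite fs eqxx in f00.
have NK : (0 < N0.+1 <= N.+1)%N by [].
have bt := weight_bound NK (esum_weight sumt).
have bs := weight_bound NK (esum_weight sums).
have it := index_bound (ltn0Sn N) t0 bt.
have is_ := index_bound (ltn0Sn N) s0 bs.
apply/cvg_cmodP => e e0.
have e4 : 0 < e / 4 by rewrite divr_gt0.
have [m1 h1] := family_limit (ltn0Sn N) t0 bt e4.
have [m2 h2] := family_limit (ltn0Sn N) s0 bs e4.
(* The number [n] of terms is fixed before the radius: neither the partial sums nor the coefficient
   depends on [r], which may be taken as large as [n] requires. *)
exists (maxn m1 m2) => // n /=; rewrite geq_max => /andP[m1n m2n].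
have [r1 hr1] := h1 n m1n; have [r2 hr2] := h2 n m2n.
pose K : R := N.+1%:R.
have K0 : 0 < K by rewrite ltr0n.
(* With X = r^(N+1), [radius_bound] yields X |v + Qt - Qs| <= 8 K x + 4 K l0. The choice of [e5]
   makes the first term at most (e / 8) X, and r >= [r4] does the same for the second. The three
   errors of e / 4 then stay below e. *)
pose e5 := e / (64 * K).
have e50 : 0 < e5 by rewrite divr_gt0// mulr_gt0.
have [r3 r30 hr3] := nev_T_small Tsmall e50.
pose l0 := `|ln (cmod (f 0))|.
have l00 : 0 <= l0 by exact: normr_ge0.
pose r4 := 32 * K * l0 / e.
have r40 : 0 <= r4 by rewrite divr_ge0 ?(ltW e0)// !mulr_ge0 ?(ltW K0).
have [r hr goodr] := good_radius (fun i => cmod (t i)) (fun i => cmod (s i))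
  (1 + `|r1| + `|r2| + r3 + r4).
have p1 := ler_norm r1; have p2 := ler_norm r2.
have q1 := normr_ge0 r1; have q2 := normr_ge0 r2.
have r1' : r1 <= r by clear - p1 p2 q1 q2 hr r30 r40; lra.
have r2' : r2 <= r by clear - p1 p2 q1 q2 hr r30 r40; lra.
have r3' : r3 < r by clear - p1 p2 q1 q2 hr r30 r40; lra.
have r4' : r4 <= r by clear - p1 p2 q1 q2 hr r30 r40; lra.
have r_ge1 : 1 <= r by clear - p1 p2 q1 q2 hr r30 r40; lra.
have r_gt0 : 0 < r by exact: lt_le_trans r_ge1.
have [n1 hn1] := it r; have [n2 hn2] := is_ r.
pose v : R[i] := N`!%:R^-1 * (log_derivative f)^`(N)%classic 0.
pose Q D u n' : R[i] := \sum_(a <- points_in D u r n')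
  ((a^*%C / r%:C%C ^+ 2) ^+ N.+1 - a^-1 ^+ N.+1).
pose Qt := Q Dt t n1; pose Qs := Q Ds s n2.
have [x xT hS] : exists2 x : R, (x%:E <= nev_T r f)%E &
    pi * r ^+ N.+1 / N.+1%:R * cmod (v + Qt - Qs) <= 2 * TP * (2 * x - ln (cmod (f 0))).
  apply: radius_bound fm f_hol0 f00 r_gt0 _ _ _ _.
  - by move=> a; exact: mem_points_in.
  - by move=> a; exact: mem_points_in.
  - by move=> z; apply: lists_count lt hn1 _ => j _; exact: (goodr j).1.
  - by move=> z; apply: lists_count ls hn2 _ => j _; exact: (goodr j).2.
have k1 := hr1 r n1 r1' hn1; have k2 := hr2 r n2 r2' hn2.
rewrite -/(Q Dt t n1) -/Qt in k1; rewrite -/(Q Ds s n2) -/Qs in k2.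
set At := \sum_(0 <= k < n | k \in Dt) _ in k1 *.
set As := \sum_(0 <= k < n | k \in Ds) _ in k2 *.
rewrite -/v.
have bS : cmod (v + Qt - Qs) <= e / 4.
  have xr : x <= e5 * r ^+ N.+1.
    apply: le_trans (hr3 r x r3' xT) _; rewrite ler_wpM2l ?(ltW e50)//.
    by rewrite ler_weXn2l.
  have rN : r <= r ^+ N.+1 by rewrite -[leLHS]expr1 ler_weXn2l.
  set X := r ^+ N.+1 in hS xr rN *.
  have X0 : 0 < X by rewrite exprn_gt0.
  have lb : - ln (cmod (f 0)) <= l0 by rewrite /l0 -normrN ler_norm.
  have pi0 : 0 < pi :> R by exact: pi_gt0.
  set Y := cmod _ in hS *.
  have hS' : X * Y <= 4 * K * (2 * x - ln (cmod (f 0))).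
    have E : pi * X / K * Y = (pi / K) * (X * Y) by field; rewrite gt_eqF.
    have E2 : 2 * TP * (2 * x - ln (cmod (f 0))) = (pi / K) * (4 * K * (2 * x - ln (cmod (f 0)))).
      by field; rewrite gt_eqF.
    by move: hS; rewrite -/K E E2 ler_pM2l// divr_gt0.
  have h4 : 4 * K * l0 <= e / 8 * X.
    have : r4 <= X by exact: le_trans r4' rN.
    by rewrite /r4 ler_pdivrMr// => h; lra.
  have h5 : 8 * K * x <= e / 8 * X.
    have : 8 * K * x <= 8 * K * (e5 * X) by rewrite ler_wpM2l ?mulr_ge0 ?(ltW K0).
    have -> : 8 * K * (e5 * X) = e / 8 * X by rewrite /e5; field; rewrite gt_eqF.
    by [].
  have h6 : 4 * K * (2 * x - ln (cmod (f 0))) <= 8 * K * x + 4 * K * l0.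
    have : 4 * K * - ln (cmod (f 0)) <= 4 * K * l0 by rewrite ler_wpM2l ?mulr_ge0 ?(ltW K0).
    by move=> h; lra.
  rewrite -(ler_pM2l X0); apply: le_trans hS' _; apply: le_trans h6 _.
  by clear - h4 h5; lra.
have -> : v - (At - As) = (v + Qt - Qs) - (Qt + At) + (Qs + As) by ring.
apply: le_lt_trans (cmodD _ _) _.
have k3 := le_trans (cmodB _ _) (lerD bS k1).
apply: le_lt_trans (lerD k3 k2) _.
by clear - e0; lra.
Qed.

End coefficient_limit.

(** * Families with vanishing power sums *)

Section power_sums.
Context {R : realType}.
Implicit Types (D : set nat) (u : nat -> R[i]) (q : R[i]).

Lemma geometric_sum_le q K : cmod q <= 1 -> q != 1 ->
  cmod (\sum_(k < K) q ^+ k.+1) <= 2 / cmod (1 - q).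
Proof.
move=> q1 qN1; have dq : 0 < cmod (1 - q) by rewrite cmod_gt0 subr_eq0 eq_sym.
have E : (1 - q) * \sum_(k < K) q ^+ k.+1 = q - q ^+ K.+1.
  elim: K => [|K ih]; first by rewrite big_ord0 mulr0 expr1 subrr.
  by rewrite big_ord_recr /= mulrDr ih [q ^+ K.+2]exprS; ring.
rewrite ler_pdivlMr// mulrC -cmodM E; apply: le_trans (cmodB _ _) _.
have : cmod q ^+ K.+1 <= 1 by rewrite exprn_ile1 ?cmod_ge0.
by rewrite cmodX; lra.
Qed.

Lemma geometric_mean_le q K : cmod q <= 1 -> (0 < K)%N ->
  cmod (K%:R^-1 * \sum_(k < K) q ^+ k.+1) <= cmod q.
Proof.
move=> q1 K0; have K0' : 0 < K%:R :> R by rewrite ltr0n.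
rewrite cmodM cmodV cmod_nat mulrC ler_pdivrMr//.
apply: le_trans (cmod_sum _ _ _) _.
have : \sum_(k < K) cmod (q ^+ k.+1) <= \sum_(k < K) cmod q.
  apply: ler_sum => k _; rewrite cmodX exprS ler_piMr ?cmod_ge0//.
  by rewrite exprn_ile1 ?cmod_ge0.
by move=> /le_trans; apply; rewrite sumr_const card_ord mulr_natr.
Qed.

Lemma cvg_sum0 K (c : nat -> R[i]) (S : nat -> nat -> R[i]) :
  (forall k, S k n @[n --> \oo] --> (0 : R[i])) ->
  \sum_(k < K) c k * S k n @[n --> \oo] --> (0 : R[i]).
Proof.
move=> hS; elim: K => [|K ih].
  have -> : (fun n => \sum_(k < 0) c k * S k n) = fun=> 0.
    by apply/funext => n; rewrite big_ord0.
  exact: cvgCC.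
have -> : (fun n => \sum_(k < K.+1) c k * S k n) =
    (fun n => \sum_(k < K) c k * S k n + c K * S K n).
  by apply/funext => n; rewrite big_ord_recr.
pose proof (cvgCD ih (cvgCM (cvgCC (c K)) (hS K))) as h.
by rewrite mulr0 addr0 in h.
Qed.

(* Normalizing by a term of least modulus, the Cesaro means of the powers of
   [q j = (u j0 / u j) ^ M] tend to 1 if [q j = 1] and to 0 otherwise, so that the
   sum of these means over [j] stays away from 0. *)
Lemma power_sums_zero D u M : (0 < M)%N -> (forall j, D j -> u j != 0) ->
  (exists S, forall n, \sum_(0 <= j < n) weight D u M j <= S) ->
  (forall k, (1 <= k)%N ->
     \sum_(0 <= j < n | j \in D) (u j ^+ (k * M))^-1 @[n --> \oo] --> (0 : R[i])) ->
  forall j, ~ D j.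
Proof.
move=> M0 u0 bw hk jD Dj.
have [n0 hn0] := index_bound M0 u0 bw (cmod (u jD)).
have jn : (jD < n0)%N by apply: hn0.
have [j0 [Dj0 minj0]] : exists j0, D j0 /\ forall j, D j -> cmod (u j0) <= cmod (u j).
  pose P (j : 'I_n0) := (j : nat) \in D.
  have P0 : P (Ordinal jn) by rewrite /P /= mem_set.
  case: (@Order.TotalTheory.arg_minP _ R 'I_n0 (Ordinal jn) P (fun j : 'I_n0 => cmod (u j)) P0).
  move=> j0 /set_mem Dj0 hj0; exists j0; split => // j Dj'.
  have [jn0|n0j] := ltnP j n0.
    by apply: (hj0 (Ordinal jn0)); rewrite /P /= mem_set.
  apply: le_trans (hj0 (Ordinal jn) P0) _; rewrite /= leNgt; apply/negP => h.
  by have := hn0 j Dj' (ltW h); rewrite ltnNge n0j.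
have uj0 := u0 _ Dj0; have cj0 : 0 < cmod (u j0) by rewrite cmod_gt0.
pose q j := (u j0 / u j) ^+ M.
have cq j : D j -> cmod (q j) = cmod (u j0) ^+ M * weight D u M j.
  by move=> Dj'; rewrite /q /weight mem_set// cmodX cmodM cmodV exprMn exprVn.
have q1 j : D j -> cmod (q j) <= 1.
  move=> Dj'; rewrite /q cmodX cmodM cmodV exprn_ile1 ?divr_ge0 ?cmod_ge0//.
  by rewrite ler_pdivrMr ?cmod_gt0 ?u0// mul1r minj0.
pose rho := cmod (u j0) ^+ M; have rho0 : 0 < rho by rewrite exprn_gt0.
have [S hS] := bw.
(* The mean [c j] is at most rho times the weight of [j] whatever [K] is, so this tail contributes
   at most 1/4 and [m] can be fixed before [K]. *)
have e0 : 0 < 4^-1 / rho by rewrite divr_gt0.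
have [m0 hm0] := bounded_tail (weight_ge0 D u M) hS e0.
pose m := maxn m0 j0.+1.
have m0m : (m0 <= m)%N by rewrite leq_maxl.
have j0m : (j0 < m)%N by rewrite leq_maxr.
pose z j : R := if (j \in D) && (q j != 1) then 2 / cmod (1 - q j) else 0.
have z0 j : 0 <= z j.
  by rewrite /z; case: ifP => // _; rewrite divr_ge0 ?cmod_ge0.
pose Z := \sum_(0 <= j < m) z j.
have Z0 : 0 <= Z by rewrite sumr_ge0.
(* With this many powers averaged, the indices below [m] with q j != 1 contribute at most Z / K <=
   1/4. Together with the tail this leaves at least 1/2 of the 1 contributed by [j0]; further
   indices with q j = 1 only add to the real part. *)
pose K := (Num.bound (4 * Z)).+1.
have K0 : 0 < K%:R :> R by rewrite ltr0n.
have ZK : Z / K%:R <= 4^-1.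
  rewrite ler_pdivrMr//.
  have : 4 * Z < (Num.bound (4 * Z))%:R by apply: archi_boundP; rewrite mulr_ge0.
  have : (Num.bound (4 * Z))%:R <= K%:R :> R by rewrite ler_nat.
  by clear; lra.
pose c j : R[i] := K%:R^-1 * \sum_(k < K) q j ^+ k.+1.
have KC : K%:R != 0 :> R[i] by rewrite pnatr_eq0.
have c1 j : q j = 1 -> c j = 1.
  move=> qj; rewrite /c qj; under eq_bigr do rewrite expr1n.
  by rewrite sumr_const card_ord mulVf.
have cz j : D j -> q j != 1 -> cmod (c j) <= z j / K%:R.
  move=> Dj' qj; rewrite /c cmodM cmodV cmod_nat mulrC ler_wpM2r ?invr_ge0 ?(ltW K0)//.
  by rewrite /z mem_set//= qj; apply: geometric_sum_le => //; exact: q1.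
have cw j : D j -> cmod (c j) <= rho * weight D u M j.
  by move=> Dj'; rewrite -cq//; apply: geometric_mean_le => //; exact: q1.
have lower n : (m <= n)%N -> 2^-1 <= cmod (\sum_(0 <= j < n | j \in D) c j).
  move=> mn; rewrite (big_cat_nat (n := m))//=.
  set A := \sum_(0 <= j < m | j \in D) c j; set B := \sum_(m <= j < n | j \in D) c j.
  have bB : cmod B <= 4^-1.
    apply: le_trans (cmod_sum _ _ _) _.
    have : \sum_(m <= j < n | j \in D) cmod (c j) <= rho * \sum_(m <= j < n) weight D u M j.
      rewrite mulr_sumr big_mkcond; apply: ler_sum => j _; case: ifP => [jD'|_].
        by apply: cw; move: jD' => /set_mem.
      by rewrite mulr_ge0 ?weight_ge0 ?(ltW rho0).
    move=> /le_trans; apply; have := hm0 n.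
    rewrite (big_cat_nat (n := m))//= ltr_pdivlMr// => h.
    have h' : 0 <= \sum_(m0 <= j < m) weight D u M j by rewrite sumr_ge0// => j _; exact: weight_ge0.
    rewrite mulrC; apply: le_trans (ltW h); rewrite ler_wpM2r ?(ltW rho0)//.
    by rewrite lerDr.
  have bA : 1 - 4^-1 <= Re A.
    have ReA : Re A = \sum_(0 <= j < m | j \in D) Re (c j).
      by rewrite /A; elim/big_ind2 : _ => // a x b y <- <-; rewrite cReD.
    have lb j : (if j == j0 then 1 else 0) - z j / K%:R <= (if j \in D then Re (c j) else 0).
      have [/set_mem Dj'|nD] := boolP (j \in D); last first.
        case: eqP nD => [-> /negP|_ _]; first by rewrite mem_set.
        by rewrite sub0r oppr_le0 divr_ge0 ?z0 ?(ltW K0).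
      have [qj|qj] := eqVneq (q j) 1.
        rewrite c1//= lerBlDr -[leLHS]addr0 lerD//; first by case: ifP.
        by rewrite divr_ge0 ?z0 ?(ltW K0).
      have jj0 : (j == j0) = false.
        by apply/negP => /eqP jj; rewrite jj /q divff// expr1n eqxx in qj.
      rewrite jj0 sub0r lerNl; apply: le_trans (cz _ Dj' qj).
      by apply: le_trans (normr_Re _); rewrite -normrN ler_norm.
    rewrite ReA [leRHS]big_mkcond; apply: le_trans (ler_sum _ (fun j _ => lb j)).
    rewrite sumrB -mulr_suml -/Z lerB//.
    rewrite (bigD1_seq j0) ?iota_uniq ?mem_index_iota//= eqxx lerDl.
    by rewrite sumr_ge0// => j _; case: ifP.
  have := cmod_sub A (- B); rewrite opprK cmodN => h.
  have h' := le_trans (ler_norm _) (normr_Re A).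
  by clear - h h' bA bB; lra.
(* Exchanging the sums writes the means as a fixed finite combination of power sums, each of which
   tends to 0. *)
have lim0 : \sum_(0 <= j < n | j \in D) c j @[n --> \oo] --> (0 : R[i]).
  have -> : (fun n => \sum_(0 <= j < n | j \in D) c j) = (fun n => \sum_(k < K)
      (K%:R^-1 * u j0 ^+ (k.+1 * M)) * \sum_(0 <= j < n | j \in D) (u j ^+ (k.+1 * M))^-1).
    apply/funext => n; rewrite /c; under eq_bigr do rewrite mulr_sumr.
    rewrite exchange_big /=; apply: eq_bigr => k _; rewrite mulr_sumr.
    by apply: eq_bigr => j _; rewrite /q -exprM mulnC exprMn exprVn mulrA.
  apply: (@cvg_sum0 K (fun k => K%:R^-1 * u j0 ^+ (k.+1 * M))
    (fun k n => \sum_(0 <= j < n | j \in D) (u j ^+ (k.+1 * M))^-1)).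
  by move=> k; exact: hk.
have half0 : 0 < 2^-1 :> R by rewrite invr_gt0.
have /cvg_cmodP /(_ _ half0)[n1 _ hn1] := lim0.
have := lower (maxn m n1) (leq_maxl _ _).
have := hn1 (maxn m n1) (leq_maxr _ _); rewrite sub0r cmodN.
by move=> h1 /(lt_le_trans h1); rewrite ltxx.
Qed.

(** [zero_mult] would also be 0 at a zero of infinite order; [zero_finite_order] excludes this case,
    so every zero is listed. *)
Lemma is_zero_mult (f : R[i] -> R[i]) z : meromorphic f -> holomorphic_at f 0 -> f 0 != 0 ->
  is_zero f z -> (0 < zero_mult f z)%N.
Proof.
move=> fm f_hol0 f00 [hz fz0].
have [m hm] := zero_finite_order fm f_hol0 f00 hz.
have m0 : (0 < m)%N.
  case: m hm => // -[g [_ gz0 /nbhs_singleton]]; rewrite expr0 mul1r fz0 => g0.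
  by rewrite -g0 eqxx in gz0.
by have [_ h] := xget_mult (zero_of_order f z); apply: h; exists m.
Qed.

End power_sums.

Theorem theorem6 (R : realType) (N0 : nat) (f : R[i] -> R[i])
    (Dt Ds : set nat) (t s : nat -> R[i])
    (f_mero : meromorphic f)
    (f_holo0 : holomorphic_at f 0)
    (f0_neq0 : f 0 != 0)
    (t_poles : lists Dt t (pole_mult f))
    (s_zeros : lists Ds s (zero_mult f))
    (t_summable : (\esum_(n in Dt) ((cmod (t n) ^+ N0.+1)^-1)%:E < +oo)%E)
    (T_small : limf_esup (fun r : R => nev_T r f * ((r ^+ N0.+1)^-1)%:E)%E
                 (pinfty_nbhs R) = 0%E) :
  ((forall z, ~ is_zero f z) ->
    forall N : nat, (N0 <= N)%N ->
      has_sum Dt (fun n => (t n ^+ N.+1)^-1)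
        ((N`!)%:R^-1 * (log_derivative f)^`(N)%classic 0))
  /\
  ((\esum_(n in Ds) ((cmod (s n) ^+ N0.+1)^-1)%:E < +oo)%E ->
   (exists2 M : nat, (N0.+1 <= M)%N &
      forall k : nat, (1 <= k)%N ->
        has_sum Dt (fun n => (t n ^+ (k * M))^-1)
          (((k * M).-1`!)%:R^-1 * (log_derivative f)^`((k * M).-1)%classic 0)) ->
   forall z, ~ is_zero f z).
Proof.
have limit (sums : (\esum_(n in Ds) ((cmod (s n) ^+ N0.+1)^-1)%:E < +oo)%E) N (NN : (N0 <= N)%N) :
    \sum_(0 <= k < n | k \in Dt) (t k ^+ N.+1)^-1 -
    \sum_(0 <= k < n | k \in Ds) (s k ^+ N.+1)^-1 @[n --> \oo] -->
    (N`!)%:R^-1 * (log_derivative f)^`(N)%classic 0.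
  exact: (coefficient_limit f_mero f_holo0 f0_neq0 t_poles s_zeros t_summable sums T_small NN).
split.
- move=> nozero N NN.
  (* Without zeros the index set [Ds] is empty, so its summability is trivial and its sum disappears
     from [limit]. *)
  have Ds0 n : ~ Ds n.
    by move=> /(lists_gt0 s_zeros) /zero_mult_gt0; exact: nozero.
  have sums : (\esum_(n in Ds) ((cmod (s n) ^+ N0.+1)^-1)%:E < +oo)%E.
    have -> : Ds = set0 by apply/seteqP; split => // n /Ds0.
    by rewrite esum_set0 ltry.
  have h := limit sums N NN.
  have E : (fun n => \sum_(0 <= k < n | k \in Dt) (t k ^+ N.+1)^-1 -
      \sum_(0 <= k < n | k \in Ds) (s k ^+ N.+1)^-1) =
      (fun n => \sum_(0 <= k < n | k \in Dt) (t k ^+ N.+1)^-1).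
    apply/funext => n; rewrite [X in _ - X]big_pred0 ?subr0// => k.
    by apply/negP => /set_mem /Ds0.
  by rewrite E in h; exact: h.
- move=> sums [M NM hM] z zz.
  have s0 n : Ds n -> s n != 0.
    move=> /(lists_gt0 s_zeros) /zero_mult_gt0[_ fs]; apply/eqP => sn.
    by rewrite sn in fs; rewrite fs eqxx in f0_neq0.
  have M0 : (0 < M)%N by exact: leq_trans NM.
  have N0M : (0 < N0.+1 <= M)%N by [].
  have noDs : forall n, ~ Ds n.
    apply: (power_sums_zero M0 s0 (weight_bound N0M (esum_weight sums))) => k k1.
    have kM0 : (0 < k * M)%N by rewrite muln_gt0 k1.
    (* [limit] at N = k M - 1 concerns exactly the powers k M; subtracting it from the hypothesis on
       the poles leaves the power sums of the zeros. *)
    have NkM : (N0 <= (k * M).-1)%N.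
      by rewrite -ltnS prednK//; apply: leq_trans NM _; rewrite leq_pmull.
    have h1 := hM k k1; have h2 := limit sums _ NkM.
    rewrite (prednK kM0) in h2; rewrite /has_sum in h1.
    pose proof (cvgCB h1 h2) as h; rewrite subrr in h.
    have E : (fun n => \sum_(0 <= j < n | j \in Dt) (t j ^+ (k * M))^-1 -
        (\sum_(0 <= j < n | j \in Dt) (t j ^+ (k * M))^-1 -
         \sum_(0 <= j < n | j \in Ds) (s j ^+ (k * M))^-1)) =
        (fun n => \sum_(0 <= j < n | j \in Ds) (s j ^+ (k * M))^-1).
      by apply/funext => n; rewrite opprB addrC subrK.
    by rewrite E in h; exact: h.
  have := is_zero_mult f_mero f_holo0 f0_neq0 zz.
  rewrite lt0n => /eqP; apply; have := s_zeros z.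
  have -> : [set n | Ds n /\ s n = z] = set0.
    by apply/seteqP; split => // n [/noDs].
  by rewrite -II0 => /card_eq_II <-.
Qed.
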